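(* Let $I,J,K,L$ be increasing tuples in $\{1,\dots,n\}$ with $|I|=|J|=r$, $|K|=|L|=s$, $r+s=n$, $I\cap K=\emptyset$, $J\cap L=C$, $|C|=z$. Let $N$ be the length of the standard row tower of $I$ in $\{1,\dots,n\}$ and $M$ the length of the standard column tower of $J\setminus C$ in $(J\cup L)\setminus C$. Then in $\mathcal O_q(M_n(k))$ $$q^{-z}[K,L][I,J]=\sum_{i=0}^{M+N}(q^{-1}-q)^i\sum_{(Z,W)\in C_i^{I,J\setminus C}}\mathrm{sign}(Z,W)\,(-q)^{-l(W)-l(W')}\,[Z,(W\cup C)_{ord}]\,[Z',(W'\cup C)_{ord}],$$ where the lists $C_i^{I,J\setminus C}$ and the signs are those defined in the context with row set $U=\{1,\dots,n\}$ and column set $V=(J\cup L)\setminus C$.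
   Context: Let $k$ be a field, $q$ an indeterminate, $k_q=k[q,q^{-1}]$. $\mathcal O_q(M_n(k))$ is the $k_q$-algebra generated by $x_{ij}$, $1\le i,j\le n$, with relations: $x_{ij}x_{ik}=q^{-1}x_{ik}x_{ij}$ and $x_{ji}x_{ki}=q^{-1}x_{ki}x_{ji}$ for $j<k$; $x_{ij}x_{kl}=x_{kl}x_{ij}$ if $i<k,\ j>l$ or $i>k,\ j<l$; $x_{ij}x_{kl}-x_{kl}x_{ij}=(q^{-1}-q)x_{kj}x_{il}$ if $i<k,\ j<l$. Quantum minors: for increasing tuples $A=(a_1<\dots<a_p)$, $B=(b_1<\dots<b_p)$, $[A,B]=\sum_{\sigma\in S_p}(-q)^{-l(\sigma)}x_{a_1b_{\sigma(1)}}\cdots x_{a_pb_{\sigma(p)}}$, with $l(\sigma)$ the number of inversions. For a tuple $S$ of distinct integers, $S_{ord}$ is its increasing rearrangement and $l(S)$ its number of inversions; for tuples $A,B$ of distinct entries not necessarily increasing, $[A,B]:=(-q)^{-l(A)-l(B)}[A_{ord},B_{ord}]$. $(W\cup C)_{ord}$ is the increasing tuple with entries those of $W$ and $C$. Increasing tuples are also regarded as sets. Towers in ordered sets: a finite set of integers $V=\{v_1<\dots<v_m\}$ is identified with $\{1,\dots,m\}$ via $v_a\leftrightarrow a$; ''$m',m'+1$'' and transpositions refer to consecutive elements of the set. Standard column tower of an increasing $p$-tuple $B$ in $V\cong\{1,\dots,m\}$: if $B\ne(m-p+1,\dots,m)$ put $b_{p+1}=m+1$, let $a$ be the largest index in $\{1,\dots,p\}$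 with $b_{a+1}-b_a>1$, $\sigma_B=(b_a,b_a+1)$; iterating gives $B=B_M<\dots<B_0=(m-p+1,\dots,m)$, $B_{s-1}=\sigma_s^c(B_s)$, $\sigma^c_s=\sigma_{B_s}$. Standard row tower of an increasing $p$-tuple $A$ in an ordered set $U\cong\{1,\dots,u\}$: if $A\ne(1,\dots,p)$ put $a_0=0$, let $b$ be the smallest index in $\{1,\dots,p\}$ with $a_b-a_{b-1}>1$, $\sigma_A=(a_b,a_b-1)$; iterating gives $A=A_N>\dots>A_0=(1,\dots,p)$, $A_{t-1}=\sigma_t^r(A_t)$, $\sigma^r_t=\sigma_{A_t}$. Lists $C_i^{A,B}$ (rows $A$ in $U$, columns $B$ in $V$; $|A|,|B|$ may differ): finite lists (with multiplicity) of elements written $(Z,W)$, each carrying a sign; an element records four tuples $Z,Z',W,W'$ of distinct, not necessarily increasing entries, $Z'$ (resp. $W'$) having as entries the complement of $Z$ in $U$ (resp. of $W$ in $V$). $C_0^{A_0,B_0}$ consists of the single element $(A_0,B_0)$ with increasing complements; $C_i^{A_t,B_s}$ is empty if $i<0$ or $i>s+t$. Column steps, $1\le s\le M$: $C_i^{A_0,B_s}$ is the concatenation of $C_{i-1}^{A_0,B_{s-1}}$ with $\phi_{i-1}^{A_0,B_{s-1}}$ removed and of $\sigma^c_s(C_i^{A_0,B_{s-1}})$, where $\sigma^c_s=(m',m'+1)$ acts on every entry of $W$ and $W'$ (no reordering) and $\phi_{i-1}^{A_0,B_{s-1}}$ is the sublist of elements for which $m'$ appears before $m'+1$ in the concatenated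 tuple $(W,W')$. Elements of $C_i^{A_0,B_s}$ have sign $(-1)^i$. Row steps, $1\le t\le N$: $C_i^{A_t,B_M}$ is the concatenation of $C_{i-1}^{A_{t-1},B_M}$ with $\psi_{i-1}^{A_{t-1},B_M}$ removed and of $\sigma^r_t(C_i^{A_{t-1},B_M})$, where $\sigma^r_t=(m',m'+1)$ acts on every entry of $Z$ and $Z'$ (no reordering) and $\psi_{i-1}^{A_{t-1},B_M}$ is the sublist of elements for which $m'+1$ appears before $m'$ in the concatenated tuple $(Z,Z')$. In row steps signs are inherited unchanged. Finally $C_i^{A,B}:=C_i^{A_N,B_M}$. Sums over $C_i^{A,B}$ count multiplicity. *)

(* Defs.v *)
From HB Require Import structures.
From mathcomp Require Import all_boot all_order all_algebra all_fingroup.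
From mathcomp Require Import generic_quotient ring_quotient.
From mathcomp Require Import boolp.
From mathcomp Require Import monalg zify.

Set Implicit Arguments.
Unset Strict Implicit.
Unset Printing Implicit Defensive.

Import GRing.Theory.
Local Open Scope ring_scope.

Local Notation "p %:F" := (@FracField.tofrac _ p).

(** ** The ring k[q, q^-1], as a subring of k(q) *)

Section Laurent.
Variable k : fieldType.

Definition laurent_pred : {pred {fraction {poly k}}} :=
  fun f => `[< exists (p : {poly k}) (m : nat), f = p%:F / ('X%:F) ^+ m >].

Fact tofracX_neq0 : ('X : {poly k})%:F != 0.
Proof. by rewrite tofrac_eq0 polyX_eq0. Qed.

Fact laurent_subring : subring_closed laurent_pred.
Proof.
have X0 m : ('X : {poly k})%:F ^+ m != 0 by rewrite expf_neq0 ?tofracX_neq0.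
split=> [|f g /asboolP[p [m ->]] /asboolP[p' [m' ->]]
         |f g /asboolP[p [m ->]] /asboolP[p' [m' ->]]]; apply/asboolP.
- by exists 1, 0%N; rewrite tofrac1 expr0 divr1.
- exists (p * 'X ^+ m' - p' * 'X ^+ m), (m + m')%N.
  by rewrite -mulNr addf_div // tofracB !tofracM !tofracXn mulNr exprD.
- by exists (p * p'), (m + m')%N; rewrite mulf_div tofracM exprD.
Qed.

HB.instance Definition _ :=
  GRing.isSubringClosed.Build {fraction {poly k}} laurent_pred laurent_subring.

Record laurent : predArgType :=
  Laurent { laurent_val : {fraction {poly k}}; _ : laurent_val \in laurent_pred }.

HB.instance Definition _ := [isSub for laurent_val].
HB.instance Definition _ := [Choice of laurent by <:].
HB.instance Definition _ := [SubChoice_isSubComNzRing of laurent by <:].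

Fact laurent_q_subproof : ('X : {poly k})%:F \in laurent_pred.
Proof. by apply/asboolP; exists 'X, 0%N; rewrite expr0 divr1. Qed.

Fact laurent_qV_subproof : (('X : {poly k})%:F)^-1 \in laurent_pred.
Proof. by apply/asboolP; exists 1, 1%N; rewrite tofrac1 expr1 div1r. Qed.

Definition q : laurent := Laurent laurent_q_subproof.
Definition qV : laurent := Laurent laurent_qV_subproof.

Lemma mulqqV : q * qV = 1.
Proof. by apply: val_inj; rewrite /= mulfV ?tofracX_neq0. Qed.

End Laurent.

Arguments q {k}.
Arguments qV {k}.

(** ** Quotient of an algebra by the two-sided ideal generated by [S] *)

Inductive ideal_gen (R : nzRingType) (S : R -> Prop) : R -> Prop :=
| ideal_gen_incl x of S x : ideal_gen S x
| ideal_gen0 : ideal_gen S 0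
| ideal_genD x y of ideal_gen S x & ideal_gen S y : ideal_gen S (x + y)
| ideal_genMl a x of ideal_gen S x : ideal_gen S (a * x)
| ideal_genMr a x of ideal_gen S x : ideal_gen S (x * a).

Section QuotientAlgebra.
Variables (R : comNzRingType) (A : algType R) (S : A -> Prop).

Definition gen_ideal : {pred A} := fun f => `[< ideal_gen S f >].

Fact gen_ideal_zmod : zmod_closed gen_ideal.
Proof.
split=> [|f g /asboolP If /asboolP Ig]; apply/asboolP; first exact: ideal_gen0.
by apply: ideal_genD => //; rewrite -mulN1r; apply: ideal_genMl.
Qed.

HB.instance Definition _ := GRing.isZmodClosed.Build A gen_ideal gen_ideal_zmod.

Fact gen_idealMl a f : f \in gen_ideal -> a * f \in gen_ideal.
Proof. by move=> /asboolP If; apply/asboolP; apply: ideal_genMl. Qed.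

Fact gen_idealMr a f : f \in gen_ideal -> f * a \in gen_ideal.
Proof. by move=> /asboolP If; apply/asboolP; apply: ideal_genMr. Qed.

(* The MathComp algebra hierarchy requires [1 != 0]. *)
Definition quot_alg of ~ ideal_gen S 1 := {ideal_quot gen_ideal}.

Hypothesis S1 : ~ ideal_gen S 1.
Local Notation Q := (quot_alg S1).
HB.instance Definition _ := GRing.Zmodule.on Q.

Definition quot_pi (f : A) : Q := (\pi_{ideal_quot gen_ideal} f)%qT.

Lemma quot_piP f g : quot_pi f = quot_pi g <-> f - g \in gen_ideal.
Proof. by rewrite Quotient.idealrBE; split=> [|/eqP] // fg; apply/eqP. Qed.

Let rp (x : Q) : A := repr (x : {ideal_quot gen_ideal}).

Let rpK x : quot_pi (rp x) = x. Proof. exact: reprK. Qed.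

Let rpE f : f - rp (quot_pi f) \in gen_ideal.
Proof. by apply/quot_piP; rewrite rpK. Qed.

Let quot_piD f g : quot_pi (f + g) = quot_pi f + quot_pi g.
Proof. by rewrite /quot_pi; rewrite !piE. Qed.

Let mulq (x y : Q) : Q := quot_pi (rp x * rp y).
Let scaleq (c : R) (x : Q) : Q := quot_pi (c *: rp x).

Let piM f g : mulq (quot_pi f) (quot_pi g) = quot_pi (f * g).
Proof.
apply/esym/quot_piP; set f' := rp _; set g' := rp _.
have -> : f * g - f' * g' = (f - f') * g + f' * (g - g').
  by rewrite mulrBl mulrBr addrA subrK.
by apply: rpredD; [apply: gen_idealMr | apply: gen_idealMl]; exact: rpE.
Qed.

Let piZ c f : scaleq c (quot_pi f) = quot_pi (c *: f).
Proof.
apply/esym/quot_piP; rewrite -scalerBr -[_ - _]mul1r scalerAl.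
by apply: gen_idealMl; exact: rpE.
Qed.

Fact mulqA : associative mulq.
Proof. by move=> x y z; rewrite -[x]rpK -[y]rpK -[z]rpK !piM mulrA. Qed.

Fact mul1q : left_id (quot_pi 1) mulq.
Proof. by move=> x; rewrite -[x]rpK piM mul1r. Qed.

Fact mulq1 : right_id (quot_pi 1) mulq.
Proof. by move=> x; rewrite -[x]rpK piM mulr1. Qed.

Fact mulqDl : left_distributive mulq +%R.
Proof.
by move=> x y z; rewrite -[x]rpK -[y]rpK -[z]rpK -quot_piD !piM -quot_piD mulrDl.
Qed.

Fact mulqDr : right_distributive mulq +%R.
Proof.
by move=> x y z; rewrite -[x]rpK -[y]rpK -[z]rpK -quot_piD !piM -quot_piD mulrDr.
Qed.

Fact oneq_neq0 : quot_pi 1 != 0.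
Proof.
have -> : 0 = quot_pi 0 by rewrite /quot_pi piE.
by apply/eqP=> /quot_piP; rewrite subr0 => /asboolP.
Qed.

HB.instance Definition _ :=
  GRing.Zmodule_isNzRing.Build Q mulqA mul1q mulq1 mulqDl mulqDr oneq_neq0.

Fact scaleqA a b x : scaleq a (scaleq b x) = scaleq (a * b) x.
Proof. by rewrite -[x]rpK !piZ scalerA. Qed.

Fact scale1q : left_id 1 scaleq.
Proof. by move=> x; rewrite -[x]rpK piZ scale1r. Qed.

Fact scaleqDr : right_distributive scaleq +%R.
Proof.
by move=> a x y; rewrite -[x]rpK -[y]rpK -quot_piD !piZ -quot_piD scalerDr.
Qed.

Fact scaleqDl x : {morph scaleq^~ x : a b / a + b}.
Proof. by move=> a b /=; rewrite -[x]rpK !piZ -quot_piD scalerDl. Qed.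

HB.instance Definition _ :=
  GRing.Zmodule_isLmodule.Build R Q scaleqA scale1q scaleqDr scaleqDl.

Fact scaleqAl (c : R) (x y : Q) : c *: (x * y) = (c *: x) * y.
Proof.
rewrite -[x]rpK -[y]rpK.
rewrite -[RHS]/(mulq (scaleq _ _) _) -[LHS]/(scaleq _ (mulq _ _)).
by rewrite piZ !piM piZ scalerAl.
Qed.

HB.instance Definition _ := GRing.Lmodule_isLalgebra.Build R Q scaleqAl.

Fact scaleqAr (c : R) (x y : Q) : c *: (x * y) = x * (c *: y).
Proof.
rewrite -[x]rpK -[y]rpK.
rewrite -[RHS]/(mulq _ (scaleq _ _)) -[LHS]/(scaleq _ (mulq _ _)).
by rewrite piZ !piM piZ scalerAr.
Qed.

HB.instance Definition _ := GRing.Lalgebra_isAlgebra.Build R Q scaleqAr.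

Fact quot_pi_zmod : zmod_morphism quot_pi.
Proof. by move=> f g; rewrite /quot_pi !piE. Qed.

HB.instance Definition _ := GRing.isZmodMorphism.Build A Q quot_pi quot_pi_zmod.

Fact quot_pi_monoid : monoid_morphism quot_pi.
Proof. by split=> // f g; rewrite -[RHS]/(mulq _ _) piM. Qed.

HB.instance Definition _ :=
  GRing.isMonoidMorphism.Build A Q quot_pi quot_pi_monoid.

Fact quot_pi_scale : scalable quot_pi.
Proof. by move=> c f; rewrite -[RHS]/(scaleq _ _) piZ. Qed.

HB.instance Definition _ :=
  GRing.isScalable.Build R A Q *:%R quot_pi quot_pi_scale.

End QuotientAlgebra.

Fact malg_scalerAr (R : comNzRingType) (K : monomType) (c : R)
  (g h : {malg R[K]}) : c *: (g * h) = g * (c *: h).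
Proof.
have gC : g * c%:MP = c *: g.
  rewrite -mul_malgC malgM_def fgmulgU malgM_def fgmulUg.
  by apply: eq_bigr => m _; rewrite mulm1 mul1m mulrC.
by rewrite -(mul_malgC c h) mulrA gC scalerAl.
Qed.

(** ** The quantum matrix algebra *)

Section QuantumMatrices.
Variables (k : fieldType) (n : nat).

Inductive qm_relator (A : algType (laurent k)) (x : 'I_n -> 'I_n -> A) :
    A -> Prop :=
| qm_relator_row (i j l : 'I_n) of (j < l)%N :
    qm_relator x (x i j * x i l - qV *: (x i l * x i j))
| qm_relator_col (i j l : 'I_n) of (j < l)%N :
    qm_relator x (x j i * x l i - qV *: (x l i * x j i))
| qm_relator_comm (i j i' l : 'I_n)
    of ((i < i') && (l < j) || (i' < i) && (j < l))%N :
    qm_relator x (x i j * x i' l - x i' l * x i j)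
| qm_relator_cross (i j i' l : 'I_n) of (i < i')%N & (j < l)%N :
    qm_relator x (x i j * x i' l - x i' l * x i j
                  - (qV - q) *: (x i' j * x i l)).

(* A character vanishing on the generators exists on the free algebra, hence
   the relations do not generate the unit ideal. *)
Fact qm_proper (A : algType (laurent k)) (x : 'I_n -> 'I_n -> A)
    (aug : {rmorphism A -> laurent k}) :
    scalable_for *%R aug -> (forall i j, aug (x i j) = 0) ->
  ~ ideal_gen (qm_relator x) 1.
Proof.
move=> augZ augX.
suff augI f : ideal_gen (qm_relator x) f -> aug f = 0.
  by move/augI/eqP; rewrite rmorph1 oner_eq0.
elim=> [_ [i j l _|i j l _|i j i' l _|i j i' l _ _]||u v _ u0 _ v0|a u _ u0|a u _ u0];
  rewrite ?(rmorphB, augZ, rmorphM, augX, mulr0, mul0r, subr0) //.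
- exact: rmorph0.
- by rewrite rmorphD u0 v0 addr0.
- by rewrite u0 mulr0.
- by rewrite u0 mul0r.
Qed.

Definition free_alg := {malg (laurent k)[{fmonom ('I_n * 'I_n)%type}]}.
HB.instance Definition _ := GRing.Lalgebra.on free_alg.
HB.instance Definition _ :=
  GRing.Lalgebra_isAlgebra.Build (laurent k) free_alg (@malg_scalerAr _ _).

Definition free_gen (i j : 'I_n) : free_alg := << fmu (i, j) >>.

Fact qm_relator1 : ~ ideal_gen (qm_relator free_gen) 1.
Proof.
pose aug : {rmorphism {malg (laurent k)[{fmonom ('I_n * 'I_n)%type}]} -> laurent k} :=
  mcoeff mone.
apply: (@qm_proper free_alg free_gen aug) => [c f|i j].
  exact: mcoeffZ.
by rewrite /= mcoeffU fm1_eq1.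
Qed.

Definition Oq := quot_alg qm_relator1.
HB.instance Definition _ := GRing.Algebra.on Oq.

Definition Oq_gen (i j : 'I_n) : Oq := quot_pi qm_relator1 (free_gen i j).

Lemma Oq_genP (f : Oq) : qm_relator Oq_gen f -> f = 0.
Proof.
have relP (A B : algType (laurent k)) (phi : {lrmorphism A -> B}) x (y : B) :
    qm_relator (fun i j => phi (x i j)) y ->
  exists2 a, qm_relator x a & y = phi a.
  have phiZ c u : phi (c *: u) = c *: phi u by rewrite linearZ.
  have phiB u v : phi (u - v) = phi u - phi v by rewrite rmorphB.
  have phiM u v : phi (u * v) = phi u * phi v by rewrite rmorphM.
  case=> [i j l lt|i j l lt|i j i' l lt|i j i' l lt lt'].
  - by exists (x i j * x i l - qV *: (x i l * x i j));
      [constructor 1|rewrite phiB phiZ !phiM].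
  - by exists (x j i * x l i - qV *: (x l i * x j i));
      [constructor 2|rewrite phiB phiZ !phiM].
  - by exists (x i j * x i' l - x i' l * x i j);
      [constructor 3|rewrite phiB !phiM].
  - by exists (x i j * x i' l - x i' l * x i j - (qV - q) *: (x i' j * x i l));
      [constructor 4|rewrite !phiB phiZ !phiM].
case/(relP _ _ (@quot_pi _ _ _ qm_relator1)) => a Ra ->.
rewrite -[RHS](rmorph0 (quot_pi qm_relator1)); apply/quot_piP.
by rewrite subr0; apply/asboolP; apply: ideal_gen_incl.
Qed.

End QuantumMatrices.

Arguments Oq_gen {k n}.

(** ** Quantum minors *)

Definition inversions p (f : 'I_p -> nat) : nat :=
  #|[set ij : 'I_p * 'I_p | (ij.1 < ij.2)%N && (f ij.2 < f ij.1)%N]|.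

Definition perm_inv p (s : 'S_p) : nat := inversions (fun i => val (s i)).

Section Tuples.
Variable n : nat.
Implicit Types S A B : seq 'I_n.

Definition increasing S : bool := sorted (fun i j : 'I_n => (i < j)%N) S.
Definition ord_of S : seq 'I_n := sort (fun i j : 'I_n => (i <= j)%N) S.
Definition tuple_inv S : nat :=
  inversions (fun i => val (tnth (in_tuple S) i)).

End Tuples.

Section QuantumMinors.
Variables (k : fieldType) (n : nat) (A : algType (laurent k)).
Variable (x : 'I_n -> 'I_n -> A).

(* Both tuples have the same size wherever this is used; the default value of
   [nth] is then irrelevant. *)
Definition qminor_inc (S T : seq 'I_n) : A :=
  \sum_(s : 'S_(size S)) (- qV) ^+ perm_inv s *:
    \prod_(i < size S) (let a := tnth (in_tuple S) i in x a (nth a T (s i))).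

Definition qminor (S T : seq 'I_n) : A :=
  (- qV) ^+ (tuple_inv S + tuple_inv T) *: qminor_inc (ord_of S) (ord_of T).

End QuantumMinors.

(** ** Standard towers *)

(* A set of size [m] is identified with [{1, ..., m}]; positions are 1-based,
   and a transposition [(c, c+1)] of positions is represented by [c].  A tower
   is given by its list of transpositions, from the given tuple down to [B_0]
   (resp. [A_0]). *)

Section Towers.
Local Open Scope nat_scope.

Definition swap (c v : nat) : nat :=
  if v == c then c.+1 else if v == c.+1 then c else v.

(* With [b_{p+1} = m+1]: the entry [b_a] for the largest [a] such that
   [b_{a+1} - b_a > 1]. *)
Definition col_pivot (m : nat) (b : seq nat) : nat :=
  let b' := rcons b m.+1 in
  last 0 [seq nth 0 b' a | a <- iota 0 (size b)
                         & nth 0 b' a.+1 - nth 0 b' a > 1].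

(* With [a_0 = 0]: the number [a_b - 1] for the smallest [b] such that
   [a_b - a_{b-1} > 1]. *)
Definition row_pivot (a : seq nat) : nat :=
  let a' := 0 :: a in
  head 0 [seq (nth 0 a' b).-1 | b <- iota 1 (size a)
                              & nth 0 a' b - nth 0 a' b.-1 > 1].

(* Each step changes the sum of the entries by one, so [m * m] steps suffice to
   reach the end of the tower: see [col_towerP] and [row_towerP] below. *)
Fixpoint col_tower_rec (fuel m : nat) (b : seq nat) : seq nat :=
  if fuel isn't f.+1 then [::] else
  if b == iota (m - size b).+1 (size b) then [::] else
  let c := col_pivot m b in c :: col_tower_rec f m (map (swap c) b).

Fixpoint row_tower_rec (fuel : nat) (a : seq nat) : seq nat :=
  if fuel isn't f.+1 then [::] else
  if a == iota 1 (size a) then [::] else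
  let c := row_pivot a in c :: row_tower_rec f (map (swap c) a).

Definition col_tower m b := col_tower_rec (m * m) m b.
Definition row_tower m a := row_tower_rec (m * m) a.

Definition bounded (m : nat) (b : seq nat) : bool :=
  sorted ltn b && all (fun v => 0 < v <= m) b.

Lemma bounded_size m b : bounded m b -> size b <= m.
Proof.
case/andP=> sb /allP ab; rewrite -(size_iota 1 m); apply: uniq_leq_size.
  exact: sorted_uniq ltn_trans ltnn _ sb.
by move=> v /ab; rewrite mem_iota; lia.
Qed.

Lemma sumn_bounded m b : bounded m b -> sumn b <= m * m.
Proof.
move=> bb; have := bounded_size bb; case/andP: bb => _.
move=> ab sb; apply: (@leq_trans (size b * m)); last by rewrite leq_mul2r sb orbT.
elim: b ab {sb} => //= v b IH /andP[/andP[_ vm] /IH]; lia.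
Qed.

Lemma bounded_swap m b c d :
  bounded m b -> 0 < d <= m -> c \in b -> d \notin b -> (d == c.+1) || (c == d.+1) ->
  bounded m (map (swap (minn c d)) b) /\ sumn (map (swap (minn c d)) b) + c = sumn b + d.
Proof.
case/andP=> sb ab dm cb db cd.
have swE v : v \in b -> swap (minn c d) v = if v == c then d else v.
  move=> vb; have : v != d by apply: contraNneq db => <-.
  by rewrite /swap => /eqP vd; do 3?[case: ifP => /eqP]; lia.
have ub : uniq b by exact: sorted_uniq ltn_trans ltnn _ sb.
have -> : map (swap (minn c d)) b = [seq (if v == c then d else v) | v <- b].
  exact/eq_in_map.
split; last first.
  elim: b ub cb db {sb ab swE} => //= v b IH /andP[vb ub].
  rewrite !inE negb_or; case: (eqVneq c v) => [cv _ _|cv /= cb /andP[_ db]].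
    subst v; have -> : [seq (if v0 == c then d else v0) | v0 <- b] = b.
      rewrite -[RHS]map_id; apply/eq_in_map => u ub'.
      by case: (u =P c) => // uc; case/negP: vb; rewrite -uc.
    lia.
  have := IH ub cb db; lia.
apply/andP; split; last first.
  by rewrite all_map; apply/allP => v /(allP ab) /=; case: ifP.
move: sb; rewrite !sorted_pairwise; try exact: ltn_trans.
rewrite pairwise_map => sb.
have bb : all (mem b) b by apply/allP.
apply: (sub_in_pairwise _ bb sb) => u v ub' vb /= uv.
have : u != d by apply: contraNneq db => <-.
have : v != d by apply: contraNneq db => <-.
by case: ifP => /eqP; case: ifP => /eqP; lia.
Qed.

Lemma col_pivotP m b : bounded m b -> b != iota (m - size b).+1 (size b) ->
  let c := col_pivot m b in [/\ c \in b, c.+1 \notin b & c < m].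
Proof.
move=> bb bN c; have sm := bounded_size bb; case/andP: bb => sb ab.
set b' := rcons b m.+1.
have sb' : sorted ltn b'.
  case: (b) sb ab @b' => //= v t svt /andP[vm tm].
  rewrite rcons_path svt /=; have : last v t \in v :: t by exact: mem_last.
  rewrite inE => /predU1P[->|/(allP tm)]; lia.
have nb' a : a < size b -> nth 0 b' a = nth 0 b a.
  by move=> ha; rewrite nth_rcons ha.
have inc i j : i < j -> j <= size b -> nth 0 b' i < nth 0 b' j.
  move=> ij jb; apply: (sorted_ltn_nth ltn_trans) => //; rewrite inE size_rcons; lia.
pose P a := (nth 0 b' a.+1 - nth 0 b' a > 1)%N.
have [a [ha Pa ->]] : exists a, [/\ a < size b, P a & c = nth 0 b a].
  have hP : has P (iota 0 (size b)).
    apply: contraR bN => /hasPn nP; apply/eqP.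
    have step j : j <= size b -> nth 0 b' (size b - j) = (m.+1 - j)%N.
      elim: j => [|j IH] jb; first by rewrite subn0 nth_rcons ltnn eqxx subn0.
      have /nP : size b - j.+1 \in iota 0 (size b) by rewrite mem_iota; lia.
      have := @inc (size b - j.+1) (size b - j)%N.
      rewrite /P (_ : (size b - j.+1).+1 = size b - j)%N ?IH; lia.
    apply: (@eq_from_nth _ 0) => [|i ib]; first by rewrite size_iota.
    rewrite nth_iota // -nb' //.
    have := step (size b - i)%N; rewrite subKn; lia.
  pose l := [seq nth 0 b' a | a <- iota 0 (size b) & P a].
  have : c \in l.
    rewrite /c /col_pivot -/b' -/l.
    have : 0 < size l by rewrite size_map size_filter -has_count.
    case: (l) => //= v t _; exact: mem_last.
  case/mapP=> a; rewrite mem_filter mem_iota => /andP[Pa ha] ->.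
  by exists a; split=> //; rewrite -nb'.
have Pa' : (nth 0 b' a).+1 < nth 0 b' a.+1 by move: Pa; rewrite /P; lia.
have c1 : (nth 0 b a).+1 \notin b.
  rewrite -nb' //; apply/negP=> /(nthP 0)[i ib]; rewrite -nb' // => E.
  have [ia|ai|ia] := ltngtP i a; last by move: E; rewrite ia; lia.
    have := inc _ _ ia (ltnW ha); lia.
  have [ai'|ai'] := eqVneq a.+1 i; first by subst i; lia.
  have := inc a.+1 i (ltac:(lia)) (ltnW ib); lia.
split=> //; first exact: mem_nth.
have := inc a.+1 (size b); have := nb' a ha.
by rewrite [nth 0 b' (size b)]nth_rcons ltnn eqxx; 
  case: (eqVneq a.+1 (size b)) => [e|];
  [move: Pa'; rewrite e {2}/b' nth_rcons ltnn eqxx|]; lia.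
Qed.

Lemma col_towerP m b : bounded m b ->
  foldl (fun b c => map (swap c) b) b (col_tower m b) = iota (m - size b).+1 (size b).
Proof.
move=> bb; rewrite /col_tower.
suff gen f : forall b, bounded m b -> m * m <= f + sumn b ->
    foldl (fun b c => map (swap c) b) b (col_tower_rec f m b)
    = iota (m - size b).+1 (size b).
  by apply: gen => //; lia.
elim: f => [|f IH] {}b {}bb hf /=.
  apply/eqP; apply: contraT => /(col_pivotP bb)[cb c1 cm].
  have dm : 0 < (col_pivot m b).+1 <= m by [].
  have [] := bounded_swap bb dm cb c1 _; first by rewrite eqxx.
  by move=> /sumn_bounded; lia.
case: eqP => [->|/eqP /(col_pivotP bb)[cb c1 cm]].
  by rewrite /= size_iota.
have dm : 0 < (col_pivot m b).+1 <= m by [].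
have [] := bounded_swap bb dm cb c1 _; first by rewrite eqxx.
have -> : minn (col_pivot m b) (col_pivot m b).+1 = col_pivot m b by lia.
by move=> b1 s1; rewrite /= IH ?size_map //; lia.
Qed.

Lemma row_pivotP m a : bounded m a -> a != iota 1 (size a) ->
  let c := row_pivot a in [/\ c.+1 \in a, c \notin a & 0 < c].
Proof.
move=> ba aN c; case/andP: ba => sa aa.
set a' := 0 :: a.
have sa' : sorted ltn a'.
  by rewrite {}/a'; case: a sa aa {aN c} => //= v t -> /andP[/andP[-> _] _].
have inc i j : i < j -> j <= size a -> nth 0 a' i < nth 0 a' j.
  by move=> ij ja; apply: (sorted_ltn_nth ltn_trans) => //; rewrite inE /=; lia.
pose P b := (nth 0 a' b - nth 0 a' b.-1 > 1)%N.
have [b [hb Pb cE]] : exists b, [/\ b < size a, P b.+1 & c = (nth 0 a b).-1].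
  have hP : has P (iota 1 (size a)).
    apply: contraR aN => /hasPn nP; apply/eqP.
    have step j : j <= size a -> nth 0 a' j = j.
      elim: j => [|j IH] ja //.
      have /nP : j.+1 \in iota 1 (size a) by rewrite mem_iota; lia.
      have := @inc j j.+1; rewrite /P /= -/a' IH; lia.
    apply: (@eq_from_nth _ 0) => [|i ia]; first by rewrite size_iota.
    by rewrite nth_iota // add1n -(step i.+1).
  pose l := [seq (nth 0 a' b).-1 | b <- iota 1 (size a) & P b].
  have : c \in l.
    rewrite /c /row_pivot -/a' -/l.
    have : 0 < size l by rewrite size_map size_filter -has_count.
    by case: (l) => //= v t _; rewrite inE eqxx.
  case/mapP=> -[|b]; rewrite mem_filter mem_iota ?andbF // => /andP[Pb hb] ->.
  by exists b; split=> //; lia.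
have cS : c.+1 = nth 0 a' b.+1 by move: Pb; rewrite /P /= cE; lia.
have bc : nth 0 a' b < c by move: Pb; rewrite /P /= cE; lia.
split; [by rewrite cS /= mem_nth | | by lia].
apply/negP=> /(nthP 0)[i ia E]; have {}E : nth 0 a' i.+1 = c by [].
have [bi|ib|bi] := ltngtP b i; last by move: cS; rewrite bi E; lia.
  have := inc b.+1 i.+1 (ltac:(lia)) ia; lia.
have [e|ne] := eqVneq i.+1 b; first by move: bc; rewrite -e E; lia.
have := inc i.+1 b (ltac:(lia)) (ltnW hb); lia.
Qed.

Lemma row_towerP m a : bounded m a ->
  foldl (fun a c => map (swap c) a) a (row_tower m a) = iota 1 (size a).
Proof.
move=> ba; rewrite /row_tower.
suff gen f : forall a, bounded m a -> sumn a <= f ->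
    foldl (fun a c => map (swap c) a) a (row_tower_rec f a) = iota 1 (size a).
  by apply: gen => //; exact: sumn_bounded.
elim: f => [|f IH] {}a {}ba hf /=.
  case: a ba hf => //= v t /andP[_ /andP[]]; lia.
case: eqP => [->|/eqP /(row_pivotP ba)[cS c c0]].
  by rewrite /= size_iota.
have dm : 0 < row_pivot a <= m.
  by case/andP: ba => _ /allP/(_ _ cS); lia.
have [] := bounded_swap ba dm cS c _; first by rewrite eqxx orbT.
have -> : minn (row_pivot a).+1 (row_pivot a) = row_pivot a by lia.
by move=> b1 s1; rewrite /= IH ?size_map //; lia.
Qed.

End Towers.

(** ** The lists C_i *)

Section Lists.
Variable T : eqType.
Implicit Types (S U V Z W : seq T).

Record entry := Entry {
  eZ : seq T; eZ' : seq T; eW : seq T; eW' : seq T; eneg : bool }.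

Definition entry_sign (R : nzRingType) (e : entry) : R := (-1) ^+ eneg e.

Definition pos S (x : T) : nat := (index x S).+1.
Definition swap_in S (c : nat) (x : T) : T := nth x S (swap c (pos S x)).-1.

(* The [c]-th element of [S] appears before its [d]-th element in [X]. *)
Definition before S (c d : nat) (X : seq T) : bool :=
  (index c (map (pos S) X) < index d (map (pos S) X))%N.

Definition compl S (X : seq T) : seq T := [seq x <- S | x \notin X].

Definition set_neg (b : bool) (e : entry) : entry :=
  Entry (eZ e) (eZ' e) (eW e) (eW' e) b.

Definition swap_cols V c (e : entry) : entry :=
  Entry (eZ e) (eZ' e) (map (swap_in V c) (eW e)) (map (swap_in V c) (eW' e))
        (eneg e).

Definition swap_rows U c (e : entry) : entry :=
  Entry (map (swap_in U c) (eZ e)) (map (swap_in U c) (eZ' e)) (eW e) (eW' e)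
        (eneg e).

Definition phi V c (e : entry) : bool := before V c c.+1 (eW e ++ eW' e).
Definition psi U c (e : entry) : bool := before U c.+1 c (eZ e ++ eZ' e).

(* [C_(i-1)], which is empty for [i = 0]. *)
Definition pred_list (C : nat -> seq entry) (i : nat) : seq entry :=
  if i is j.+1 then C j else [::].

(* [C_i^{A_0,B_s}], where [tw] lists the transpositions from [B_s] to [B_0]. *)
Fixpoint col_list (base : entry) V (tw : seq nat) (i : nat) : seq entry :=
  if tw is c :: tw' then
    let C := col_list base V tw' in
    map (set_neg (odd i))
      ([seq e <- pred_list C i | ~~ phi V c e] ++ map (swap_cols V c) (C i))
  else if i == 0 then [:: base] else [::].

(* [C_i^{A_t,B_M}], where [tw] lists the transpositions from [A_t] to [A_0]
   and [C0] is the family [C_i^{A_0,B_M}]. *)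
Fixpoint row_list (C0 : nat -> seq entry) U (tw : seq nat) (i : nat) :
    seq entry :=
  if tw is c :: tw' then
    let C := row_list C0 U tw' in
    [seq e <- pred_list C i | ~~ psi U c e] ++ map (swap_rows U c) (C i)
  else C0 i.

Definition std_col_tower V (B : seq T) : seq nat :=
  col_tower (size V) (map (pos V) B).
Definition std_row_tower U (A : seq T) : seq nat :=
  row_tower (size U) (map (pos U) A).

Definition base_entry U V (A B : seq T) : entry :=
  let A0 := take (size A) U in let B0 := drop (size V - size B) V in
  Entry A0 (compl U A0) B0 (compl V B0) false.

Definition Clist U V (A B : seq T) : nat -> seq entry :=
  row_list (col_list (base_entry U V A B) V (std_col_tower V B))
           U (std_row_tower U A).

End Lists.

Arguments entry_sign {T R}.

(* Main.v *)
From HB Require Import structures.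
Require Import Defs.
From mathcomp Require Import all_boot all_order all_algebra all_fingroup.
From mathcomp Require Import generic_quotient ring_quotient boolp monalg.
From mathcomp Require Import zify.

Set Implicit Arguments.
Unset Strict Implicit.
Unset Printing Implicit Defensive.

Import GRing.Theory.
Local Open Scope ring_scope.

(** Write [l = q^-1 - q]. On each side of the identity the rows enter only
    through [(Z, Z')] and the columns only through [(W, W')], and a step of the
    standard towers is the action of a generator [T] of the Hecke algebra
    (relation [(T - q^-1)(T + q) = 0]) on the letters of these words: [T] on
    rows, [T^-1 = T - l] on columns. Now [T = H - q], where [H = F E] is the
    product of the raising and lowering operators of U_q(sl_2) for two adjacent
    indices. These are twisted derivations of O_q(M_n), so [T] acts on every
    linear relation between products of two minors. On the left-hand side,
    where the minors are in the opposite order, each tower step is a plain swap.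
    By induction along the towers it remains to q-commute [A', L] and [A, J]
    when all rows and all non-common columns are ordered; this in turn follows
    from the case of disjoint columns, where the entries commute, by moving and
    merging columns with the same operators, each merge giving a factor [q]. *)

(** * Relations and twisted derivations *)

(** The constant subtracted from [H] is read off from the left-hand side. Before a column swap the
    first factor holds the smaller of the two letters, and [H] returns [q^-1] times the product plus
    the swapped one; before a row swap it holds the larger, and the coefficient is [q]. Removing
    that multiple leaves the plain swap. On the right-hand side both letters may also lie in the
    same minor, which [H] kills; the powers of [-q^-1] attached to words make one formula cover both
    situations. The twisted derivations must exist on an algebra given by generators and relations:
    they are the corner entry of a ring morphism into upper triangular 2 by 2 matrices, so that only
    the defining relations have to be checked. Consecutive elements of [V] need not be consecutive
    integers, but the columns between them are common to both minors or absent from both; [H] is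
    therefore conjugated by operators moving such columns with coefficient 1. Finally [r + s = n]
    leaves exactly [z] columns outside both minors, and undoing a merge requires such a free
    column. *)

Section Relations.
Variables (k : fieldType) (n : nat).
Local Notation laurent := (laurent k).

(* [D i j i' l] stands for the product [x i j * x i' l], or for its image under
   a skew derivation; the set of relations is stable under transposition. *)
Record qm_rels (V : lmodType laurent) (D : 'I_n -> 'I_n -> 'I_n -> 'I_n -> V) :
    Prop :=
  QmRels {
    qm_row : forall i j l : 'I_n, (j < l)%N -> D i j i l = qV *: D i l i j;
    qm_col : forall i j l : 'I_n, (j < l)%N -> D j i l i = qV *: D l i j i;
    qm_comm : forall i j i' l : 'I_n, (i < i')%N -> (l < j)%N -> D i j i' l = D i' l i j;
    qm_cross : forall i j i' l : 'I_n, (i < i')%N -> (j < l)%N ->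
      D i j i' l = D i' l i j + (qV - q) *: D i' j i l }.

(** Only the cross relation needs an argument: its transpose carries the correction [D i l i' j]
    instead of [D i' j i l], and the commutation relation identifies the two. Row operators are
    obtained from column operators through this symmetry. *)
Lemma qm_relsT (V : lmodType laurent) (D : 'I_n -> 'I_n -> 'I_n -> 'I_n -> V) :
  qm_rels (fun i j i' l => D j i l i') -> qm_rels D.
Proof.
case=> r c m x; split=> [i j l jl|i j l jl|i j i' l ii lj|i j i' l ii jl].
- exact: c jl.
- exact: r jl.
- by rewrite (m l i' j i).
- have /= -> := x j i l i' jl ii.
  by have /= -> := m j i' l i jl ii.
Qed.

Lemma qVq : qV * q = 1 :> laurent.
Proof. by rewrite mulrC mulqqV. Qed.

Section Algebra.
Variables (A : algType laurent) (x : 'I_n -> 'I_n -> A).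

(** The value on [x i j * x i' l] forced by the rule [E (f * g) = E f * K' g + K f * E g], when [K]
    and [K'] scale the generators by [u] and [v] and [E] sends them to [w]. *)
Definition skewD (u v : 'I_n -> 'I_n -> laurent) (w : 'I_n -> 'I_n -> A)
    (i j i' l : 'I_n) : A :=
  v i' l *: (w i j * x i' l) + u i j *: (x i j * w i' l).

Variables c d : 'I_n.
Hypothesis cd : (d = c.+1 :> nat)%N.

(** Weights of a single index under the Cartan element of the sl_2 attached to [c] and [d];
    [lower_wt] gives the inverse weights. *)
Definition raise_wt (j : 'I_n) : laurent :=
  if j == c then qV else if j == d then q else 1.
Definition lower_wt (j : 'I_n) : laurent :=
  if j == c then q else if j == d then qV else 1.

Hypothesis xr : qm_rels (fun i j i' l => x i j * x i' l).


Let cNd : (c == d) = false.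
Proof. by apply/eqP=> E; move: cd; rewrite E => /n_Sn. Qed.

Let dNc : (d == c) = false. Proof. by rewrite eq_sym. Qed.

Let ltd (j : 'I_n) : j != c -> (j < d)%N -> (j < c)%N.
Proof. by rewrite -(inj_eq val_inj) /=; move: cd; lia. Qed.

Let ltc (j : 'I_n) : j != d -> (c < j)%N -> (d < j)%N.
Proof. by rewrite -(inj_eq val_inj) /=; move: cd; lia. Qed.

Let scal_rel : 1 + qV * (qV - q) = qV * qV :> laurent.
Proof. by rewrite mulrBr qVq addrCA subrr addr0. Qed.

Let simp := (mul0r, mulr0, scaler0, addr0, add0r, scale1r).

Let col_rel (P Q : A) :
  P + qV *: (Q + (qV - q) *: P) = qV *: (Q + qV *: P).
Proof.
rewrite !scalerDr !scalerA addrCA; congr (_ + _).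
by rewrite -[X in X + _]scale1r -scalerDl scal_rel.
Qed.

(** Every relation is homogeneous in the column indices, so rescaling the columns is compatible with
    it. This provides the diagonal entries of the triangular matrices. *)
Lemma col_weight_rels (f : 'I_n -> laurent) :
  qm_rels (fun i j i' l => (f j * f l) *: (x i j * x i' l)).
Proof.
have [rr rc rm rx] := xr.
split=> [i j l jl|i j l jl|i j i' l ii lj|i j i' l ii jl].
- rewrite (rr i j l jl) !scalerA; congr (_ *: _).
  by rewrite mulrC [f j * f l]mulrC.
- by rewrite (rc i j l jl) !scalerA; congr (_ *: _); rewrite mulrC.
- by rewrite (rm i j i' l ii lj); congr (_ *: _); rewrite mulrC.
- rewrite (rx i j i' l ii jl) scalerDr !scalerA.
  by congr (_ *: _ + _ *: _); rewrite mulrC.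
Qed.

Lemma row_weight_rels (f : 'I_n -> laurent) :
  qm_rels (fun i j i' l => (f i * f i') *: (x i j * x i' l)).
Proof.
have [rr rc rm rx] := xr.
split=> [i j l jl|i j l jl|i j i' l ii lj|i j i' l ii jl].
- by rewrite (rr i j l jl) !scalerA; congr (_ *: _); rewrite mulrC.
- rewrite (rc i j l jl) !scalerA; congr (_ *: _).
  by rewrite mulrC [f j * f l]mulrC.
- by rewrite (rm i j i' l ii lj); congr (_ *: _); rewrite mulrC.
- rewrite (rx i j i' l ii jl) scalerDr !scalerA.
  by congr (_ *: _ + _ *: _); rewrite mulrC // [f i * f i']mulrC.
Qed.

(** The rule for [E] is the coproduct of a generator of U_q(sl_2), with [K] and [K'] diagonal ring
    endomorphisms: raising uses trivial weights for [K'], lowering uses trivial weights for [K]. *)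
Record skew_derivation (u v : 'I_n -> 'I_n -> laurent) (w : 'I_n -> 'I_n -> A)
    (K E K' : A -> A) : Prop := SkewDerivation {
  skewK_lin : linear K; skewE_lin : linear E; skewK'_lin : linear K';
  skewKM : forall f g, K (f * g) = K f * K g;
  skewEM : forall f g, E (f * g) = E f * K' g + K f * E g;
  skewK'M : forall f g, K' (f * g) = K' f * K' g;
  skewK1 : K 1 = 1; skewE1 : E 1 = 0; skewK'1 : K' 1 = 1;
  skewKx : forall i j, K (x i j) = u i j *: x i j;
  skewEx : forall i j, E (x i j) = w i j;
  skewK'x : forall i j, K' (x i j) = v i j *: x i j }.

(** Replacing [c] by its successor [d] keeps its order relative to every third column, so most
    relations persist formally. The special cases are those where [c] meets [d], which must become
    relations between entries of column [d], and the one where both entries lie in column [c]. *)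
Lemma raise_skewD :
  qm_rels (skewD (fun _ => raise_wt) (fun _ _ => 1)
                 (fun i j => if j == c then x i d else 0)).
Proof.
have cltd : (c < d)%N by rewrite cd.
have [rr rc rm rx] := xr.
rewrite /skewD /raise_wt; split=> [i j l jl|i j l jl|i j i' l ii lj|i j i' l ii jl].
- case: (eqVneq j c) jl => [->|jc] jl; case: (eqVneq l c) jl => [->|lc] jl.
  + by rewrite ltnn in jl.
  + case: (eqVneq l d) jl => [->|ld] jl; rewrite !simp; last exact/rr/ltc.
    by rewrite scalerA qVq scale1r.
  + have jd : (j == d) = false by apply/eqP=> E; move: jl; rewrite E; lia.
    by rewrite jd !simp; apply: rr; rewrite cd; lia.
  + by rewrite !simp.
- case: (eqVneq i c) => [->|ic]; last by rewrite !simp.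
  by rewrite !scale1r (rm j d l c) // (rx j c l d) // col_rel.
- case: (eqVneq j c) lj => [->|jc] lj; case: (eqVneq l c) lj => [->|lc] lj.
  + by rewrite ltnn in lj.
  + have ld : (l == d) = false by apply/eqP=> E; move: lj; rewrite E; lia.
    by rewrite ld !simp; apply: rm => //; lia.
  + case: (eqVneq j d) lj => [->|jd] lj; rewrite !simp; last exact/rm/ltc.
    by rewrite (rc d i i') // scalerA mulqqV scale1r.
  + by rewrite !simp.
- case: (eqVneq j c) jl => [->|jc] jl; case: (eqVneq l c) jl => [->|lc] jl.
  + by rewrite ltnn in jl.
  + case: (eqVneq l d) jl => [->|ld] jl; rewrite !simp; last exact/rx/ltc.
    by rewrite (rc d i i') // -scalerDl addrC subrK.
  + have jd : (j == d) = false by apply/eqP=> E; move: jl; rewrite E; lia.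
    by rewrite jd !simp; apply: rx => //; lia.
  + by rewrite !simp.
Qed.

Lemma lower_skewD :
  qm_rels (skewD (fun _ _ => 1) (fun _ => lower_wt)
                 (fun i j => if j == d then x i c else 0)).
Proof.
have cltd : (c < d)%N by rewrite cd.
have [rr rc rm rx] := xr.
rewrite /skewD /lower_wt; split=> [i j l jl|i j l jl|i j i' l ii lj|i j i' l ii jl].
- case: (eqVneq j d) jl => [->|jd] jl; case: (eqVneq l d) jl => [->|ld] jl.
  + by rewrite ltnn in jl.
  + have lc : (l == c) = false by apply/eqP=> E; move: jl; rewrite E; lia.
    by rewrite lc !simp; apply: rr; lia.
  + rewrite dNc; case: (eqVneq j c) jl => [->|jc] jl; rewrite !simp.
      by rewrite scalerA qVq scale1r.
    exact/rr/ltd.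
  + by rewrite !simp.
- case: (eqVneq i d) => [->|id]; last by rewrite !simp.
  by rewrite dNc !scale1r (rm j d l c) // (rx j c l d) // addrC col_rel addrC.
- case: (eqVneq j d) lj => [->|jd] lj; case: (eqVneq l d) lj => [->|ld] lj.
  + by rewrite ltnn in lj.
  + rewrite ?dNc; case: (eqVneq l c) lj => [->|lc] lj; rewrite !simp.
      by rewrite (rc c i i') // scalerA mulqqV scale1r.
    exact/rm/ltd.
  + have jc : (j == c) = false by apply/eqP=> E; move: lj; rewrite E; lia.
    by rewrite jc !simp; apply: rm => //; lia.
  + by rewrite !simp.
- case: (eqVneq j d) jl => [->|jd] jl; case: (eqVneq l d) jl => [->|ld] jl.
  + by rewrite ltnn in jl.
  + have lc : (l == c) = false by apply/eqP=> E; move: jl; rewrite E; lia.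
    by rewrite ?dNc lc !simp; apply: rx => //; lia.
  + rewrite ?dNc; case: (eqVneq j c) jl => [->|jc] jl; rewrite !simp.
      by rewrite (rc c i i') // -scalerDl addrC subrK.
    exact/rx/ltd.
  + by rewrite !simp.
Qed.

End Algebra.
End Relations.

(** * Twisted derivations of the quantum matrix algebra *)

Section Lift.
Variables (k : fieldType) (n : nat) (S : nzRingType).
Variables (h : {rmorphism laurent k -> S}) (y : 'I_n -> 'I_n -> S).

Definition word_eval (m : {fmonom ('I_n * 'I_n)%type}) : S :=
  foldr (fun p acc => y p.1 p.2 * acc) 1 (m : seq _).

Lemma word_eval_morph : mmorphism word_eval.
Proof.
split; last by rewrite /word_eval fm1.
move=> [a] [b]; rewrite /word_eval fmM /=.
by elim: a => [|p a IH] /=; rewrite ?mul1r // IH mulrA.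
Qed.

HB.instance Definition _ := isMultiplicative.Build _ _ word_eval word_eval_morph.

Hypothesis hC : forall a i j, h a * y i j = y i j * h a.

(** Scalars enter through [h] because the target is only a ring, later a matrix ring; [hC],
    commutation with the images of the generators, replaces centrality. *)
Definition free_eval (f : free_alg k n) : S := mmap h word_eval f.

Lemma free_evalM f g : free_eval (f * g) = free_eval f * free_eval g.
Proof.
rewrite /free_eval.
apply: (commr_mmap_is_multiplicative (f := h) (h := word_eval) _).1.
move=> {}g m [b]; rewrite /GRing.comm /word_eval /=.
by elim: b => [|p b IH] /=; rewrite ?mul1r ?mulr1 // mulrA hC -!mulrA IH.
Qed.

Lemma free_eval1 : free_eval 1 = 1.
Proof. exact: (mmap1 (f := h) (h := word_eval)). Qed.

Lemma free_evalD f g : free_eval (f + g) = free_eval f + free_eval g.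
Proof. exact: mmapD. Qed.

Lemma free_evalB f g : free_eval (f - g) = free_eval f - free_eval g.
Proof. exact: mmapB. Qed.

Lemma free_evalZ a f : free_eval (a *: f) = h a * free_eval f.
Proof. exact: (mmapZ (f := h) (h := word_eval)). Qed.

Lemma free_evalBZ f g a e :
  free_eval (f - g - a *: e) = free_eval f - free_eval g - h a * free_eval e.
Proof. by rewrite free_evalB free_evalB free_evalZ. Qed.

Lemma free_eval_gen i j : free_eval (free_gen k i j) = y i j.
Proof.
have -> : free_eval (free_gen k i j) = h 1 * word_eval (fmu (i, j)).
  exact: (mmapU (f := h)).
by rewrite rmorph1 mul1r /word_eval fmU /= mulr1.
Qed.

Lemma free_eval_ind (P : S -> Prop) f :
  P 0 -> (forall a b, P a -> P b -> P (a + b)) ->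
  (forall a b, P a -> P b -> P (a * b)) -> (forall a, P (h a)) -> P 1 ->
  (forall i j, P (y i j)) -> P (free_eval f).
Proof.
move=> P0 PD PM Ph P1 Py; rewrite /free_eval mmapE.
elim/big_ind: _ => // m _; apply: (PM) => //.
by rewrite /word_eval; elim: (m : seq _) => //= p s; apply: (PM).
Qed.

Lemma free_eval_ideal f :
  (forall g, qm_relator (@free_gen k n) g -> free_eval g = 0) ->
  ideal_gen (qm_relator (@free_gen k n)) f -> free_eval f = 0.
Proof.
move=> rel0; elim=> [g /rel0 //||a b _ a0 _ b0|a b _ b0|a b _ b0].
- by have := free_evalB 0 0; rewrite !subrr.
- by rewrite free_evalD a0 b0 addr0.
- by rewrite free_evalM b0 mulr0.
- by rewrite free_evalM b0 mul0r.
Qed.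

End Lift.


Lemma ord2E (i : 'I_2) : i = 0 \/ i = 1.
Proof. by case: i => [[|[|//]] lt]; [left|right]; apply: val_inj. Qed.

(** * Twisted derivations as corner entries of upper triangular matrices *)

Section UpperTriangular.
Variables (k : fieldType) (n : nat) (A : algType (laurent k)).
Local Notation laurent := (laurent k).
Local Notation M2 := 'M[A]_2.

(** If a ring morphism sends [f] to [utri (K f) (E f) (K' f)], comparing the corners of a product
    gives [E (f * g) = E f * K' g + K f * E g]; twisted derivations are built as such morphisms. *)
Definition utri (a b c : A) : M2 := \matrix_(i, j)
  (if i == 0 then (if j == 0 then a else b) else (if j == 0 then 0 else c)).

Lemma utriE a b c :
  [/\ utri a b c 0 0 = a, utri a b c 0 1 = b, utri a b c 1 0 = 0
    & utri a b c 1 1 = c].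
Proof. by rewrite !mxE. Qed.

Lemma utriP (M : M2) : M 1 0 = 0 -> M = utri (M 0 0) (M 0 1) (M 1 1).
Proof.
move=> M10; apply/matrixP=> i j; rewrite mxE.
by case: (ord2E i) => ->; case: (ord2E j) => ->.
Qed.

Lemma utriM a b c a' b' c' :
  utri a b c * utri a' b' c' = utri (a * a') (b * c' + a * b') (c * c').
Proof.
apply/matrixP=> i j; rewrite !mxE !big_ord_recl big_ord0 !mxE.
have -> : lift ord0 ord0 = 1 :> 'I_2 by apply: val_inj.
case: (ord2E i) => ->; case: (ord2E j) => -> /=;
  by rewrite ?mul0r ?mulr0 ?addr0 ?add0r // addrC.
Qed.

Lemma utriD a b c a' b' c' :
  utri a b c + utri a' b' c' = utri (a + a') (b + b') (c + c').
Proof.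
apply/matrixP=> i j; rewrite !mxE.
by case: (ord2E i) => ->; case: (ord2E j) => -> /=; rewrite ?addr0.
Qed.

Lemma utriM_entries (M N : M2) : M 1 0 = 0 -> N 1 0 = 0 ->
  [/\ (M * N) 0 0 = M 0 0 * N 0 0,
      (M * N) 0 1 = M 0 1 * N 1 1 + M 0 0 * N 0 1
    & (M * N) 1 1 = M 1 1 * N 1 1].
Proof.
move=> /utriP -> /utriP ->; rewrite utriM.
by case: (utriE (M 0 0 * N 0 0) (M 0 1 * N 1 1 + M 0 0 * N 0 1)
                (M 1 1 * N 1 1)) => -> -> _ ->; rewrite !mxE.
Qed.

Lemma utri1 : [/\ (1 : M2) 0 0 = 1, (1 : M2) 0 1 = 0 & (1 : M2) 1 1 = 1].
Proof. by rewrite !mxE. Qed.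

Definition scal2 : {rmorphism laurent -> M2} := @scalar_mx A 2 \o in_alg A.

Lemma scal2E s : scal2 s = utri (s%:A) 0 (s%:A).
Proof.
apply/matrixP=> i j; rewrite !mxE.
by case: (ord2E i) => ->; case: (ord2E j) => -> /=.
Qed.

Lemma scal2M s a b c : scal2 s * utri a b c = utri (s *: a) (s *: b) (s *: c).
Proof. by rewrite scal2E utriM mul0r add0r !mulr_algl. Qed.

Lemma scal2C s a b c : scal2 s * utri a b c = utri a b c * scal2 s.
Proof.
by rewrite scal2M scal2E utriM mulr0 addr0 -!scalerAr !mulr1.
Qed.

Lemma scal2_entry s (M : M2) i j : (scal2 s * M) i j = s *: M i j.
Proof. by rewrite /scal2 /= -[_%:M * M]/(_%:M *m M) mul_scalar_mx mxE mulr_algl. Qed.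

Variables (x : 'I_n -> 'I_n -> A).
Variables (u v : 'I_n -> 'I_n -> laurent) (w : 'I_n -> 'I_n -> A).
Hypothesis ru : qm_rels (fun i j i' l => (u i j * u i' l) *: (x i j * x i' l)).
Hypothesis rv : qm_rels (fun i j i' l => (v i j * v i' l) *: (x i j * x i' l)).
Hypothesis rw : qm_rels (skewD x u v w).

Definition skew_mx i j := utri (u i j *: x i j) (w i j) (v i j *: x i j).

Lemma skew_mxM i j i' l : skew_mx i j * skew_mx i' l =
  utri ((u i j * u i' l) *: (x i j * x i' l)) (skewD x u v w i j i' l)
       ((v i j * v i' l) *: (x i j * x i' l)).
Proof.
rewrite utriM -!scalerAl -!scalerAr !scalerA; congr utri.
Qed.

Lemma skew_mx_rels (g : free_alg k n) :
  qm_relator (@free_gen k n) g -> free_eval scal2 skew_mx g = 0.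
Proof.
have yC a i j : scal2 a * skew_mx i j = skew_mx i j * scal2 a by apply: scal2C.
pose T i j i' l :=
  utri ((u i j * u i' l) *: (x i j * x i' l)) (skewD x u v w i j i' l)
       ((v i j * v i' l) *: (x i j * x i' l)).
have eM i j i' l : free_eval scal2 skew_mx (free_gen k i j * free_gen k i' l)
    = T i j i' l.
  by rewrite (free_evalM yC) !free_eval_gen skew_mxM.
case=> [i j l lt|i j l lt|i j i' l lt|i j i' l lt lt'].
- rewrite free_evalB eM free_evalZ eM scal2M.
  by rewrite -(qm_row ru _ lt) -(qm_row rv _ lt) -(qm_row rw _ lt) subrr.
- rewrite free_evalB eM free_evalZ eM scal2M.
  by rewrite -(qm_col ru _ lt) -(qm_col rv _ lt) -(qm_col rw _ lt) subrr.
- have TE : T i j i' l = T i' l i j.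
    rewrite /T; case/orP: lt => /andP[lt lt'].
      by rewrite (qm_comm ru lt lt') (qm_comm rv lt lt') (qm_comm rw lt lt').
    by rewrite -(qm_comm ru lt lt') -(qm_comm rv lt lt') -(qm_comm rw lt lt').
  rewrite free_evalB -[RHS](subrr (T i j i' l)); congr (_ - _); first exact: eM.
  by rewrite TE; exact: eM.
- have TE : T i j i' l = T i' l i j + scal2 (qV - q) * T i' j i l.
    rewrite /T scal2M utriD.
    by rewrite (qm_cross ru lt lt') (qm_cross rv lt lt') (qm_cross rw lt lt').
  have -> : 0 = T i j i' l - T i' l i j - scal2 (qV - q) * T i' j i l.
    by rewrite TE [X in X - _ - _]addrC addrK subrr.
  by rewrite free_evalBZ; congr (_ - _ - _ * _); exact: eM.
Qed.

Lemma free_eval10 f : free_eval scal2 skew_mx f 1 0 = 0.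
Proof.
pose P (B : M2) := B 1 0 = 0.
apply: (@free_eval_ind k n _ scal2 skew_mx P f) => [|B C B0 C0|B C B0 C0|s||i j]; rewrite /P.
- by rewrite mxE.
- by rewrite mxE B0 C0 addr0.
- by rewrite (utriP B0) (utriP C0) utriM; case: (utriE (B 0 0 * C 0 0) (B 0 1 * C 1 1 + B 0 0 * C 0 1) (B 1 1 * C 1 1)).
- by rewrite scal2E; case: (utriE (s%:A) 0 (s%:A)).
- by rewrite mxE.
- by case: (utriE (u i j *: x i j) (w i j) (v i j *: x i j)).
Qed.
End UpperTriangular.

Section QuotientLift.
Variables (R : comNzRingType) (F : algType R) (S : F -> Prop).
Hypothesis S1 : ~ ideal_gen S 1.
Variables (M : nzRingType) (h : R -> M) (ev : F -> M).
Hypothesis ev0 : forall f, ideal_gen S f -> ev f = 0.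
Hypothesis evD : forall f g, ev (f + g) = ev f + ev g.
Hypothesis evZ : forall a f, ev (a *: f) = h a * ev f.
Hypothesis evM : forall f g, ev (f * g) = ev f * ev g.
Hypothesis ev1 : ev 1 = 1.

(** [Phi] evaluates a representative, which is independent of the choice because [ev] kills the
    ideal. The last clause transfers statements about [ev] to the quotient. *)
Lemma quotient_lift : exists Phi : quot_alg S1 -> M,
  [/\ forall f, Phi (quot_pi S1 f) = ev f,
      forall a b c, Phi (a *: b + c) = h a * Phi b + Phi c,
      forall a b, Phi (a * b) = Phi a * Phi b, Phi 1 = 1
    & forall a, exists f, a = quot_pi S1 f].
Proof.
pose rp (a : quot_alg S1) : F := repr (a : {ideal_quot (gen_ideal S)}).
have rpK a : quot_pi S1 (rp a) = a by apply: reprK.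
pose Phi a := ev (rp a).
have PhiE f : Phi (quot_pi S1 f) = ev f.
  have /quot_piP/asboolP/ev0 := rpK (quot_pi S1 f).
  by move=> e0; rewrite /Phi -[rp _](subrK f) evD e0 add0r.
exists Phi; split=> // [a b c|a b||a].
- by rewrite -[b]rpK -[c]rpK -linearP !PhiE evD evZ.
- by rewrite -[a]rpK -[b]rpK -rmorphM !PhiE evM.
- by rewrite -(rmorph1 (quot_pi S1)) PhiE ev1.
- by exists (rp a).
Qed.
End QuotientLift.

(** * Existence of the raising and lowering operators *)

Section SkewDerivations.
Variables (k : fieldType) (n : nat).
Local Notation laurent := (laurent k).
Local Notation O := (Oq k n).
Local Notation x := (@Oq_gen k n).

Lemma Oq_rels : qm_rels (fun i j i' l => x i j * x i' l).
Proof.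
split=> [i j l jl|i j l jl|i j i' l ii lj|i j i' l ii jl]; apply/eqP;
  rewrite -subr_eq0; apply/eqP.
- by apply: Oq_genP; constructor 1.
- by apply: Oq_genP; constructor 2.
- by apply: Oq_genP; constructor 3; rewrite ii lj.
- by rewrite opprD addrA; apply: Oq_genP; constructor 4.
Qed.

Lemma skew_derivation_exists u v w :
  qm_rels (fun i j i' l => (u i j * u i' l) *: (x i j * x i' l)) ->
  qm_rels (fun i j i' l => (v i j * v i' l) *: (x i j * x i' l)) ->
  qm_rels (skewD x u v w) ->
  exists K E K', skew_derivation x u v w K E K'.
Proof.
move=> ru rv rw; set y := skew_mx x u v w.
have yC a i j : scal2 O a * y i j = y i j * scal2 O a by apply: scal2C.
pose ev := free_eval (scal2 O) y.
have ev0 : forall f, ideal_gen (qm_relator (@free_gen k n)) f -> ev f = 0.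
  move=> f; exact: (free_eval_ideal yC (skew_mx_rels ru rv rw)).
have [Phi [PhiE PhiL PhiM Phi1 piK]] := quotient_lift (@qm_relator1 k n) ev0
  (@free_evalD _ _ _ _ _) (@free_evalZ _ _ _ _ _)
  (@free_evalM _ _ _ _ _ yC) (@free_eval1 _ _ _ _ _).
have Phix i j : Phi (x i j) = y i j by rewrite PhiE /ev free_eval_gen.
have Phi10 a : Phi a 1 0 = 0.
  have [f ->] := piK a.
  by rewrite PhiE; apply: free_eval10.
have entryL i j : linear (fun a => Phi a i j).
  move=> s a b; rewrite PhiL; move: (Phi a) (Phi b) => A B.
  by rewrite mxE scal2_entry.
have at00 (M N : 'M[O]_2) : M = N -> M 0 0 = N 0 0 by move=> ->.
have at01 (M N : 'M[O]_2) : M = N -> M 0 1 = N 0 1 by move=> ->.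
have at11 (M N : 'M[O]_2) : M = N -> M 1 1 = N 1 1 by move=> ->.
have yE i j := utriE (u i j *: x i j) (w i j) (v i j *: x i j).
have PhiMu a b := utriM_entries (Phi10 a) (Phi10 b).
exists (fun a => Phi a 0 0), (fun a => Phi a 0 1), (fun a => Phi a 1 1).
split=> [|||f g|f g|f g||||i j|i j|i j].
- exact: entryL.
- exact: entryL.
- exact: entryL.
- by cbv beta; have [<- _ _] := PhiMu f g; apply: (at00 _ _ (PhiM f g)).
- by cbv beta; have [_ <- _] := PhiMu f g; apply: (at01 _ _ (PhiM f g)).
- by cbv beta; have [_ _ <-] := PhiMu f g; apply: (at11 _ _ (PhiM f g)).
- by cbv beta; have [e _ _] := @utri1 k O; rewrite -[RHS]e; apply: (at00 _ _ Phi1).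
- by cbv beta; have [_ e _] := @utri1 k O; rewrite -[RHS]e; apply: (at01 _ _ Phi1).
- by cbv beta; have [_ _ e] := @utri1 k O; rewrite -[RHS]e; apply: (at11 _ _ Phi1).
- by cbv beta; have [e _ _ _] := yE i j; rewrite -[RHS]e; apply: (at00 _ _ (Phix i j)).
- by cbv beta; have [_ e _ _] := yE i j; rewrite -[RHS]e; apply: (at01 _ _ (Phix i j)).
- by cbv beta; have [_ _ _ e] := yE i j; rewrite -[RHS]e; apply: (at11 _ _ (Phix i j)).
Qed.

Section Adjacent.
Variables c d : 'I_n.
Hypothesis cd : (d = c.+1 :> nat)%N.

Lemma col_raise : exists K E K',
  skew_derivation x (fun _ => raise_wt k c d) (fun _ _ => 1)
                  (fun i j => if j == c then x i d else 0) K E K'.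
Proof.
apply: skew_derivation_exists; [exact: (col_weight_rels Oq_rels) | | exact: raise_skewD cd Oq_rels].
exact: (col_weight_rels Oq_rels (fun _ => 1)).
Qed.

Lemma col_lower : exists K E K',
  skew_derivation x (fun _ _ => 1) (fun _ => lower_wt k c d)
                  (fun i j => if j == d then x i c else 0) K E K'.
Proof.
apply: skew_derivation_exists; [| exact: (col_weight_rels Oq_rels) | exact: lower_skewD cd Oq_rels].
exact: (col_weight_rels Oq_rels (fun _ => 1)).
Qed.

Lemma row_raise : exists K E K',
  skew_derivation x (fun i _ => raise_wt k c d i) (fun _ _ => 1)
                  (fun i j => if i == c then x d j else 0) K E K'.
Proof.
have xT : qm_rels (fun i j i' l => x j i * x l i') by exact: qm_relsT Oq_rels.
apply: skew_derivation_exists; [exact: (row_weight_rels Oq_rels) | | ].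
  exact: (col_weight_rels Oq_rels (fun _ => 1)).
exact: qm_relsT (raise_skewD cd xT).
Qed.

Lemma row_lower : exists K E K',
  skew_derivation x (fun _ _ => 1) (fun i _ => lower_wt k c d i)
                  (fun i j => if i == d then x c j else 0) K E K'.
Proof.
have xT : qm_rels (fun i j i' l => x j i * x l i') by exact: qm_relsT Oq_rels.
apply: skew_derivation_exists; [| exact: (row_weight_rels Oq_rels) | ].
  exact: (col_weight_rels Oq_rels (fun _ => 1)).
exact: qm_relsT (lower_skewD cd xT).
Qed.
End Adjacent.

End SkewDerivations.

(** * Minors and the raising and lowering operators *)

Section LinearFunctions.
Variables (R : nzRingType) (V W : lmodType R) (f : V -> W).
Hypothesis lf : linear f.
Let fL : {linear V -> W} := HB.pack f (GRing.isLinear.Build R V W *:%R f lf).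

(** The operators come out of existential statements as bare functions with a proof of linearity;
    packing that proof once gives the usual rules for them. *)
Lemma linear_fun0 : f 0 = 0. Proof. exact: (linear0 fL). Qed.
Lemma linear_funD u v : f (u + v) = f u + f v. Proof. exact: (linearD fL). Qed.
Lemma linear_funZ a u : f (a *: u) = a *: f u. Proof. exact: (linearZ_LR fL). Qed.
Lemma linear_fun_sum I r (P : pred I) F :
  f (\sum_(i <- r | P i) F i) = \sum_(i <- r | P i) f (F i).
Proof. exact: (linear_sum fL). Qed.
End LinearFunctions.

Section Twist.
Variables (T : finType) (c d : T).
Implicit Types S : {set T}.

(** The image of [S] under the transposition, written as a preimage so that membership unfolds
    directly; the two agree because the transposition is an involution. *)
Definition twist (S : {set T}) : {set T} := [set y | tperm c d y \in S].

Lemma in_twist S y : (y \in twist S) = (tperm c d y \in S).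
Proof. by rewrite inE. Qed.

Lemma twistK : involutive twist.
Proof. by move=> S; apply/setP=> y; rewrite !inE tpermK. Qed.

Lemma twist_fix S : (c \in S) = (d \in S) -> twist S = S.
Proof. by move=> cd; apply/setP=> y; rewrite inE; case: tpermP => // ->. Qed.

Lemma twistD1 S y : twist S :\ tperm c d y = twist (S :\ y).
Proof. by apply/setP=> z; rewrite !inE (can2_eq (tpermK c d) (tpermK c d)). Qed.

Lemma twist_s S : c \in S -> d \notin S -> twist S :\ d = S :\ c.
Proof.
move=> cS dS; rewrite -[X in _ :\ X](tpermL c d) twistD1 twist_fix //.
by rewrite !inE eqxx (negbTE dS) andbF.
Qed.

Lemma twist_both S : c \in S -> d \in S -> twist (S :\ d) = S :\ c.
Proof.
move=> cS dS; apply/setP=> y; rewrite !inE.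
case: tpermP => [->|->|/eqP yc /eqP yd]; rewrite ?eqxx ?cS ?dS ?andbT //.
- by rewrite eq_sym.
- by rewrite yd yc.
Qed.
End Twist.

(** * Minors by Laplace expansion, and the action of one operator on them *)

Section Minors.
Variables (k : fieldType) (n : nat).
Local Notation laurent := (laurent k).
Variables (A : algType laurent) (x : 'I_n -> 'I_n -> A).
Implicit Types (R : seq 'I_n) (S : {set 'I_n}).

Definition below S (b : 'I_n) := #|[set y in S | (y < b)%N]|.

(** Laplace expansion along the first row. Rows form a sequence, so that a row may be repeated or
    out of order in intermediate terms. The value is 0 when the numbers of rows and columns
    differ. *)
Fixpoint sminor R S : A :=
  if R is a :: R' then
    \sum_(b in S) (- qV) ^+ below S b *: (x a b * sminor R' (S :\ b))
  else (S == set0)%:R.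

Section Diagonal.
Variable g : A -> A.
Hypotheses (gl : linear g) (gM : forall u v, g (u * v) = g u * g v) (g1 : g 1 = 1).

Lemma col_diag (f : 'I_n -> laurent) R S :
  (forall i j, g (x i j) = f j *: x i j) ->
  g (sminor R S) = (\prod_(b in S) f b) *: sminor R S.
Proof.
move=> gx; elim: R S => [|a R IH] S /=.
  case: eqP => [->|_]; first by rewrite big_set0 scale1r g1.
  by rewrite linear_fun0 // scaler0.
rewrite linear_fun_sum // scaler_sumr; apply: eq_bigr => b bS.
rewrite linear_funZ // gM gx IH (big_setD1 b bS) /=.
by rewrite -scalerAl -scalerAr !scalerA [in RHS]mulrC ?mulrA.
Qed.

Lemma row_diag (f : 'I_n -> laurent) R S :
  (forall i j, g (x i j) = f i *: x i j) ->
  g (sminor R S) = (\prod_(a <- R) f a) *: sminor R S.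
Proof.
move=> gx; elim: R S => [|a R IH] S /=.
  rewrite big_nil scale1r; case: eqP => _; first exact: g1.
  exact: linear_fun0.
rewrite linear_fun_sum // scaler_sumr; apply: eq_bigr => b bS.
rewrite linear_funZ // gM gx IH big_cons.
by rewrite -scalerAl -scalerAr !scalerA [in RHS]mulrC ?mulrA.
Qed.
End Diagonal.

Section Moves.
Variables s t : 'I_n.
Hypothesis st : (t = s.+1 :> nat)%N \/ (s = t.+1 :> nat)%N.

Lemma st_neq : s != t.
Proof. by rewrite -(inj_eq val_inj) /=; case: st; lia. Qed.

Lemma tperm_adj_lt (y b : 'I_n) : ~~ ((y == s) && (b == t) || (y == t) && (b == s)) ->
  (tperm s t y < tperm s t b)%N = (y < b)%N.
Proof.
have := st_neq; rewrite -!(inj_eq val_inj) /=.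
case: tpermP => [->|->|/eqP ys /eqP yt]; case: tpermP => [->|->|/eqP bs /eqP bt];
 move: st; rewrite -?(inj_eq val_inj) /=; try move: ys yt; try move: bs bt;
 rewrite -?(inj_eq val_inj) /=; lia.
Qed.

Lemma below_twist S b : b \in S -> ~~ ((s \in S) && (t \in S)) ->
  below (twist s t S) (tperm s t b) = below S b.
Proof.
move=> bS stS; rewrite /below -[RHS](card_imset _ (@perm_inj _ (tperm s t))).
apply: eq_card => y; rewrite -[y](tpermK s t); set z := tperm s t y.
rewrite (mem_imset _ _ (@perm_inj _ (tperm s t))) !inE tpermK.
case zS: (z \in S) => //=; apply: tperm_adj_lt.
apply: contra stS => /orP[]/andP[/eqP<- /eqP<-]; by rewrite zS bS.
Qed.

Lemma below_both S (c d : 'I_n) : (d = c.+1 :> nat)%N -> c \in S ->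
  below S d = (below S c).+1.
Proof.
move=> cd cS; rewrite /below (cardsD1 c) inE cS cd ltnS leqnn add1n; congr _.+1.
apply: eq_card => y; rewrite !inE ltnS andbCA; congr (_ && _).
by rewrite ltn_neqAle.
Qed.

Section ColumnMove.
Variables (u v : 'I_n -> laurent) (K E K' : A -> A).
Hypothesis sk : skew_derivation x (fun _ => u) (fun _ => v)
  (fun i j => if j == s then x i t else 0) K E K'.
Hypothesis u1 : forall j, j != s -> j != t -> u j = 1.
Hypothesis v1 : forall j, j != s -> j != t -> v j = 1.
Hypothesis uv : forall S, s \in S -> t \in S ->
  (- qV) ^+ below S s * v t + (- qV) ^+ below S t * u t = 0.

(** If [s] but not [t] lies in [S], the expansions match term by term under the transposition. If
    both do, only the terms at [b = s] and [b = t] survive; both are multiples of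
    [x a t * sminor R (S :\ s)], and [uv] says that their coefficients cancel. *)
Lemma col_move R S : E (sminor R S) =
  if (s \in S) && (t \notin S) then sminor R (twist s t S) else 0.
Proof.
have El := skewE_lin sk.
have K'm R' S' : K' (sminor R' S') = (\prod_(b in S') v b) *: sminor R' S'.
  by apply: (col_diag (skewK'_lin sk) (skewK'M sk) (skewK'1 sk)) (skewK'x sk).
have prodv S' : s \notin S' -> \prod_(b in S') v b = if t \in S' then v t else 1.
  move=> sS; rewrite (bigID (pred1 t)) /= [X in _ * X]big1 ?mulr1.
    case: ifP => tS; last first.
      by rewrite big_pred0 // => b; apply/andP=> -[bS /eqP E']; rewrite -E' bS in tS.
    rewrite (big_pred1 t) // => b /=; case: eqP => [->|]; rewrite ?tS ?andbF //.
  by move=> b /andP[bS bt]; apply: v1 => //; apply: contraNneq sS => <-.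
elim: R S => [|a R IH] S /=.
  have -> : E (S == set0)%:R = 0.
    by case: eqP => _; [exact: (skewE1 sk)|exact: linear_fun0].
  case: ifP => // /andP[sS _].
  by case: eqP => // /setP/(_ t); rewrite !inE tpermR sS.
have Eb b : E (x a b * sminor R (S :\ b)) =
    (if b == s then x a t * K' (sminor R (S :\ b)) else 0)
    + u b *: (x a b * E (sminor R (S :\ b))).
  rewrite (skewEM sk) (skewEx sk) (skewKx sk) -scalerAl; congr (_ + _).
  by case: ifP; rewrite ?mul0r.
rewrite (linear_fun_sum El) (eq_bigr _ (fun b _ => linear_funZ El _ _)).
  under [in LHS]eq_bigr => b _ do rewrite Eb IH.
case sS: (s \in S) => /=; last first.
  apply: big1 => b bS; rewrite !inE sS andbF mulr0 scaler0 addr0.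
  by case: eqP => [E'|_]; [rewrite -E' bS in sS|rewrite scaler0].
case tS: (t \in S) => /=.
  have ts : t != s by rewrite eq_sym st_neq.
  rewrite (bigD1 s) //= (bigD1 t) /=; last by rewrite tS.
  rewrite big1 => [|b /andP[/andP[bS bs] bt]]; last first.
    rewrite (negbTE bs) add0r !inE tS [t == b]eq_sym bt [s == b]eq_sym bs sS /=.
    by rewrite mulr0 !scaler0.
  rewrite addr0 eqxx (negbTE ts) !inE !eqxx sS tS st_neq ts /= mulr0 scaler0 addr0.
  rewrite add0r K'm prodv ?setD11 // !inE ts tS /= twist_both //.
  by rewrite -scalerAr !scalerA -scalerDl uv // scale0r.
rewrite [RHS](reindex_inj (@perm_inj _ (tperm s t))) /=.
have inS b : (tperm s t b \in twist s t S) = (b \in S) by rewrite inE tpermK.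
rewrite [RHS](eq_bigl _ _ inS).
apply: eq_bigr => b bS; rewrite below_twist ?sS ?tS //; congr (_ *: _).
have bt : b != t by apply: contraFneq tS => <-.
case: eqP => [->|/eqP bs].
  rewrite tpermL !inE eqxx /= mulr0 scaler0 addr0 K'm prodv ?setD11 //.
  by rewrite !inE tS andbF scale1r twist_s ?tS.
rewrite tpermD 1?eq_sym // add0r !inE sS tS andbF eq_sym bs /= u1 // scale1r.
by rewrite -twistD1 tpermD // eq_sym.
Qed.
End ColumnMove.

Section RowMove.
Variables (u v : 'I_n -> laurent) (K E K' : A -> A).
Hypothesis sk : skew_derivation x (fun i _ => u i) (fun i _ => v i)
  (fun i j => if i == s then x t j else 0) K E K'.
Hypothesis u1 : forall j, j != s -> j != t -> u j = 1.
Hypothesis v1 : forall j, j != s -> j != t -> v j = 1.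

Let El := skewE_lin sk.

Let K'm R S : K' (sminor R S) = (\prod_(a <- R) v a) *: sminor R S.
Proof. by apply: (row_diag (skewK'_lin sk) (skewK'M sk) (skewK'1 sk)) (skewK'x sk). Qed.

Let E_cons a R S : E (sminor (a :: R) S) =
  (if a == s then \sum_(b in S) (- qV) ^+ below S b *:
                    (x t b * K' (sminor R (S :\ b))) else 0)
  + u a *: \sum_(b in S) (- qV) ^+ below S b *: (x a b * E (sminor R (S :\ b))).
Proof.
rewrite /= (linear_fun_sum El) (eq_bigr _ (fun b _ => linear_funZ El _ _)).
under [in LHS]eq_bigr => b _ do
  rewrite (skewEM sk) (skewEx sk) (skewKx sk) -scalerAl scalerDr.
rewrite big_split scaler_sumr /=; congr (_ + _); last first.
  by apply: eq_bigr => b _; rewrite !scalerA mulrC.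
by case: eqP => // _; apply: big1 => b _; rewrite mul0r scaler0.
Qed.

Lemma row_move_out R S : s \notin R -> E (sminor R S) = 0.
Proof.
elim: R S => [|a R IH] S.
  by rewrite /=; case: eqP => _ _; [exact: (skewE1 sk)|exact: linear_fun0].
rewrite inE negb_or eq_sym => /andP[/negbTE as_ sR].
rewrite E_cons as_ add0r big1 ?scaler0 // => b _.
by rewrite IH // mulr0 scaler0.
Qed.

Lemma row_move_in R S : uniq R -> s \in R -> t \notin R ->
  E (sminor R S) = sminor (map (tperm s t) R) S.
Proof.
elim: R S => [|a R IH] S //= /andP[aR uR].
rewrite !inE negb_or [s == a]eq_sym => sR /andP[ta tR]; rewrite -/(sminor (a :: R) S) E_cons.
case: eqP sR aR => [->|/eqP as_] /= sR aR.
  rewrite tpermL [X in _ + _ *: X]big1 => [|b _]; last first.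
    by rewrite row_move_out // mulr0 scaler0.
  rewrite scaler0 addr0; apply: eq_bigr => b _; rewrite K'm big1_seq ?scale1r.
    congr (_ *: (_ * sminor _ _)); rewrite -[LHS]map_id.
    apply/eq_in_map => y yR; rewrite tpermD //.
      by apply: contraNneq aR => ->.
    by apply: contraNneq tR => ->.
  move=> y /= yR; apply: v1; first by apply: contraNneq aR => <-.
  by apply: contraNneq tR => <-.
rewrite add0r u1 // 1?eq_sym // scale1r tpermD // 1?eq_sym //.
by apply: eq_bigr => b _; rewrite IH.
Qed.

Hypothesis xr : qm_rels (fun i j i' l => x i j * x i' l).

(** After two expansions, the term of a pair [b < b'] cancels that of the exchanged pair: the row
    relation gives a factor [q^-1], and the exchange creates one more inversion, that is a factor
    [-q^-1]. *)
Lemma sminor_dd a R S : sminor (a :: a :: R) S = 0.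
Proof.
rewrite /=.
under eq_bigr => b _ do rewrite mulr_sumr scaler_sumr.
pose F b b' := (- qV) ^+ (below S b + below (S :\ b) b') *:
   (x a b * x a b' * sminor R (S :\ b :\ b')).
rewrite (eq_bigr (fun b => \sum_(b' in S :\ b) F b b')); last first.
  move=> b _; apply: eq_bigr => b' _.
  by rewrite -scalerAr scalerA -exprD mulrA.
rewrite pair_big_dep /= (bigID (fun p : 'I_n * 'I_n => (p.1 < p.2)%N)) /=.
rewrite [X in _ + X](reindex_inj (h := fun p : 'I_n * 'I_n => (p.2, p.1))) /=; last first.
  by case=> [b b'] [c c'] /= [-> ->].
rewrite [X in _ + X](eq_bigl (fun p : 'I_n * 'I_n =>
  (p.1 \in S) && (p.2 \in S :\ p.1) && (p.1 < p.2)%N)); last first.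
  case=> b b' /=; rewrite !inE; case: (eqVneq b b') => [->|bb'] /=.
    by rewrite andbF.
  case: (b \in S); rewrite ?andbF //= ?andbT; case: (b' \in S) => //=.
  by rewrite -leqNgt ltn_neqAle bb'.
rewrite -big_split big1 //= => -[b b'] /=; rewrite !inE.
case/andP=> /andP[bS /andP[_ b'S]] lt; rewrite /F.
have -> : S :\ b' :\ b = S :\ b :\ b' by apply/setP=> y; rewrite !inE andbCA.
have -> : below (S :\ b') b = below S b.
  apply: eq_card => y; rewrite !inE; case: eqP => [->|_] //=.
  by rewrite ltnNge (ltnW lt) andbF.
have -> : below S b' = (below (S :\ b) b').+1.
  rewrite /below (cardsD1 b) inE bS lt add1n; congr _.+1.
  by apply: eq_card => y; rewrite !inE andbA.
rewrite (qm_row xr a lt) -scalerAl scalerA -scalerDl.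
rewrite addSn exprS addnC.
by rewrite mulNr [_ * qV]mulrC subrr scale0r.
Qed.

(** [E] turns row [s] into a second copy of row [t], and the weight coming from [K'] is a scalar
    common to all terms, so [sminor_dd] applies. *)
Lemma row_move_st R S : uniq (s :: t :: R) -> E (sminor (s :: t :: R) S) = 0.
Proof.
move=> /and3P[sR tR uR]; rewrite E_cons eqxx.
rewrite [X in _ + _ *: X]big1 => [|b _]; last first.
  by rewrite row_move_out // mulr0 scaler0.
rewrite scaler0 addr0.
under eq_bigr => b _ do rewrite K'm -scalerAr scalerA mulrC -scalerA.
by rewrite -scaler_sumr -/(sminor (t :: t :: R) S) sminor_dd scaler0.
Qed.

Lemma row_move_ts R S : uniq (t :: s :: R) -> E (sminor (t :: s :: R) S) = 0.
Proof.
move=> /and3P[tR sR uR]; rewrite E_cons eq_sym (negbTE st_neq) add0r.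
have tR' : t \notin R by apply: contra tR; rewrite inE orbC => ->.
under eq_bigr => b _ do rewrite row_move_in ?inE ?eqxx //= ?sR //.
rewrite tpermL.
have -> : map (tperm s t) R = R.
  rewrite -[RHS]map_id; apply/eq_in_map => y yR; rewrite tpermD //.
    by apply: contraNneq sR => ->.
  by apply: contraNneq tR' => ->.
by rewrite -/(sminor (t :: t :: R) S) sminor_dd scaler0.
Qed.

(** Rows in front of the pair are peeled off by Laplace expansion: none of them is [s], so [E]
    passes through to [R2]. *)
Lemma row_move_both R1 R2 S :
  s \notin R1 ->
  (forall S', E (sminor R2 S') = 0) -> E (sminor (R1 ++ R2) S) = 0.
Proof.
move=> + E0; elim: R1 S => [|a R1 IH] S //.
rewrite inE negb_or eq_sym => /andP[/negbTE as_ sR].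
rewrite E_cons as_ add0r big1 ?scaler0 // => b _.
by rewrite IH // mulr0 scaler0.
Qed.
End RowMove.
End Moves.
End Minors.

(** * Increasing enumerations of index sets *)

Section Enumerations.
Variable n : nat.
Implicit Types (S R : {set 'I_n}).

Lemma increasing_enum S : increasing (enum S).
Proof.
have -> : enum S = [seq y <- enum 'I_n | y \in S] by rewrite enumT.
apply: sorted_filter; first by move=> ? ? ?; apply: ltn_trans.
have := iota_ltn_sorted 0 n; rewrite -val_enum_ord sorted_map.
by [].
Qed.

Lemma increasing_eq (s t : seq 'I_n) :
  increasing s -> increasing t -> s =i t -> s = t.
Proof.
apply: irr_sorted_eq; first by move=> ? ? ?; apply: ltn_trans.
by move=> ?; apply: ltnn.
Qed.

Lemma enum_twist (s t : 'I_n) R : (t = s.+1 :> nat)%N \/ (s = t.+1 :> nat)%N ->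
  s \in R -> t \notin R -> map (tperm s t) (enum R) = enum (twist s t R).
Proof.
move=> st sR tR; apply: increasing_eq; last 1 first.
- move=> y; rewrite mem_enum inE; apply/mapP/idP => [[z zR ->]|yR].
    by rewrite tpermK -mem_enum.
  by exists (tperm s t y); rewrite ?mem_enum ?tpermK.
- rewrite /increasing sorted_map.
  have := increasing_enum R; rewrite /increasing => sR'.
  have aR : all (mem R) (enum R) by apply/allP => y; rewrite mem_enum.
  apply: (sub_in_sorted _ aR sR') => y b yR bR /= yb.
  rewrite tperm_adj_lt //; apply/negP=> /orP[]/andP[/eqP ey /eqP eb].
    by rewrite inE eb (negbTE tR) in bR.
  by rewrite inE ey (negbTE tR) in yR.
- exact: increasing_enum.
Qed.

(** No index lies strictly between [c] and [d], so they are neighbours in the enumeration. This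
    reduces a minor containing both rows to the case where they come first. *)
Lemma enum_both (c d : 'I_n) R : (d = c.+1 :> nat)%N -> c \in R -> d \in R ->
  exists R1 R2 : seq 'I_n, enum R = R1 ++ c :: d :: R2 /\ c \notin R1 /\ d \notin R1.
Proof.
move=> cd cR dR; exists (enum [set y in R | (y < c)%N]), (enum [set y in R | (d < y)%N]).
split; last by rewrite !mem_enum !inE cR dR ltnn cd /= ltnNge leqnSn.
apply: increasing_eq; first exact: increasing_enum.
  have tr : transitive (fun i j : 'I_n => (i < j)%N) by move=> ? ? ?; apply: ltn_trans.
  rewrite /increasing (sorted_pairwise tr) pairwise_cat /= -!(sorted_pairwise tr).
  rewrite cd leqnn -!/(increasing _) !increasing_enum /= andbT.
  apply/and3P; split; last 2 first.
  - by apply/allP => y; rewrite mem_enum inE => /andP[_]; lia.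
  - by apply/allP => y; rewrite mem_enum inE => /andP[_].
  apply/allrelP => y z; rewrite mem_enum inE => /andP[_ yc].
  rewrite !inE mem_enum inE => /or3P[/eqP->|/eqP->|/andP[_]] //; lia.
move=> y; rewrite mem_cat !inE !mem_enum !inE.
case: (ltngtP y c) => [yc|yc|/val_inj ->]; rewrite ?cR ?eqxx ?orbT //.
- by rewrite andbT; case: (y \in R) => //=; apply/esym; apply/negP => /or3P[/eqP e|/eqP e|];
   [rewrite e ltnn in yc|rewrite e in yc; lia| lia].
- rewrite andbF /=; case: (ltngtP d y) => [dy|dy|/val_inj <-]; rewrite ?dR ?eqxx ?orbT ?andbT //.
    by rewrite -!(inj_eq val_inj) /= !gtn_eqF.
  lia.
Qed.
End Enumerations.

(** * Raising and lowering on products of two minors *)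

Section Operators.
Variables (k : fieldType) (n : nat).
Local Notation laurent := (laurent k).
Variables (A : algType laurent) (x : 'I_n -> 'I_n -> A).
Hypothesis xr : qm_rels (fun i j i' l => x i j * x i' l).
Hypothesis col_raise : forall c d : 'I_n, (d = c.+1 :> nat)%N -> exists K E K',
  skew_derivation x (fun _ => raise_wt k c d) (fun _ _ => 1)
                  (fun i j => if j == c then x i d else 0) K E K'.
Hypothesis col_lower : forall c d : 'I_n, (d = c.+1 :> nat)%N -> exists K E K',
  skew_derivation x (fun _ _ => 1) (fun _ => lower_wt k c d)
                  (fun i j => if j == d then x i c else 0) K E K'.
Hypothesis row_raise : forall c d : 'I_n, (d = c.+1 :> nat)%N -> exists K E K',
  skew_derivation x (fun i _ => raise_wt k c d i) (fun _ _ => 1)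
                  (fun i j => if i == c then x d j else 0) K E K'.
Hypothesis row_lower : forall c d : 'I_n, (d = c.+1 :> nat)%N -> exists K E K',
  skew_derivation x (fun _ _ => 1) (fun i _ => lower_wt k c d i)
                  (fun i j => if i == d then x c j else 0) K E K'.

Implicit Types S R : {set 'I_n}.
Definition minor R S : A := sminor x (enum R) S.

(** One kind of index is frozen in [p], so that rows and columns can be treated alike. The operators
    do not depend on [p]; hence a single operator acts on both sides of a relation whose factors
    occur in opposite orders. *)
Definition colfam (p : {set 'I_n} * {set 'I_n}) S S' := minor p.1 S * minor p.2 S'.
Definition rowfam (p : {set 'I_n} * {set 'I_n}) R R' := minor R p.1 * minor R' p.2.

(* Eigenvalue of the Cartan element [K_c] on the minors with index set [S]. *)
Definition kap (c d : 'I_n) S : laurent :=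
  if c \in S then (if d \in S then 1 else qV) else if d \in S then q else 1.

Lemma prod_wt (c d : 'I_n) (a b : laurent) S : c != d -> a * b = 1 ->
  \prod_(j in S) (if j == c then a else if j == d then b else 1) =
  if c \in S then (if d \in S then 1 else a) else if d \in S then b else 1.
Proof.
move=> cNd ab.
have dNc : (d == c) = false by rewrite eq_sym (negbTE cNd).
have rest : \prod_(j in S :\ c :\ d) (if j == c then a else if j == d then b else 1) = 1.
  by apply: big1 => j; rewrite !inE => /and3P[/negbTE-> /negbTE->].
case cS: (c \in S); case dS: (d \in S).
- by rewrite (big_setD1 c) //= (big_setD1 d) ?inE ?dNc ?dS //= rest ?eqxx ?dNc ?mulr1.
- have e : S :\ c :\ d = S :\ c.
    by apply/setP=> j; rewrite !inE; case: eqP => // ->; rewrite dS andbF.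
  by rewrite (big_setD1 c) //= eqxx -e rest mulr1.
- have e : S :\ c :\ d = S :\ d.
    by apply/setP=> j; rewrite !inE; case: (j =P c) => [->|]; rewrite ?cS ?andbF.
  by rewrite (big_setD1 d) //= eqxx dNc -e rest mulr1.
- move: rest; have -> // : S :\ c :\ d = S.
  apply/setP=> j; rewrite !inE.
  case jS: (j \in S); rewrite ?andbF // ?andbT.
  by apply/andP; split; [apply: contraFneq dS => <-|apply: contraFneq cS => <-].
Qed.

(** The coproduct rule: to reach the second factor the operator passes the first and picks up its
    weight. In [lowering] it is the first term that carries the weight of the other factor. *)
Definition raising (c d : 'I_n) (E : A -> A)
    (f : {set 'I_n} * {set 'I_n} -> {set 'I_n} -> {set 'I_n} -> A) :=
  forall p S S', E (f p S S') =
    (if (c \in S) && (d \notin S) then f p (twist c d S) S' else 0) +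
    (if (c \in S') && (d \notin S') then kap c d S *: f p S (twist c d S') else 0).

Definition lowering (c d : 'I_n) (F : A -> A)
    (f : {set 'I_n} * {set 'I_n} -> {set 'I_n} -> {set 'I_n} -> A) :=
  forall p S S', F (f p S S') =
    (if (d \in S) && (c \notin S) then kap d c S' *: f p (twist c d S) S' else 0) +
    (if (d \in S') && (c \notin S') then f p S (twist c d S') else 0).

Lemma twist_sym (c d : 'I_n) : twist d c =1 twist c d.
Proof. by move=> S; apply/setP=> y; rewrite !inE tpermC. Qed.

Section Adjacent.
Variables c d : 'I_n.
Hypothesis cd : (d = c.+1 :> nat)%N.

Let cNd : c != d. Proof. by rewrite -(inj_eq val_inj) /= cd; lia. Qed.
Let dNc : d != c. Proof. by rewrite eq_sym. Qed.

Let raise_wt1 j : j != c -> j != d -> raise_wt k c d j = 1.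
Proof. by rewrite /raise_wt => /negbTE-> /negbTE->. Qed.

Let lower_wt1 j : j != c -> j != d -> lower_wt k c d j = 1.
Proof. by rewrite /lower_wt => /negbTE-> /negbTE->. Qed.

Lemma col_raising : exists E, linear E /\ raising c d E colfam.
Proof.
have [K [E [K' sk]]] := col_raise cd; exists E; split; first exact: skewE_lin sk.
have Em R S : E (minor R S) = if (c \in S) && (d \notin S) then minor R (twist c d S) else 0.
  apply: (col_move (or_introl cd) sk) => // S' cS dS.
  rewrite (below_both cd) // exprS /raise_wt eqxx (negbTE dNc) mulr1.
  by rewrite mulrAC mulNr (qVq k) mulN1r subrr.
have K'm R S : K' (minor R S) = minor R S.
  rewrite /minor (col_diag (skewK'_lin sk) (skewK'M sk) (skewK'1 sk) _ _ (skewK'x sk)).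
  by rewrite big1 ?scale1r.
have Km R S : K (minor R S) = kap c d S *: minor R S.
  rewrite /minor (col_diag (skewK_lin sk) (skewKM sk) (skewK1 sk) _ _ (skewKx sk)).
  by rewrite prod_wt ?qVq.
move=> p S S'; rewrite /colfam (skewEM sk) !Em K'm Km.
case: ifP => _; case: ifP => _; rewrite ?mul0r ?mulr0 ?addr0 ?add0r //.
- by rewrite -scalerAl.
- by rewrite -scalerAl.
Qed.

Lemma col_lowering : exists F, linear F /\ lowering c d F colfam.
Proof.
have [K [E [K' sk]]] := col_lower cd; exists E; split; first exact: skewE_lin sk.
have Em R S : E (minor R S) = if (d \in S) && (c \notin S) then minor R (twist c d S) else 0.
  rewrite -twist_sym; apply: (col_move (or_intror cd) sk) => // [j jd jc|S' dS cS].
    exact: lower_wt1.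
  rewrite (below_both cd) // exprS /lower_wt eqxx mulr1.
  by rewrite mulrAC mulNr (qVq k) mulN1r addrC subrr.
have K'm R S : K' (minor R S) = kap d c S *: minor R S.
  rewrite /minor (col_diag (skewK'_lin sk) (skewK'M sk) (skewK'1 sk) _ _ (skewK'x sk)).
  rewrite prod_wt ?mulqqV // /kap; by case: ifP; case: ifP.
have Km R S : K (minor R S) = minor R S.
  rewrite /minor (col_diag (skewK_lin sk) (skewKM sk) (skewK1 sk) _ _ (skewKx sk)).
  by rewrite big1 ?scale1r.
move=> p S S'; rewrite /colfam (skewEM sk) !Em K'm Km.
case: ifP => _; case: ifP => _; rewrite ?mul0r ?mulr0 ?addr0 ?add0r //.
- by rewrite -scalerAr.
- by rewrite -scalerAr.
Qed.

Lemma row_move_sets (s t : 'I_n) (u v : 'I_n -> laurent) (K E K' : A -> A) : (t = s.+1 :> nat)%N \/ (s = t.+1 :> nat)%N ->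
  skew_derivation x (fun i _ => u i) (fun i _ => v i)
    (fun i j => if i == s then x t j else 0) K E K' ->
  (forall j, j != s -> j != t -> u j = 1) ->
  (forall j, j != s -> j != t -> v j = 1) ->
  forall R S, E (minor R S) =
    if (s \in R) && (t \notin R) then minor (twist s t R) S else 0.
Proof.
move=> st sk u1 v1 R S; rewrite /minor; case sR: (s \in R) => /=; last first.
  by apply: (row_move_out sk); rewrite mem_enum sR.
case tR: (t \in R) => /=.
  case: st => e.
    have [R1 [R2 [eR [sR1 tR1]]]] := enum_both e sR tR.
    have := enum_uniq R; rewrite eR cat_uniq => /and3P[_ _ uR].
    by apply: (row_move_both sk) => // S'; apply: (row_move_st sk).
  have [R1 [R2 [eR [sR1 tR1]]]] := enum_both e tR sR.
  have := enum_uniq R; rewrite eR cat_uniq => /and3P[_ _ uR].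
  by apply: (row_move_both sk) => // S'; apply: (row_move_ts (or_intror e) sk u1 v1).
by rewrite -enum_twist ?tR // (row_move_in sk u1 v1) ?mem_enum ?tR ?enum_uniq.
Qed.

Lemma row_raising : exists E, linear E /\ raising c d E rowfam.
Proof.
have [K [E [K' sk]]] := row_raise cd; exists E; split; first exact: skewE_lin sk.
have Em := row_move_sets (or_introl cd) sk raise_wt1 (fun _ _ _ => erefl).
have K'm R S : K' (minor R S) = minor R S.
  rewrite /minor (row_diag (skewK'_lin sk) (skewK'M sk) (skewK'1 sk) _ _ (skewK'x sk)).
  by rewrite big1 ?scale1r.
have Km R S : K (minor R S) = kap c d R *: minor R S.
  rewrite /minor (row_diag (skewK_lin sk) (skewKM sk) (skewK1 sk) _ _ (skewKx sk)).
  by rewrite big_enum prod_wt ?qVq.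
move=> p S S'; rewrite /rowfam (skewEM sk) !Em K'm Km.
case: ifP => _; case: ifP => _; rewrite ?mul0r ?mulr0 ?addr0 ?add0r //.
- by rewrite -scalerAl.
- by rewrite -scalerAl.
Qed.

Lemma row_lowering : exists F, linear F /\ lowering c d F rowfam.
Proof.
have [K [E [K' sk]]] := row_lower cd; exists E; split; first exact: skewE_lin sk.
have Em R S : E (minor R S) = if (d \in R) && (c \notin R) then minor (twist c d R) S else 0.
  rewrite -twist_sym; apply: (row_move_sets (or_intror cd) sk) => // j jd jc.
  exact: lower_wt1.
have K'm R S : K' (minor R S) = kap d c R *: minor R S.
  rewrite /minor (row_diag (skewK'_lin sk) (skewK'M sk) (skewK'1 sk) _ _ (skewK'x sk)).
  rewrite big_enum prod_wt ?mulqqV // /kap; by case: ifP; case: ifP.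
have Km R S : K (minor R S) = minor R S.
  rewrite /minor (row_diag (skewK_lin sk) (skewKM sk) (skewK1 sk) _ _ (skewKx sk)).
  by rewrite big1 ?scale1r.
move=> p S S'; rewrite /rowfam (skewEM sk) !Em K'm Km.
case: ifP => _; case: ifP => _; rewrite ?mul0r ?mulr0 ?addr0 ?add0r //.
- by rewrite -scalerAr.
- by rewrite -scalerAr.
Qed.
End Adjacent.
End Operators.

(** * The Hecke operator *)

Lemma linear_fun_comp (R : nzRingType) (U V W : lmodType R) (g : V -> W) (f : U -> V) :
  linear g -> linear f -> linear (g \o f).
Proof. by move=> lg lf a u v /=; rewrite lf lg. Qed.

Section Families.
Variables (k : fieldType) (n : nat).
Local Notation laurent := (laurent k).
Variables (A : algType laurent).
Variable f : {set 'I_n} * {set 'I_n} -> {set 'I_n} -> {set 'I_n} -> A.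
Hypothesis f_raise : forall c d : 'I_n, (d = c.+1 :> nat)%N ->
  exists E, linear E /\ raising c d E f.
Hypothesis f_lower : forall c d : 'I_n, (d = c.+1 :> nat)%N ->
  exists E, linear E /\ lowering c d E f.
Implicit Types S : {set 'I_n}.

(** The transposition fixes the set in which [c] and [d] have the same status. The other set is
    moved by the raising operator if [c] is in both sets, by the lowering operator if it is in
    neither; any weight picked up is that of the fixed set, hence 1. *)
Lemma swap_low (c d : 'I_n) b : (d = c.+1 :> nat)%N -> exists O, linear O /\
  forall p S S', (c \in S) = b -> (c \in S') = b -> (d \in S) != (d \in S') ->
  O (f p S S') = f p (twist c d S) (twist c d S').
Proof.
move=> cd; case: b.
  have [E [lE rE]] := f_raise cd; exists E; split=> // p S S' cS cS'.
  rewrite rE /kap cS cS'.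
  case dS: (d \in S); case dS': (d \in S') => //= _; rewrite ?addr0 ?add0r.
    by rewrite scale1r [twist c d S]twist_fix // cS dS.
  by rewrite [twist c d S']twist_fix // cS' dS'.
have [E [lE rE]] := f_lower cd; exists E; split=> // p S S' cS cS'.
rewrite rE /kap cS cS'.
case dS: (d \in S); case dS': (d \in S') => //= _; rewrite ?addr0 ?add0r.
  by rewrite scale1r [twist c d S']twist_fix // cS' dS'.
by rewrite [twist c d S]twist_fix // cS dS.
Qed.

Lemma swap_high (c d : 'I_n) b : (d = c.+1 :> nat)%N -> exists O, linear O /\
  forall p S S', (d \in S) = b -> (d \in S') = b -> (c \in S) != (c \in S') ->
  O (f p S S') = f p (twist c d S) (twist c d S').
Proof.
move=> cd; case: b.
  have [E [lE rE]] := f_lower cd; exists E; split=> // p S S' dS dS'.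
  rewrite rE /kap dS dS'.
  case cS: (c \in S); case cS': (c \in S') => //= _; rewrite ?addr0 ?add0r.
    by rewrite [twist c d S]twist_fix // cS dS.
  by rewrite scale1r [twist c d S']twist_fix // cS' dS'.
have [E [lE rE]] := f_raise cd; exists E; split=> // p S S' dS dS'.
rewrite rE /kap dS dS'.
case cS: (c \in S); case cS': (c \in S') => //= _; rewrite ?addr0 ?add0r.
  by rewrite [twist c d S']twist_fix // cS' dS'.
by rewrite scale1r [twist c d S]twist_fix // cS dS.
Qed.

(** On two products exchanged by the transposition the matrix is [((q^-1, 1), (1, q))], of trace
    [q + q^-1] and determinant 0; this is the source of the quadratic Hecke relation. The value 0 is
    for both indices in one set, where the raising operator already vanishes. *)
Definition hecke_val (c d : 'I_n) p S S' :=
  if (c \in S) && (d \in S') then qV *: f p S S' + f p (twist c d S) (twist c d S')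
  else if (d \in S) && (c \in S') then
    q *: f p S S' + f p (twist c d S) (twist c d S')
  else 0.

Lemma hecke_adjacent (c d : 'I_n) : (d = c.+1 :> nat)%N -> exists H, linear H /\
  forall p S S', (c \in S) != (c \in S') -> (d \in S) != (d \in S') ->
  H (f p S S') = hecke_val c d p S S'.
Proof.
move=> cd; have [E [lE rE]] := f_raise cd; have [F [lF rF]] := f_lower cd.
exists (F \o E); split; first exact: linear_fun_comp.
move=> p S S' cc dd /=; rewrite rE (linear_funD lF) /hecke_val.
have F0 : F 0 = 0 by apply: (linear_fun0 lF).
have FL a u : F (a *: u) = a *: F u by apply: (linear_funZ lF).
case cS: (c \in S); case dS: (d \in S); rewrite cS in cc; rewrite dS in dd;
  move: cc dd; case cS': (c \in S'); case dS': (d \in S') => //= _ _;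
  rewrite ?F0 ?add0r ?addr0 //.
- rewrite rF !in_twist tpermL tpermR cS dS cS' dS' /= twistK /kap.
  by rewrite cS' dS'.
- rewrite FL rF !in_twist ?tpermL ?tpermR cS dS cS' dS' /= twistK /kap.
  rewrite cS dS !in_twist tpermL tpermR cS' dS' scalerDr scalerA mulqqV scale1r.
  by rewrite addrC.
Qed.

Lemma tperm_conj3 (c d e : 'I_n) S : c != e -> c != d ->
  twist e d (twist c e (twist e d S)) = twist c d S.
Proof.
move=> ce cd; apply/setP=> y; rewrite !in_twist.
have -> : tperm c d = (tperm c e ^ tperm e d)%g.
  by rewrite tpermJ tpermL tpermD // eq_sym.
by rewrite conjgE tpermV !permM.
Qed.

(* The entries strictly between [c] and [d] lie in both sets or in neither:
   [d] is brought next to [c] by swaps that do not change any coefficient. *)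
Lemma hecke_exists (C : {set 'I_n}) m (c d : 'I_n) : (d = c + m.+1 :> nat)%N ->
  exists H, linear H /\
  forall p S S', (c \in S) != (c \in S') -> (d \in S) != (d \in S') ->
  (forall e : 'I_n, (c < e < d)%N -> (e \in S) = (e \in C) /\ (e \in S') = (e \in C)) ->
  H (f p S S') = hecke_val c d p S S'.
Proof.
elim: m d => [|m IH] d dE.
  have cd : (d = c.+1 :> nat)%N by rewrite dE addn1.
  by have [H [lH HE]] := hecke_adjacent cd; exists H; split=> // p S S' cS dS _; exact: HE.
have en : (c + m.+1 < n)%N by have := ltn_ord d; lia.
have [e eE] : exists e : 'I_n, (e = c + m.+1 :> nat)%N by exists (Ordinal en).
have [H [lH HE]] := IH e eE.
have ed : (d = e.+1 :> nat)%N by rewrite dE eE addnS.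
have ced : (c < e < d)%N by rewrite ed eE; lia.
have [O1 [l1 O1E]] := swap_low (e \in C) ed.
have [O2 [l2 O2E]] := swap_high (e \in C) ed.
exists (O2 \o (H \o O1)); split; first by do 2!apply: linear_fun_comp => //.
move=> p S S' cS dS CE /=; have [eS eS'] := CE e ced.
have ce : c != e by rewrite -(inj_eq val_inj) /= eE; lia.
have cd : c != d by rewrite -(inj_eq val_inj) neq_ltn /= (ltn_trans _ (proj2 (andP ced))) ?(proj1 (andP ced)).
have ec : e != c by rewrite eq_sym.
have dc : d != c by rewrite eq_sym.
have ed' : e != d by rewrite -(inj_eq val_inj) /= ed neq_ltn ltnSn.
have de : d != e by rewrite eq_sym.
rewrite (O1E _ _ _ eS eS' dS) HE; first last.
- move=> y /andP[cy ye].
  have ey : e != y by rewrite -(inj_eq val_inj) neq_ltn /= ye orbT.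
  have yd : (y < d)%N by rewrite ed ltnS ltnW.
  have dy : d != y by rewrite -(inj_eq val_inj) neq_ltn /= yd orbT.
  by rewrite !in_twist !tpermD //; apply: CE; rewrite cy.
- by rewrite !in_twist !tpermL.
- by rewrite !in_twist !tpermD.
have O20 : O2 0 = 0 by exact: (linear_fun0 l2).
rewrite /hecke_val !in_twist !(tpermL e d) !(tpermD ec dc).
have o1 : O2 (f p (twist e d S) (twist e d S')) = f p S S'.
  by rewrite O2E ?twistK // !in_twist ?tpermL ?tpermR.
have o2 : O2 (f p (twist c e (twist e d S)) (twist c e (twist e d S'))) =
    f p (twist c d S) (twist c d S').
  by rewrite O2E ?tperm_conj3 // !in_twist ?[tperm c e d]tpermD ?tpermR ?tpermL ?(tpermD ec dc) // ?tpermR.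
case: ifP => _; first by rewrite (linear_funD l2) (linear_funZ l2) o1 o2.
by case: ifP => // _; rewrite (linear_funD l2) (linear_funZ l2) o1 o2.
Qed.
End Families.

(** * Quasi-commutation of ordered minors *)

Lemma card_twist (T : finType) (c d : T) (S : {set T}) : #|twist c d S| = #|S|.
Proof.
rewrite -(card_imset S (@perm_inj _ (tperm c d))); apply: eq_card => y.
by rewrite -[y in RHS](tpermK c d) (mem_imset _ _ (@perm_inj _ (tperm c d))) in_twist.
Qed.

Lemma twistI (T : finType) (c d : T) (S S' : {set T}) :
  twist c d (S :&: S') = twist c d S :&: twist c d S'.
Proof. by apply/setP=> y; rewrite !inE. Qed.

Lemma twistD (T : finType) (c d : T) (S S' : {set T}) :
  twist c d (S :\: S') = twist c d S :\: twist c d S'.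
Proof. by apply/setP=> y; rewrite !inE. Qed.

Lemma sum_twist (T : finType) (c d : T) (S : {set T}) (F : T -> nat) :
  c \in S -> d \notin S ->
  (\sum_(y in twist c d S) F y + F c = \sum_(y in S) F y + F d)%N.
Proof.
move=> cS dS; have dT : d \in twist c d S by rewrite in_twist tpermR.
rewrite (big_setD1 d dT) (big_setD1 c cS) /= twist_s //; lia.
Qed.

Lemma adjacent_change n (P : pred 'I_n) m (i j : 'I_n) : (j = i + m :> nat)%N ->
  P i != P j -> exists e e' : 'I_n,
  [/\ (e' = e.+1 :> nat)%N, (i <= e)%N, (e' <= j)%N & P e != P e'].
Proof.
elim: m j => [|m IH] j jE; first by rewrite (_ : j = i) ?eqxx //; apply: val_inj; rewrite /= jE addn0.
have jn : (i + m < n)%N by have := ltn_ord j; lia.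
have [j' j'E] : exists j' : 'I_n, (j' = i + m :> nat)%N by exists (Ordinal jn).
have jj' : (j = j'.+1 :> nat)%N by rewrite jE j'E addnS.
case: (eqVneq (P j') (P j)) => [<- Pi|Pj _].
  have [e [e' [ee' ie e'j Pe]]] := IH j' j'E Pi; exists e, e'; split=> //.
  by rewrite jj' (leq_trans e'j).
by exists j', j; split=> //; rewrite j'E leq_addr.
Qed.

Section Base.
Variables (k : fieldType) (n : nat).
Local Notation laurent := (laurent k).
Variables (A : algType laurent) (x : 'I_n -> 'I_n -> A).
Hypothesis xr : qm_rels (fun i j i' l => x i j * x i' l).
Hypothesis f_raise : forall c d : 'I_n, (d = c.+1 :> nat)%N ->
  exists E, linear E /\ raising c d E (colfam x).
Hypothesis f_lower : forall c d : 'I_n, (d = c.+1 :> nat)%N ->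
  exists E, linear E /\ lowering c d E (colfam x).
Implicit Types S L J : {set 'I_n}.
Local Notation minor := (minor x).

Lemma sminor_comm_gen (u : A) Q S :
  (forall a b, a \in Q -> b \in S -> u * x a b = x a b * u) ->
  u * sminor x Q S = sminor x Q S * u.
Proof.
elim: Q S => [|a Q IH] S uC /=; first by case: eqP; rewrite ?mulr1 ?mul1r ?mulr0 ?mul0r.
rewrite mulr_sumr mulr_suml; apply: eq_bigr => b bS.
rewrite -scalerAr -scalerAl; congr (_ *: _).
rewrite mulrA uC ?inE ?eqxx // -!mulrA; congr (_ * _); apply: IH => a' b' aQ.
by rewrite !inE => /andP[_ b'S]; apply: uC; rewrite ?inE ?aQ ?orbT.
Qed.

Lemma sminor_comm Q S Q' S' :
  (forall a b a' b', a \in Q -> b \in S -> a' \in Q' -> b' \in S' ->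
     x a b * x a' b' = x a' b' * x a b) ->
  sminor x Q S * sminor x Q' S' = sminor x Q' S' * sminor x Q S.
Proof.
move=> C; apply: sminor_comm_gen => a' b' aQ bS; apply/esym.
by apply: sminor_comm_gen => a b ? ?; apply/esym/C.
Qed.

Variables R R' : {set 'I_n}.
Hypothesis RR' : forall a a', a \in R -> a' \in R' -> (a < a')%N.

Definition qcomm z L J :=
  minor R' L * minor R J = q ^+ z *: (minor R J * minor R' L).

(** A linear operator acting on both orders of the product carries one quasi-commutation to another;
    the weight met in only one of the two orders becomes the extra factor [a]. *)
Lemma qcomm_transfer z (O : A -> A) (a : laurent) L J L' J' : linear O ->
  O (minor R' L * minor R J) = minor R' L' * minor R J' ->
  O (minor R J * minor R' L) = a *: (minor R J' * minor R' L') ->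
  qcomm z L J -> minor R' L' * minor R J' = (q ^+ z * a) *: (minor R J' * minor R' L').
Proof. by move=> lO e1 e2 e; rewrite -e1 e (linear_funZ lO) e2 scalerA. Qed.

Lemma qcomm_low z (c d : 'I_n) L J : (d = c.+1 :> nat)%N ->
  (c \in L) = (c \in J) -> (d \in L) != (d \in J) -> qcomm z L J ->
  qcomm z (twist c d L) (twist c d J).
Proof.
move=> cd cLJ dLJ e; have [O [lO OE]] := swap_low f_raise f_lower (c \in J) cd.
have := @qcomm_transfer z O 1 L J (twist c d L) (twist c d J) lO.
rewrite mulr1 scale1r; apply => //; first exact: (OE (R', R)).
by apply: (OE (R, R')) => //; rewrite eq_sym.
Qed.

Lemma qcomm_high z (c d : 'I_n) L J : (d = c.+1 :> nat)%N ->
  (d \in L) = (d \in J) -> (c \in L) != (c \in J) -> qcomm z L J ->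
  qcomm z (twist c d L) (twist c d J).
Proof.
move=> cd cLJ dLJ e; have [O [lO OE]] := swap_high f_raise f_lower (d \in J) cd.
have := @qcomm_transfer z O 1 L J (twist c d L) (twist c d J) lO.
rewrite mulr1 scale1r; apply => //; first exact: (OE (R', R)).
by apply: (OE (R, R')) => //; rewrite eq_sym.
Qed.

(** The lower rows [R'] meet only columns further to the left, so all entries involved commute. *)
Lemma qcomm0 L J : (forall l j, l \in L -> j \in J -> (l < j)%N) -> qcomm 0 L J.
Proof.
move=> LJ; rewrite /qcomm expr0 scale1r; apply: sminor_comm => a b a' b'.
rewrite !mem_enum => aR bL a'R b'J.
by apply/esym/(qm_comm xr); [exact: RR'|exact: LJ].
Qed.

(** The raising operator turns column [e] of [L] into [e'], already present in [J]. With [L] on the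
    left it acts without weight; with [J] on the left it first passes [J], whose weight is [q]. *)
Lemma qcomm_merge_up z (e e' : 'I_n) L J : (e' = e.+1 :> nat)%N ->
  e \in L -> e' \notin L -> e \notin J -> e' \in J -> qcomm z L J ->
  qcomm z.+1 (twist e e' L) J.
Proof.
move=> ee' eL e'L eJ e'J Q; have [E [lE rE]] := f_raise ee'.
rewrite /qcomm exprSr; apply: (qcomm_transfer lE _ _ Q).
  by have /= := rE (R', R) L J; rewrite eL e'L (negbTE eJ) addr0 => ->.
have /= := rE (R, R') J L; rewrite eL e'L (negbTE eJ) add0r => ->.
by rewrite /kap (negbTE eJ) e'J.
Qed.

Lemma qcomm_merge_down z (e e' : 'I_n) L J : (e' = e.+1 :> nat)%N ->
  e \in L -> e' \notin L -> e \notin J -> e' \in J -> qcomm z L J ->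
  qcomm z.+1 L (twist e e' J).
Proof.
move=> ee' eL e'L eJ e'J Q; have [E [lE rE]] := f_lower ee'.
rewrite /qcomm exprSr; apply: (qcomm_transfer lE _ _ Q).
  by have /= := rE (R', R) L J; rewrite e'J eJ (negbTE e'L) add0r => ->.
have /= := rE (R, R') J L; rewrite e'J eJ (negbTE e'L) addr0 => ->.
by rewrite /kap (negbTE e'L) eL.
Qed.

(** Swaps with neighbouring columns bring those of [L] alone to the left end and those of [J] alone
    to the right end; then a common column next to a free one is split into two private columns,
    which lowers the number of common columns. The bound on the cardinalities provides the free
    column. *)
Lemma minor_qcomm L J : (#|L| + #|J| <= n)%N ->
  (forall l j, l \in L :\: J -> j \in J :\: L -> (l < j)%N) ->
  qcomm #|L :&: J| L J.
Proof.
have [z] := ubnP #|L :&: J|; elim: z L J => [//|z IHz] L J.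
(* This decreases when a column of [L] alone moves left or a column of [J] alone moves right. *)
pose mu L J := (\sum_(l in L :\: J) l + \sum_(j in J :\: L) (n - j))%N.
have [m] := ubnP (mu L J); elim: m L J => [//|m IHm] L J muLJ zLJ cLJ LJ.
(* A column of [L] alone whose left neighbour is common or free is moved past it; the relation is
   then carried back by [qcomm_high]. *)
case: (boolP [exists l : 'I_n, [exists e : 'I_n,
   [&& l \in L :\: J, (l == e.+1 :> nat) & (e \in L) == (e \in J)]]]).
  case/existsP=> l /existsP[e /and3P[lLJ /eqP le /eqP eLJ]].
  set t := twist e l; have elp : (e < l)%N by rewrite le.
  have eN : e \notin L :\: J by rewrite inE eLJ andNb.
  have eN' : e \notin J :\: L by rewrite inE eLJ andNb.
  have lN : l \notin J :\: L by move: lLJ; rewrite !inE => /andP[_ ->].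
  have tJL : t J :\: t L = J :\: L.
    by rewrite -twistD twist_fix // (negbTE eN') (negbTE lN).
  have QL : qcomm #|t L :&: t J| (t L) (t J).
    apply: IHm; rewrite ?card_twist //.
    - rewrite /mu tJL -twistD /t.
      have := @sum_twist _ l e (L :\: J) (fun y => val y) lLJ eN.
      rewrite (twist_sym l e) /= => h'; rewrite ltnS in muLJ.
      apply: leq_trans muLJ; rewrite ltn_add2r -(ltn_add2r l) h'.
      by rewrite ltn_add2l.
    - by rewrite -twistI card_twist.
    - move=> l' j; rewrite tJL -twistD in_twist => l'L jJ.
      case: tpermP l'L => [-> _|-> eL|_ _ l'L]; last exact: LJ.
        exact: leq_trans elp (ltnW (LJ _ _ lLJ jJ)).
      by rewrite eL in eN.
  have := qcomm_high le _ _ QL; rewrite /t !in_twist !tpermL !tpermR eLJ !twistK.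
  rewrite -/t -twistI card_twist; apply=> //.
  by move: lLJ; rewrite inE => /andP[/negbTE-> ->].
rewrite negb_exists => /forallP noL.
case: (boolP [exists j : 'I_n, [exists e : 'I_n,
   [&& j \in J :\: L, (e == j.+1 :> nat) & (e \in L) == (e \in J)]]]).
  case/existsP=> j /existsP[e /and3P[jJL /eqP je /eqP eLJ]].
  set t := twist j e; have jep : (j < e)%N by rewrite je.
  have eN : e \notin L :\: J by rewrite inE eLJ andNb.
  have eN' : e \notin J :\: L by rewrite inE eLJ andNb.
  have jN : j \notin L :\: J by move: jJL; rewrite !inE => /andP[_ ->].
  have tLJ : t L :\: t J = L :\: J.
    by rewrite -twistD twist_fix // (negbTE eN) (negbTE jN).
  have QL : qcomm #|t L :&: t J| (t L) (t J).
    apply: IHm; rewrite ?card_twist //.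
    - rewrite /mu tLJ -twistD /t.
      have := @sum_twist _ j e (J :\: L) (fun y => (n - y)%N) jJL eN'.
      move=> /= h'; rewrite ltnS in muLJ.
      apply: leq_trans muLJ; rewrite ltn_add2l -(ltn_add2r (n - j)) h'.
      by rewrite ltn_add2l ltn_sub2l // (leq_trans _ (ltn_ord e)) // ltnW.
    - by rewrite -twistI card_twist.
    - move=> l j'; rewrite tLJ -twistD in_twist => lL j'J.
      case: tpermP j'J => [-> eJ|-> jJ|_ _ j'J]; last exact: LJ.
        by rewrite eJ in eN'.
      exact: leq_trans (LJ _ _ lL jJ) (ltnW jep).
  have := qcomm_low je _ _ QL; rewrite /t !in_twist !tpermL !tpermR eLJ !twistK.
  rewrite -/t -twistI card_twist; apply=> //.
  by move: jJL; rewrite inE => /andP[/negbTE-> ->].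
rewrite negb_exists => /forallP noJ.
(* When no such move is left, [L :\: J] is an initial segment and [J :\: L], by [upJ], a final
   one. *)
have downL m' (l y : 'I_n) : (l = y + m' :> nat)%N -> l \in L :\: J -> y \in L :\: J.
  elim: m' l => [|m' IH] l lE lLJ; first by rewrite (_ : y = l) //; apply: val_inj; rewrite /= lE addn0.
  have en : (y + m' < n)%N by have := ltn_ord l; lia.
  have [e eE] : exists e : 'I_n, (e = y + m' :> nat)%N by exists (Ordinal en).
  apply: (IH e eE).
  have le : (l = e.+1 :> nat)%N by rewrite lE eE addnS.
  have := noL l; rewrite negb_exists => /forallP/(_ e); rewrite lLJ le eqxx /=.
  rewrite !inE; case eL: (e \in L); case eJ: (e \in J) => //= _.
  have := LJ l e lLJ; rewrite inE eL eJ le => /(_ isT); lia.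
have upJ m' (j y : 'I_n) : (y = j + m' :> nat)%N -> j \in J :\: L -> y \in J :\: L.
  elim: m' j => [|m' IH] j jE jJL; first by rewrite (_ : y = j) //; apply: val_inj; rewrite /= jE addn0.
  have en : (j.+1 < n)%N by have := ltn_ord y; lia.
  have [e eE] : exists e : 'I_n, (e = j.+1 :> nat)%N by exists (Ordinal en).
  apply: (IH e); first by rewrite eE jE addSnnS.
  have := noJ j; rewrite negb_exists => /forallP/(_ e); rewrite jJL eE eqxx /=.
  rewrite !inE; case eL: (e \in L); case eJ: (e \in J) => //= _.
  have := LJ e j; rewrite jJL inE eL eJ eE => /(_ isT isT); lia.
case: (posnP #|L :&: J|) => [c0|c0].
  rewrite c0; have LJ0 : L :&: J = set0 by apply/eqP; rewrite -cards_eq0 c0.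
  apply: qcomm0 => l j lL jJ.
  have nn y : ~~ ((y \in L) && (y \in J)) by rewrite -in_setI LJ0 inE.
  apply: LJ; rewrite inE ?lL ?jJ ?andbT.
    by have := nn l; rewrite lL.
  by have := nn j; rewrite jJ andbT.
have [c] : exists c, c \in L :&: J by apply/set0Pn; rewrite -card_gt0.
(* The union has [#|L| + #|J| - #|L :&: J|] elements, fewer than [n], so some column is free. *)
have [u] : exists u, u \notin L :|: J.
  apply/existsP; rewrite -negb_forall; apply/negP=> /forallP all.
  have : #|L :|: J| = n.
    by rewrite -[RHS]card_ord; apply: eq_card => y; rewrite all.
  have := subset_leq_card (subsetIl L J); move: c0 cLJ; rewrite cardsU.
  by move: #|L :&: J| #|L| #|J| => a b d; clear; lia.
rewrite !inE negb_or => /andP[uL uJ] /andP[cL cJ].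
have even_le (i j y : 'I_n) : (i \in L) = (i \in J) -> (j \in L) = (j \in J) ->
    (i <= y)%N -> (y <= j)%N -> (y \in L) = (y \in J).
  move=> iLJ jLJ iy yj; have yE : (y = i + (y - i) :> nat)%N by rewrite subnKC.
  have jE : (j = y + (j - y) :> nat)%N by rewrite subnKC.
  have := downL _ _ _ yE; have := upJ _ _ _ jE; rewrite !inE iLJ jLJ !andNb.
  by case: (y \in L); case: (y \in J) => //= h1 h2; [have := h2 isT|have := h1 isT].
(* Between a common and a free column every column is of one of these two kinds, so the two kinds
   occur side by side somewhere. *)
have [i [j [ij iLJ jLJ ijL]]] : exists i j : 'I_n, [/\ (i <= j)%N,
    (i \in L) = (i \in J), (j \in L) = (j \in J) & (i \in L) != (j \in L)].
  case: (leqP c u) => [cu|/ltnW uc].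
    by exists c, u; rewrite cL cJ (negbTE uL) (negbTE uJ).
  by exists u, c; rewrite cL cJ (negbTE uL) (negbTE uJ).
have jE : (j = i + (j - i) :> nat)%N by rewrite subnKC.
have [e [e' [ee' ie e'j eL]]] := adjacent_change jE ijL; move: eL => /= eL.
have eLJ : (e \in L) = (e \in J).
  by apply: (even_le i j) => //; rewrite (leq_trans _ e'j) // ee'.
have e'LJ : (e' \in L) = (e' \in J).
  by apply: (even_le i j) => //; rewrite (leq_trans ie) // ee'.
have hl l : l \in L :\: J -> (l < e)%N.
  move=> lLJ; rewrite ltnNge; apply/negP=> el.
  have lE : (l = e + (l - e) :> nat)%N by rewrite subnKC.
  by have := downL _ _ _ lE lLJ; rewrite inE eLJ andNb.
have hj y : y \in J :\: L -> (e' < y)%N.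
  move=> yJL; rewrite ltnNge; apply/negP=> ye.
  have yE : (e' = y + (e' - y) :> nat)%N by rewrite subnKC.
  by have := upJ _ _ _ yE yJL; rewrite inE e'LJ andNb.
have elt : (e < e')%N by rewrite ee'.
have eNe' : (e == e') = false by apply/eqP=> E; rewrite E ltnn in elt.
have order L1 J1 : (forall l, l \in L1 :\: J1 -> (l <= e)%N) ->
    (forall y, y \in J1 :\: L1 -> (e < y)%N) ->
    forall l y, l \in L1 :\: J1 -> y \in J1 :\: L1 -> (l < y)%N.
  by move=> h1 h2 l y /h1 le /h2; apply: leq_ltn_trans.
have inT S y : e != y -> e' != y -> (y \in twist e e' S) = (y \in S).
  by move=> ey e'y; rewrite in_twist tpermD.
have {}eL : (e \in L) != (e' \in L) := eL.
move: eL; case eL': (e \in L); case e'L: (e' \in L) => //= _; move: eLJ e'LJ;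
  rewrite eL' e'L => /esym eJ /esym e'J.
(* [e] is common and [e'] is free: the copy of [e] in [J] is first moved to [e'], and the lowering
   operator merges it back. *)
- have eJ1 : (e \in twist e e' J) = false by rewrite in_twist tpermL e'J.
  have e'J1 : e' \in twist e e' J by rewrite in_twist tpermR eJ.
  have LJ1 : #|L :&: J| = #|L :&: twist e e' J|.+1.
    rewrite (cardsD1 e (L :&: J)) inE eL' eJ add1n; congr _.+1; apply: eq_card => y.
    rewrite !inE; case: (eqVneq y e) => [->|ye] /=; first by rewrite tpermL e'J andbF.
    case: (eqVneq y e') => [->|ye']; first by rewrite e'L.
    by rewrite tpermD // eq_sym.
  rewrite LJ1 -[X in qcomm _ _ X](twistK e e' J).
  apply: qcomm_merge_down => //; rewrite ?e'L ?eJ1 //.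
  apply: IHz; [by rewrite -ltnS -LJ1 | by rewrite card_twist | apply: order => y].
    rewrite inE; case: (eqVneq e y) => [->//|ey]; case: (eqVneq e' y) => [<-|e'y].
      by rewrite e'J1.
    by rewrite inT // -in_setD => /hl/ltnW.
  rewrite inE; case: (eqVneq e' y) => [<- //|e'y]; case: (eqVneq e y) => [<-|ey].
    by rewrite eJ1 andbF.
  by rewrite inT // -in_setD => /hj; apply: ltn_trans.
(* [e'] is common and [e] is free: the copy of [e'] in [L] is first moved to [e], and the raising
   operator merges it back. *)
- have e'L1 : (e' \in twist e e' L) = false by rewrite in_twist tpermR eL'.
  have eL1 : e \in twist e e' L by rewrite in_twist tpermL e'L.
  have LJ1 : #|L :&: J| = #|twist e e' L :&: J|.+1.
    rewrite (cardsD1 e' (L :&: J)) inE e'L e'J add1n; congr _.+1; apply: eq_card => y.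
    rewrite !inE; case: (eqVneq y e') => [->|ye'] /=; first by rewrite tpermR eL'.
    case: (eqVneq y e) => [->|ye]; first by rewrite eJ !andbF.
    by rewrite tpermD // eq_sym.
  rewrite LJ1 -[X in qcomm _ X _](twistK e e' L).
  apply: qcomm_merge_up => //; rewrite ?e'L1 ?eJ //.
  apply: IHz; [by rewrite -ltnS -LJ1 | by rewrite card_twist | apply: order => y].
    rewrite inE; case: (eqVneq e y) => [->//|ey]; case: (eqVneq e' y) => [<-|e'y].
      by rewrite e'L1 andbF.
    by rewrite inT // -in_setD => /hl/ltnW.
  rewrite inE; case: (eqVneq e' y) => [<- //|e'y]; case: (eqVneq e y) => [<-|ey].
    by rewrite eL1.
  by rewrite inT // -in_setD => /hj; apply: ltn_trans.
Qed.
End Base.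

(** * Inversions and Laplace expansion *)

Section Inversions.
Local Open Scope nat_scope.

Lemma inversionsE p (f : 'I_p -> nat) :
  inversions f = \sum_(i < p) \sum_(j < p) ((i < j) && (f j < f i)).
Proof.
rewrite /inversions -sum1dep_card pair_big /= [LHS]big_mkcond.
by apply: eq_bigr => -[i j] _ /=; case: ifP.
Qed.

Lemma inversions_recl p (f : 'I_p.+1 -> nat) :
  inversions f = \sum_(j < p) (f (lift ord0 j) < f ord0)
                 + inversions (fun i => f (lift ord0 i)).
Proof.
rewrite !inversionsE big_ord_recl big_ord_recl /= add0n; congr (_ + _).
by apply: eq_bigr => i _; rewrite big_ord_recl /= add0n.
Qed.

Lemma eq_inversions p (f g : 'I_p -> nat) : f =1 g -> inversions f = inversions g.
Proof.
by move=> fg; rewrite !inversionsE; apply: eq_bigr => i _; apply: eq_bigr => j _; rewrite !fg.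
Qed.

Variable n : nat.
Implicit Types (S X : seq 'I_n).

Fixpoint seq_inv S : nat :=
  if S is a :: S' then count (fun y : 'I_n => y < a) S' + seq_inv S' else 0.

Lemma tuple_invE S : tuple_inv S = seq_inv S.
Proof.
elim: S => [|a S IH]; first by rewrite /tuple_inv inversionsE big_ord0.
rewrite -[tuple_inv _]/(@inversions (size S).+1 (fun i => val (tnth (in_tuple (a :: S)) i))).
rewrite inversions_recl.
rewrite [seq_inv (_ :: _)]/seq_inv -/seq_inv -IH; congr (_ + _).
  rewrite -sum1_count (big_tnth _ _ S) [RHS]big_mkcond /=.
  by apply: eq_bigr => i _; rewrite !(tnth_nth a) /=; case: ifP.
by apply: eq_inversions => i; rewrite !(tnth_nth a).
Qed.

(** The first value is [j], and exactly the [j] smaller values come after it. *)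
Lemma perm_inv_lift p (j : 'I_p.+1) (s : 'S_p) :
  Defs.perm_inv (lift_perm ord0 j s) = j + Defs.perm_inv s.
Proof.
rewrite /Defs.perm_inv inversions_recl lift_perm_id; congr (_ + _).
  under eq_bigr => i _ do rewrite lift_perm_lift.
  rewrite -(reindex_inj (@perm_inj _ s) (P := predT)
     (F := fun i : 'I_p => nat_of_bool (val (lift j i) < val j))) /=.
  rewrite -[RHS](card_ord j) -sum1_card.
  have jp : j <= p by rewrite -ltnS.
  rewrite (big_ord_widen p (fun=> 1) jp) [RHS]big_mkcond /=.
  apply: eq_bigr => i _; rewrite /bump.
  by case: (leqP j i) => ji; rewrite ?add1n ?add0n; [case: ltnP => //; lia|rewrite ji].
rewrite !inversionsE; apply: eq_bigr => a _; apply: eq_bigr => b _.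
by rewrite !lift_perm_lift /= /bump; congr (nat_of_bool (_ && _)); lia.
Qed.

Lemma seq_inv_sorted S : increasing S -> seq_inv S = 0.
Proof.
elim: S => //= a S IH; rewrite /increasing /= (path_sortedE); last first.
  by move=> ? ? ?; apply: ltn_trans.
case/andP=> aS /IH ->; rewrite addn0; apply/eqP; rewrite -leqn0 leqNgt -has_count.
by apply/hasPn => y /(allP aS); rewrite -leqNgt => /ltnW.
Qed.

Lemma increasing_ord_of S : uniq S -> increasing (ord_of S).
Proof.
move=> uS; rewrite /increasing /ord_of.
have : sorted (fun i j : 'I_n => i <= j) (sort (fun i j : 'I_n => i <= j) S).
  by apply: sort_sorted => i j; apply: leq_total.
have : uniq (sort (fun i j : 'I_n => i <= j) S) by rewrite sort_uniq.
move: (sort _ _) => T; elim: T => //= a T IH /andP[aT uT].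
have tr : transitive (fun i j : 'I_n => i <= j) by move=> ? ? ?; apply: leq_trans.
have tr' : transitive (fun i j : 'I_n => i < j) by move=> ? ? ?; apply: ltn_trans.
rewrite !path_sortedE // => /andP[all_a sT]; rewrite IH // andbT.
apply/allP => y yT; rewrite ltn_neqAle (allP all_a) // andbT.
by apply: contraNneq aT => /val_inj ->.
Qed.

Lemma ord_of_enum S : uniq S -> ord_of S = enum [set y in S].
Proof.
move=> uS; apply: increasing_eq; [exact: increasing_ord_of|exact: increasing_enum|].
by move=> y; rewrite mem_sort mem_enum inE.
Qed.

Lemma increasing_uniq S : increasing S -> uniq S.
Proof.
apply: sorted_uniq; first by move=> ? ? ?; apply: ltn_trans.
by move=> ?; apply: ltnn.
Qed.

Lemma mono_ltn_inj p (b : 'I_p -> 'I_n) : {mono b : i l / i < l} -> injective b.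
Proof.
move=> b_mono i l e; apply: val_inj.
by case: (ltngtP i l) => //= lt; [have := b_mono i l|have := b_mono l i];
  rewrite e ltnn lt.
Qed.

Lemma below_imset p (b : 'I_p -> 'I_n) (j : 'I_p) :
  {mono b : i l / i < l} -> below [set b i | i in 'I_p] (b j) = j.
Proof.
move=> b_mono.
have b_inj := mono_ltn_inj b_mono.
have -> : below [set b i | i in 'I_p] (b j) = #|[set b i | i in [set i : 'I_p | i < j]]|.
  apply: eq_card => y; rewrite inE; apply/andP/imsetP => [[/imsetP[i _ ->]]|[i]].
    by rewrite b_mono => ij; exists i; rewrite ?inE.
  by rewrite inE => ij ->; rewrite imset_f // b_mono.
rewrite card_imset // -sum1dep_card -[RHS](card_ord j) -sum1_card.
by rewrite (big_ord_widen p (fun=> 1) (ltnW (ltn_ord j))).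
Qed.
End Inversions.

(** * From sums over permutations to Laplace expansion *)

Section QuantumMinors.
Variables (k : fieldType) (n : nat).
Local Notation laurent := (laurent k).
Variables (A : algType laurent) (x : 'I_n -> 'I_n -> A).

Definition perm_sum p (a b : 'I_p -> 'I_n) : A :=
  \sum_(s : 'S_p) (- qV) ^+ Defs.perm_inv s *: \prod_(i < p) x (a i) (b (s i)).

Lemma perm_sum_recl p (a b : 'I_p.+1 -> 'I_n) :
  perm_sum a b = \sum_(j < p.+1) (- qV) ^+ j *:
    (x (a ord0) (b j) * perm_sum (fun i => a (lift ord0 i)) (fun i => b (lift j i))).
Proof.
rewrite /perm_sum (partition_big (fun s : 'S_p.+1 => s ord0) predT) //=.
apply: eq_bigr => j _.
(* [g s] is [s] with its first position and the value taken there removed; it inverts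
   [lift_perm ord0 j]. *)
pose g (s : 'S_p.+1) i := odflt i (unlift (s ord0) (s (lift ord0 i))).
have gE (s : 'S_p.+1) i : lift (s ord0) (g s i) = s (lift ord0 i).
  have neq : s ord0 != s (lift ord0 i) by rewrite (inj_eq perm_inj) neq_lift.
  by rewrite /g; case: (unlift_some neq) => l -> ->.
have g_inj (s : 'S_p.+1) : injective (g s).
  by move=> i l /(congr1 (lift (s ord0))); rewrite !gE => /perm_inj/lift_inj.
rewrite (reindex (lift_perm ord0 j)) /=; last first.
  exists (fun s => perm (g_inj s)) => [s _|s /eqP sj].
    apply/permP=> i; rewrite permE; apply: (@lift_inj _ j).
    by have := gE (lift_perm ord0 j s) i; rewrite lift_perm_id lift_perm_lift.
  apply/permP=> i; case: (unliftP ord0 i) => [l ->|->].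
    by rewrite lift_perm_lift permE -sj gE.
  by rewrite lift_perm_id.
rewrite mulr_sumr scaler_sumr; apply: eq_big => [s|s _].
  by rewrite lift_perm_id eqxx.
rewrite perm_inv_lift exprD -scalerA -scalerAr; congr (_ *: (_ *: _)).
rewrite big_ord_recl lift_perm_id; congr (_ * _).
by apply: eq_bigr => i _; rewrite lift_perm_lift.
Qed.

Lemma perm0_eq1 (s : 'S_0) : (s == 1%g) = true.
Proof. by apply/eqP/permP=> -[]. Qed.

Lemma perm_sum_sminor p (a b : 'I_p -> 'I_n) : {mono b : i l / (i < l)%N} ->
  perm_sum a b = sminor x [seq a i | i <- enum 'I_p] [set b i | i in 'I_p].
Proof.
elim: p a b => [|p IH] a b b_mono.
  rewrite /perm_sum (big_pred1 1%g) => [|s]; last exact: (esym (perm0_eq1 s)).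
  rewrite big_ord0 /Defs.perm_inv inversionsE big_ord0 expr0 scale1r.
  rewrite (size0nil (s := enum 'I_0)) ?size_enum_ord //=.
  rewrite (_ : [set b i | i in 'I_0] = set0) ?eqxx //.
  by apply/setP=> y; rewrite inE; apply/imsetP=> -[[]].
have b_inj := mono_ltn_inj b_mono.
rewrite perm_sum_recl enum_ordSl /= big_imset /=; last by move=> ? ? _ _ /b_inj.
apply: eq_bigr => j _; rewrite below_imset //; congr (_ *: (_ * _)).
rewrite IH => [|i l]; last by rewrite b_mono /= /bump; lia.
rewrite -map_comp; congr sminor.
apply/setP=> y; rewrite !inE; apply/imsetP/andP => [[i _ ->]|[yj /imsetP[i _ yi]]].
  by rewrite (inj_eq b_inj) eq_sym neq_lift imset_f.
move: yj; rewrite yi (inj_eq b_inj) eq_sym => /unlift_some[l -> _].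
by exists l.
Qed.

Lemma qminor_incE (R T : seq 'I_n) : size R = size T -> increasing T ->
  qminor_inc x R T = sminor x R [set y in T].
Proof.
(* In [qminor_inc] the default of [nth] varies with the row. Fixing one default requires an element,
   hence the separate empty case. *)
move=> RT iT; case: R RT => [|a R] RT.
  case: T RT iT => // _ _; rewrite /qminor_inc (big_pred1 1%g) => [|s].
    rewrite big_ord0 /Defs.perm_inv inversionsE big_ord0 expr0 scale1r.
    by rewrite /= (_ : [set y in [::]] = set0) ?eqxx //; apply/setP=> y; rewrite !inE.
  exact: (esym (perm0_eq1 s)).
move: (a :: R) RT => {}R RT.
have -> : qminor_inc x R T =
    perm_sum (fun i => tnth (in_tuple R) i) (fun i : 'I_(size R) => nth a T i).
  apply: eq_bigr => s _; congr (_ *: _); apply: eq_bigr => i _ /=; congr (x _ _).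
  by apply: set_nth_default; rewrite -RT.
have tr : transitive (fun i j : 'I_n => i < j)%N by move=> ? ? ?; apply: ltn_trans.
rewrite perm_sum_sminor => [|i l]; last first.
  have lt u v : (u < v)%N -> (v < size T)%N -> (nth a T u < nth a T v)%N.
    move=> uv vT; apply: (sorted_ltn_nth tr a iT) => //; rewrite ?inE //.
    exact: ltn_trans vT.
  case: (ltngtP i l) => [il|li|->]; last exact: ltnn.
    by apply: lt => //; rewrite -RT.
  by apply/negbTE; rewrite -leqNgt ltnW // lt // -RT.
congr sminor; first exact: map_tnth_enum.
apply/setP=> y; rewrite inE; apply/imsetP/idP => [[i _ ->]|yT].
  by rewrite mem_nth // -RT.
have iy : (index y T < size R)%N by rewrite RT index_mem.
by exists (Ordinal iy); rewrite //= nth_index.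
Qed.

Lemma qminorE (R T : seq 'I_n) : size R = size T -> uniq R -> uniq T ->
  qminor x R T = (- qV) ^+ (seq_inv R + seq_inv T) *: minor x [set y in R] [set y in T].
Proof.
move=> RT uR uT; rewrite /qminor !tuple_invE; congr (_ *: _).
rewrite qminor_incE ?increasing_ord_of ?size_sort // /minor -ord_of_enum //.
by congr sminor; apply/setP=> y; rewrite !inE mem_sort.
Qed.
End QuantumMinors.

(** * Hecke action on words *)

Section SwapInversions.
Variable n : nat.
Implicit Types (X : seq 'I_n) (c d y : 'I_n).
Local Open Scope nat_scope.

Definition precedes c d X := [&& c \in X, d \in X & index c X < index d X].

Lemma precedes_cons c d a X : precedes c d (a :: X) =
  if a == c then (d != c) && (d \in X) else (a != d) && precedes c d X.
Proof.
rewrite /precedes !inE /= ![_ == a]eq_sym; case: (eqVneq a c) => [->|ac] /=.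
  by rewrite eq_sym; case: (eqVneq d c); rewrite ?ltnn ?andbF ?andbT.
by case: (eqVneq a d) => [_|ad]; rewrite ?andbF //= ltnS.
Qed.

Lemma count_split (T : eqType) (P Q : pred T) (z : T) (X : seq T) : uniq X ->
  P z -> ~~ Q z -> {in X, forall y : T, y != z -> P y = Q y} ->
  count P X = count Q X + (z \in X).
Proof.
move=> uX Pz Qz PQ; elim: X uX PQ => //= a X IH /andP[aX uX] PQ.
have PQ' : {in X, forall y : T, y != z -> P y = Q y}.
  by move=> y yX; apply: PQ; rewrite inE yX orbT.
rewrite IH // inE eq_sym; case: (eqVneq a z) aX => [->|az] aX /=.
  by rewrite Pz (negbTE Qz) (negbTE aX) add0n addn0 addnC.
by rewrite addnA PQ ?inE ?eqxx.
Qed.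

(** No letter of the word separates [c] from [d], so only their own pair can change status, and only
    when both occur. The additive form avoids truncated subtraction. *)
Lemma seq_inv_swap c d X : uniq X -> c < d ->
  {in X, forall y, y != c -> y != d -> (y < c) = (y < d)} ->
  seq_inv (map (tperm c d) X) + precedes d c X = seq_inv X + precedes c d X.
Proof.
move=> uX cd; have cNd : c != d by rewrite -(inj_eq val_inj) neq_ltn cd.
have dNc : d != c by rewrite eq_sym.
elim: X uX => [|a X IH] // /andP[aX uX] btw.
have btw' : {in X, forall y, y != c -> y != d -> (y < c) = (y < d)}.
  by move=> y yX; apply: btw; rewrite inE yX orbT.
have {IH} := IH uX btw'; rewrite !precedes_cons /= count_map.
case: (eqVneq a c) aX => [->|ac] aX.
  rewrite (negbTE cNd) tpermL dNc /= => IH.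
  have np d' : precedes c d' X = false by rewrite /precedes (negbTE aX).
  have np' : precedes d c X = false by rewrite /precedes (negbTE aX) andbF.
  move: IH; rewrite np np' !addn0 => ->.
  rewrite addnAC; congr (_ + _).
  apply: (count_split uX); rewrite /= ?tpermR ?cd // -?leqNgt ?(ltnW cd) //.
  move=> y yX yd /=; have yc : y != c by apply: contraNneq aX => <-.
  by rewrite tpermD 1?eq_sym // btw'.
case: (eqVneq a d) aX => [->|ad] aX.
  rewrite ?eqxx cNd /= tpermR => IH.
  have np : precedes c d X = false by rewrite /precedes (negbTE aX) !andbF.
  have np' : precedes d c X = false by rewrite /precedes (negbTE aX).
  move: IH; rewrite np np' !addn0 => ->.
  rewrite addnAC; congr (_ + _); apply/esym.
  apply: (count_split uX); rewrite /= ?tpermL ?cd // -?leqNgt ?(ltnW cd) //.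
  move=> y yX yc /=; have yd : y != d by apply: contraNneq aX => <-.
  by rewrite tpermD 1?eq_sym // -btw'.
rewrite tpermD 1?eq_sym // => IH; rewrite -!addnA IH; congr (_ + _).
have ca : (c < a) = (d < a).
  have := btw a (mem_head _ _) ac ad; move: ac ad; rewrite -!(inj_eq val_inj) /=; lia.
by apply: eq_count => y /=; case: tpermP => // ->; rewrite ca.
Qed.

Lemma set_map_tperm c d X : [set y in map (tperm c d) X] = twist c d [set y in X].
Proof.
apply/setP=> y; rewrite !inE; apply/mapP/idP => [[z zX ->]|yX].
  by rewrite tpermK.
by exists (tperm c d y); rewrite ?tpermK.
Qed.
End SwapInversions.

(** * The Hecke operator on pairs of words *)

Section Words.
Variables (k : fieldType) (n : nat).
Local Notation laurent := (laurent k).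
Variables (A : algType laurent) (F : {set 'I_n} -> {set 'I_n} -> A).
Variables (H : A -> A) (c d : 'I_n).
Hypothesis lH : linear H.
Hypothesis cd : (c < d)%N.
Implicit Types X : seq 'I_n.

Definition word_val X X' : A :=
  (- qV) ^+ (seq_inv X + seq_inv X') *: F [set y in X] [set y in X'].

Lemma word_hecke X X' : uniq (X ++ X') -> c \in X ++ X' -> d \in X ++ X' ->
  {in X ++ X', forall y, y != c -> y != d -> (y < c)%N = (y < d)%N} ->
  H (F [set y in X] [set y in X']) =
    (if (c \in X) && (d \in X') then
       qV *: F [set y in X] [set y in X']
       + F (twist c d [set y in X]) (twist c d [set y in X'])
     else if (d \in X) && (c \in X') then
       q *: F [set y in X] [set y in X']
       + F (twist c d [set y in X]) (twist c d [set y in X'])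
     else 0) ->
  H (word_val X X') = word_val (map (tperm c d) X) (map (tperm c d) X')
    + (if (index c (X ++ X') < index d (X ++ X'))%N then qV else q)
      *: word_val X X'.
Proof.
move=> uXX cX dX btw HF; rewrite /word_val !set_map_tperm (linear_funZ lH) HF.
move: uXX; rewrite cat_uniq => /and3P[uX /hasPn XX' uX'].
have bX : {in X, forall y, y != c -> y != d -> (y < c)%N = (y < d)%N}.
  by move=> y yX; apply: btw; rewrite mem_cat yX.
have bX' : {in X', forall y, y != c -> y != d -> (y < c)%N = (y < d)%N}.
  by move=> y yX; apply: btw; rewrite mem_cat yX orbT.
have := seq_inv_swap uX cd bX; have := seq_inv_swap uX' cd bX'.
move: cX dX; rewrite !mem_cat !index_cat /precedes.
have cXX : c \in X' -> c \in X = false by move/XX' => /= /negbTE.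
have dXX : d \in X' -> d \in X = false by move/XX' => /= /negbTE.
have cNd : c != d by rewrite -(inj_eq val_inj) neq_ltn cd.
case cX': (c \in X') cXX; case dX': (d \in X') dXX => dXX cXX.
- rewrite cXX // dXX // !andbF /= !addn0 ltn_add2l => _ _ e1 ->.
  rewrite scaler0 !twist_fix ?inE ?cX' ?dX' ?cXX ?dXX //.
  move: e1; case: (ltngtP (index c X') (index d X')) => [lt|lt|e].
  + rewrite addn0 addn1 => ->; rewrite addnS exprS scalerA -scalerDl.
    by rewrite mulNr addNr scale0r.
  + rewrite addn0 addn1 => <-; rewrite addnS exprS scalerA -scalerDl.
    by rewrite mulrA mulrN mulqqV mulN1r subrr scale0r.
  + by move: cNd; rewrite -(nth_index c cX') e nth_index ?eqxx.
- rewrite cXX // ?orbF /= => _ dX; rewrite dX /= ?andbF ?addn0.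
  move=> -> ->.
  rewrite (leq_gtF _) /=; last by rewrite ltnW // (leq_trans _ (leq_addr _ _)) // index_mem.
  by rewrite scalerDr addrC !scalerA [q * _]mulrC.
- rewrite !orbF => cX; rewrite dXX // cX => _ /=; rewrite ?andbF ?addn0.
  move=> -> ->.
  rewrite (leq_trans _ (leq_addr _ _)) ?index_mem //=.
  by rewrite scalerDr addrC !scalerA [qV * _]mulrC.
- rewrite !orbF => cX dX; rewrite cX dX /= !addn0 => -> e1.
  rewrite scaler0 !twist_fix ?inE ?cX' ?dX' ?cX ?dX //.
  move: e1; case: (ltngtP (index c X) (index d X)) => [lt|lt|e].
  + rewrite addn0 addn1 => ->; rewrite addSn exprS scalerA -scalerDl.
    by rewrite mulNr addNr scale0r.
  + rewrite addn0 addn1 => <-; rewrite addSn exprS scalerA -scalerDl.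
    by rewrite mulrA mulrN mulqqV mulN1r subrr scale0r.
  + by move: cNd; rewrite -(nth_index c cX) e nth_index ?eqxx.
Qed.
End Words.

(** * Operators and the recursion defining the lists *)

Section ListSteps.
Variables (R : comNzRingType) (V : lmodType R) (T : eqType).
Variables (O : V -> V) (t : entry T -> V) (mu : R) (p P : pred (entry T)).
Variables (sw : entry T -> entry T).
Hypothesis lO : linear O.
Hypothesis Ot : forall e, P e -> O (t e) = t (sw e) + (if p e then 0 else mu *: t e).

Lemma list_sum_step (s : seq (entry T)) : all P s ->
  O (\sum_(e <- s) t e) =
  \sum_(e <- s) t (sw e) + mu *: \sum_(e <- s | ~~ p e) t e.
Proof.
elim: s => [|e s IH] /=; first by rewrite !big_nil scaler0 addr0 (linear_fun0 lO).
case/andP=> /Ot Oe /IH IHs; rewrite !big_cons (linear_funD lO) Oe IHs.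
rewrite -!addrA; congr (_ + _); rewrite addrCA; congr (_ + _).
by case: (p e) => /=; rewrite ?add0r ?scalerDr.
Qed.

(** The power of [mu] records the index: a swapped entry keeps its index, an entry outside [p] also
    reappears one index higher, as in the recursion for the lists. At the top index there is no
    swapped entry, which is what [D h.+1 = [::]] says. *)
Lemma list_step (D D' : nat -> seq (entry T)) h :
  (forall i, all P (D i)) -> D h.+1 = [::] ->
  (forall i, \sum_(e <- D' i) t e =
     \sum_(e <- pred_list D i | ~~ p e) t e + \sum_(e <- D i) t (sw e)) ->
  O (\sum_(i < h.+1) mu ^+ i *: \sum_(e <- D i) t e)
    = \sum_(i < h.+2) mu ^+ i *: \sum_(e <- D' i) t e.
Proof.
move=> PD Dh D'E; rewrite (linear_fun_sum lO).
under eq_bigr => i _ do rewrite (linear_funZ lO) list_sum_step // scalerDr.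
under [RHS]eq_bigr => i _ do rewrite D'E scalerDr.
rewrite !big_split /= addrC; congr (_ + _).
  rewrite [RHS]big_ord_recl /= big_nil scaler0 add0r.
  by apply: eq_bigr => i _; rewrite scalerA -exprSr.
by rewrite [RHS]big_ord_recr /= Dh big_nil scaler0 addr0.
Qed.
End ListSteps.

(** * Positions and entries *)

Lemma all_eq_sum (V : nmodType) (T : Type) (P : pred T) (s : seq T) (F G : T -> V) :
  all P s -> (forall e, P e -> F e = G e) ->
  \sum_(e <- s) F e = \sum_(e <- s) G e.
Proof.
move=> Ps FG; elim: s Ps => [|e s IH] /=; first by rewrite !big_nil.
by case/andP=> /FG Fe /IH IHs; rewrite !big_cons Fe IHs.
Qed.

Lemma index_map_in (T T' : eqType) (f : T -> T') (a : T) (s : seq T) :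
  {in s, forall y, f y = f a -> y = a} -> index (f a) (map f s) = index a s.
Proof.
elim: s => //= y s IH inj; rewrite IH => [|z zs]; last by apply: inj; rewrite inE zs orbT.
case: (eqVneq y a) => [->|ya]; first by rewrite eqxx.
by case: eqP => // /inj e; rewrite e ?eqxx ?mem_head in ya.
Qed.

Section Positions.
Variables (n : nat) (V : seq 'I_n).
Hypothesis iV : increasing V.
Implicit Types (y : 'I_n).
Local Open Scope nat_scope.

Let tr : transitive (fun i j : 'I_n => i < j).
Proof. by move=> ? ? ?; apply: ltn_trans. Qed.

Lemma pos_inj y y' : y \in V -> pos V y = pos V y' -> y = y'.
Proof.
move=> yV /succn_inj e; have y'V : y' \in V by rewrite -index_mem -e index_mem.
by rewrite -(nth_index y yV) e nth_index.
Qed.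

Lemma pos_bound y : y \in V -> 0 < pos V y <= size V.
Proof. by move=> yV; rewrite /pos /= index_mem. Qed.

Lemma pos_lt y y' : y \in V -> y' \in V -> (pos V y < pos V y') = (y < y').
Proof.
have lt u v : u \in V -> v \in V -> pos V u < pos V v -> u < v.
  move=> uV vV; rewrite ltnS => uv.
  by have := sorted_ltn_nth tr u iV; move=> /(_ _ _ _ _ uv); rewrite !inE !index_mem
     !nth_index //; apply.
move=> yV y'V; apply/idP/idP; first exact: lt.
case: (ltngtP (pos V y) (pos V y')) => // [l|/pos_inj ->//]; last by rewrite ltnn.
by have := lt _ _ y'V yV l; case: ltngtP.
Qed.

Lemma posK c : 0 < c <= size V -> exists2 y, y \in V & pos V y = c.
Proof.
case: c => // c /= cV; case: V iV cV => // x0 V' iV' cV.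
exists (nth x0 (x0 :: V') c); first exact: mem_nth.
by rewrite /pos index_uniq // increasing_uniq.
Qed.

(** [vc] and [vd] realise the 1-based positions [c] and [c.+1]; they are neighbours in [V] but not
    necessarily consecutive integers. *)
Definition adjacent_in c (vc vd : 'I_n) :=
  [/\ vc \in V, vd \in V, pos V vc = c & pos V vd = c.+1].

Lemma adjacent_exists c : 0 < c < size V -> exists vc vd, adjacent_in c vc vd.
Proof.
move=> /andP[c0 cV]; have [vc vcV pc] : exists2 y, y \in V & pos V y = c.
  by apply: posK; rewrite c0 ltnW.
have [vd vdV pd] : exists2 y, y \in V & pos V y = c.+1 by apply: posK.
by exists vc, vd.
Qed.

Section Adjacent.
Variables (c : nat) (vc vd : 'I_n).
Hypothesis adj : adjacent_in c vc vd.

Lemma adjacent_lt : vc < vd.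
Proof. by case: adj => vcV vdV pc pd; rewrite -pos_lt // pc pd. Qed.

Lemma adjacent_between : {in V, forall y, y != vc -> y != vd -> (y < vc) = (y < vd)}.
Proof.
case: adj => vcV vdV pc pd y yV yc yd; rewrite -!pos_lt // pc pd [RHS]ltnS [RHS]leq_eqVlt.
by case: eqP => //= e; rewrite (pos_inj yV (etrans e (esym pc))) eqxx in yc.
Qed.

Lemma pos_tperm : {in V, forall y, pos V (tperm vc vd y) = swap c (pos V y)}.
Proof.
case: adj => vcV vdV pc pd y yV; rewrite /swap.
case: tpermP => [->|->|/eqP yc /eqP yd].
- by rewrite pc pd eqxx.
- by rewrite pc pd eqxx gtn_eqF.
- case: eqP => [e|_]; first by rewrite (pos_inj yV (etrans e (esym pc))) eqxx in yc.
  by case: eqP => // e; rewrite (pos_inj yV (etrans e (esym pd))) eqxx in yd.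
Qed.

Lemma tperm_in y : y \in V -> tperm vc vd y \in V.
Proof. by case: adj => vcV vdV _ _ yV; case: tpermP. Qed.

Lemma swap_in_tperm : {in V, swap_in V c =1 tperm vc vd}.
Proof.
move=> y yV; rewrite /swap_in -pos_tperm // /pos /=.
by rewrite nth_index // tperm_in.
Qed.

Lemma map_swap_in X : {subset X <= V} -> map (swap_in V c) X = map (tperm vc vd) X.
Proof. by move=> XV; apply/eq_in_map => y /XV; apply: swap_in_tperm. Qed.

Lemma perm_eq_swap X : perm_eq X V -> perm_eq (map (tperm vc vd) X) V.
Proof.
move=> XV; have uV := increasing_uniq iV.
apply: uniq_perm => //; first by rewrite (map_inj_uniq perm_inj) (perm_uniq XV).
move=> y; apply/mapP/idP => [[w]|yV]; first by rewrite (perm_mem XV) => wV ->; apply: tperm_in.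
by exists (tperm vc vd y); rewrite ?tpermK // (perm_mem XV) tperm_in.
Qed.

Lemma before_index X : {subset X <= V} ->
  before V c c.+1 X = (index vc X < index vd X) /\
  before V c.+1 c X = (index vd X < index vc X).
Proof.
case: adj => vcV vdV pc pd XV; rewrite /before -pd -pc.
by rewrite !index_map_in // => y /XV yV /(pos_inj yV).
Qed.
End Adjacent.
End Positions.

(** * Values of entries, and one step of a tower *)

Section Entries.
Variables (k : fieldType) (n : nat).
Local Notation laurent := (laurent k).
Variables (A : algType laurent) (x : 'I_n -> 'I_n -> A).
Hypothesis col_r : forall c d : 'I_n, (d = c.+1 :> nat)%N ->
  exists E, linear E /\ raising c d E (colfam x).
Hypothesis col_l : forall c d : 'I_n, (d = c.+1 :> nat)%N ->
  exists E, linear E /\ lowering c d E (colfam x).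
Hypothesis row_r : forall c d : 'I_n, (d = c.+1 :> nat)%N ->
  exists E, linear E /\ raising c d E (rowfam x).
Hypothesis row_l : forall c d : 'I_n, (d = c.+1 :> nat)%N ->
  exists E, linear E /\ lowering c d E (rowfam x).
Local Notation minor := (minor x).
Variables (V : seq 'I_n) (C : {set 'I_n}) (r p : nat).
Hypothesis iV : increasing V.
Hypothesis VC : forall y, y \in V -> y \notin C.
Local Notation U := (enum 'I_n).

Definition valid (e : entry 'I_n) :=
  [&& perm_eq (eZ e ++ eZ' e) U, perm_eq (eW e ++ eW' e) V,
      size (eZ e) == r & size (eW e) == p].

(** The summand without its sign. The inversions of [Z] and [Z'] appear here because the minors of
    the expansion have unordered rows. *)
Definition entry_val (e : entry 'I_n) : A :=
  (- qV) ^+ (seq_inv (eZ e) + seq_inv (eZ' e) + (seq_inv (eW e) + seq_inv (eW' e))) *: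
  (minor [set y in eZ e] ([set y in eW e] :|: C) *
   minor [set y in eZ' e] ([set y in eW' e] :|: C)).

Lemma increasing_enumT : increasing U.
Proof. by have := increasing_enum [set: 'I_n]; rewrite enum_setT -enumT. Qed.

Lemma valid_swap_cols c e : (0 < c < size V)%N -> valid e -> valid (swap_cols V c e).
Proof.
move=> cV /and4P[hZ hW sZ sW]; have [vc [vd adj]] := adjacent_exists iV cV.
rewrite /valid /= hZ sZ size_map sW -map_cat.
rewrite (map_swap_in adj); last by move=> y; rewrite (perm_mem hW).
by rewrite (perm_eq_swap iV adj hW).
Qed.

Lemma valid_swap_rows c e : (0 < c < size U)%N -> valid e -> valid (swap_rows U c e).
Proof.
have iU := increasing_enumT.
move=> cV /and4P[hZ hW sZ sW]; have [vc [vd adj]] := adjacent_exists iU cV.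
rewrite /valid /= hW sW size_map sZ -map_cat.
rewrite (map_swap_in adj); last by move=> y; rewrite (perm_mem hZ).
by rewrite (perm_eq_swap iU adj hZ).
Qed.

Lemma twistU c d (S : {set 'I_n}) : c \notin C -> d \notin C ->
  twist c d (S :|: C) = twist c d S :|: C.
Proof.
move=> cC dC; rewrite -[C in RHS](@twist_fix _ c d C) ?(negbTE cC) ?(negbTE dC) //.
by apply/setP=> y; rewrite !inE.
Qed.

(* The operator -q^-1 + H, the inverse of the Hecke generator -q + H. *)
Lemma column_step c vc vd : adjacent_in V c vc vd -> exists O : A -> A,
  [/\ linear O,
    forall e, valid e -> O (entry_val e) = entry_val (swap_cols V c e) +
      (if phi V c e then 0 else (q - qV) *: entry_val e)
  & forall (R R' S S' : {set 'I_n}), vc \in S -> vd \in S' -> vd \notin S -> vc \notin S' ->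
      {subset S <= V} -> {subset S' <= V} ->
      O (minor R (S :|: C) * minor R' (S' :|: C)) =
      minor R (twist vc vd S :|: C) * minor R' (twist vc vd S' :|: C)].
Proof.
move=> adj; have lt := adjacent_lt iV adj; have btw := adjacent_between iV adj.
have [vcV vdV pc pd] := adj; have cC := VC vcV; have dC := VC vdV.
have dE : (vd = vc + (vd - vc).-1.+1 :> nat)%N by rewrite prednK ?subn_gt0 // subnKC // ltnW.
have [H [lH HE]] := hecke_exists col_r col_l C dE.
have HS R R' (S S' : {set 'I_n}) : {subset S <= V} -> {subset S' <= V} ->
    (vc \in S) != (vc \in S') -> (vd \in S) != (vd \in S') ->
    H (minor R (S :|: C) * minor R' (S' :|: C)) =
    hecke_val (colfam x) vc vd (R, R') (S :|: C) (S' :|: C).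
  move=> SV S'V vcS vdS; apply: (HE (R, R')).
  - by rewrite !inE (negbTE cC) !orbF.
  - by rewrite !inE (negbTE dC) !orbF.
  (* A column strictly between [vc] and [vd] is not in [V], so [C] alone decides whether it lies in
     both sets or in neither. *)
  - move=> y /andP[cy yd]; have yV : y \notin V.
      apply/negP=> yV; have := btw y yV.
      rewrite -!(inj_eq val_inj) /= gtn_eqF // ltn_eqF // yd => /(_ isT isT).
      by case: ltngtP cy.
    rewrite !inE; case yS: (y \in S); first by rewrite SV in yV.
    by case yS': (y \in S') => //; rewrite S'V in yV.
exists (fun u => - qV *: u + H u); split.
- move=> a u v; rewrite lH !scalerDr !scalerA [a * _]mulrC !addrA; congr (_ + _).
  by rewrite addrAC.
- move=> e /and4P[hZ hW sZ sW].
  pose F S S' := colfam x ([set y in eZ e], [set y in eZ' e]) (S :|: C) (S' :|: C).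
  have eE : entry_val e = (- qV) ^+ (seq_inv (eZ e) + seq_inv (eZ' e)) *:
      word_val F (eW e) (eW' e) by rewrite /entry_val exprD -scalerA.
  have WV : {subset eW e ++ eW' e <= V} by move=> y; rewrite (perm_mem hW).
  have WV1 : {subset eW e <= V} by move=> y yW; apply: WV; rewrite mem_cat yW.
  have WV2 : {subset eW' e <= V} by move=> y yW; apply: WV; rewrite mem_cat yW orbT.
  have seE : entry_val (swap_cols V c e) =
      (- qV) ^+ (seq_inv (eZ e) + seq_inv (eZ' e)) *:
      word_val F (map (tperm vc vd) (eW e)) (map (tperm vc vd) (eW' e)).
    by rewrite /entry_val /= !(map_swap_in adj) // exprD -scalerA.
  have uW : uniq (eW e ++ eW' e) by rewrite (perm_uniq hW) increasing_uniq.
  have disj y : y \in V -> (y \in eW e) != (y \in eW' e).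
    rewrite -(perm_mem hW) mem_cat; move: uW; rewrite cat_uniq => /and3P[_ /hasPn h _].
    case yW': (y \in eW' e); last by rewrite orbF => ->.
    by move=> _; rewrite (negbTE (h _ yW')).
  have WH := word_hecke lH lt uW _ _ _ _ (F := F).
  have {}WH : H (word_val F (eW e) (eW' e)) = word_val F (map (tperm vc vd) (eW e)) (map (tperm vc vd) (eW' e))
     + (if phi V c e then qV else q) *: word_val F (eW e) (eW' e).
    rewrite WH ?(perm_mem hW) //; last 2 first.
    + by move=> y; rewrite (perm_mem hW); apply: btw.
    + rewrite {1}/F /colfam HS ?inE ?disj //; first last.
      * by move=> y; rewrite inE; apply: WV2.
      * by move=> y; rewrite inE; apply: WV1.
      rewrite /hecke_val /F !inE (negbTE cC) (negbTE dC) !orbF !twistU //.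
    by have [bE _] := before_index adj WV; rewrite /phi bE.
  rewrite eE seE (linear_funZ lH) WH; set g := word_val F (eW e) _; set g' := word_val _ _ _.
  clearbody g g'.
  rewrite scalerDr addrCA; congr (_ + _); rewrite !scalerA [- qV * _]mulrC -scalerDl -mulrDr.
  by case: ifP => _; [rewrite addNr mulr0 scale0r|rewrite mulrC addrC].
- move=> R R' S S' vcS vdS' vdS vcS' SV S'V.
  rewrite HS ?vcS ?vdS' ?(negbTE vdS) ?(negbTE vcS') // /hecke_val /colfam.
  by rewrite !inE vcS vdS' orTb /= scaleNr addrA addNr add0r !twistU.
Qed.

Lemma pos_enum (y : 'I_n) : pos U y = y.+1.
Proof. by rewrite /pos index_enum_ord. Qed.

(* The Hecke generator -q + H. *)
Lemma row_step c vc vd : adjacent_in U c vc vd -> exists O : A -> A,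
  [/\ linear O,
    forall e, valid e -> O (entry_val e) = entry_val (swap_rows U c e) +
      (if psi U c e then 0 else (qV - q) *: entry_val e)
  & forall R R' S S' : {set 'I_n}, vd \in R -> vc \in R' -> vc \notin R -> vd \notin R' ->
      O (minor R S * minor R' S') =
      minor (twist vc vd R) S * minor (twist vc vd R') S'].
Proof.
have iU := increasing_enumT.
move=> adj; have lt := adjacent_lt iU adj; have btw := adjacent_between iU adj.
have [vcV vdV pc pd] := adj.
have dE : (vd = vc.+1 :> nat)%N by have := pd; rewrite pos_enum -pc pos_enum => -[].
have [H [lH HE]] := hecke_adjacent row_r row_l dE.
exists (fun u => - q *: u + H u); split.
- move=> a u v; rewrite lH !scalerDr !scalerA [a * _]mulrC !addrA; congr (_ + _).
  by rewrite addrAC.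
- move=> e /and4P[hZ hW sZ sW].
  pose F S S' := rowfam x ([set y in eW e] :|: C, [set y in eW' e] :|: C) S S'.
  have eE : entry_val e = (- qV) ^+ (seq_inv (eW e) + seq_inv (eW' e)) *:
      word_val F (eZ e) (eZ' e).
    by rewrite /entry_val addnC exprD -scalerA.
  have ZU : {subset eZ e ++ eZ' e <= U} by move=> y; rewrite (perm_mem hZ).
  have ZU1 : {subset eZ e <= U} by move=> y yW; apply: ZU; rewrite mem_cat yW.
  have ZU2 : {subset eZ' e <= U} by move=> y yW; apply: ZU; rewrite mem_cat yW orbT.
  have seE : entry_val (swap_rows U c e) =
      (- qV) ^+ (seq_inv (eW e) + seq_inv (eW' e)) *:
      word_val F (map (tperm vc vd) (eZ e)) (map (tperm vc vd) (eZ' e)).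
    by rewrite /entry_val /= !(map_swap_in adj) // addnC exprD -scalerA.
  have uZ : uniq (eZ e ++ eZ' e) by rewrite (perm_uniq hZ) increasing_uniq.
  have disj y : y \in U -> (y \in eZ e) != (y \in eZ' e).
    rewrite -(perm_mem hZ) mem_cat; move: uZ; rewrite cat_uniq => /and3P[_ /hasPn h _].
    case yW': (y \in eZ' e); last by rewrite orbF => ->.
    by move=> _; rewrite (negbTE (h _ yW')).
  have WH := word_hecke lH lt uZ _ _ _ _ (F := F).
  have {}WH : H (word_val F (eZ e) (eZ' e)) =
      word_val F (map (tperm vc vd) (eZ e)) (map (tperm vc vd) (eZ' e))
      + (if psi U c e then q else qV) *: word_val F (eZ e) (eZ' e).
    rewrite WH ?(perm_mem hZ) //; last 2 first.
    + by move=> y; rewrite (perm_mem hZ); apply: btw.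
    + rewrite {1}/F HE ?inE ?disj //.
      by rewrite /hecke_val /F !inE.
    have [_ bE] := before_index adj ZU; rewrite /psi bE; congr (_ + _ *: _).
    case: (ltngtP (index vc _) (index vd _)) => // e0.
    have vcZ : vc \in eZ e ++ eZ' e by rewrite (perm_mem hZ).
    have vdZ : vd \in eZ e ++ eZ' e by rewrite (perm_mem hZ).
    have E : vc = vd by rewrite -(nth_index vc vcZ) e0 nth_index.
    by rewrite E ltnn in lt.
  rewrite eE seE (linear_funZ lH) WH; set g := word_val F (eZ e) _; set g' := word_val _ _ _.
  clearbody g g'.
  rewrite scalerDr addrCA; congr (_ + _); rewrite !scalerA [- q * _]mulrC -scalerDl -mulrDr.
  by case: ifP => _; [rewrite addNr mulr0 scale0r|rewrite mulrC addrC].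
- move=> R R' S S' vdR vcR' vcR vdR'.
  have := HE (S, S') R R'; rewrite /rowfam /= => ->; last 2 first.
  + by rewrite vcR' (negbTE vcR).
  + by rewrite vdR (negbTE vdR').
  rewrite /hecke_val vdR vcR' (negbTE vcR) (negbTE vdR') /=.
  by rewrite scaleNr addrA addNr add0r.
Qed.
End Entries.

(** * Towers *)

Lemma swapK c : involutive (swap c).
Proof. by move=> v; rewrite /swap; do !case: eqP; lia. Qed.

Lemma mem_map_swap c v (b : seq nat) : (swap c v \in map (swap c) b) = (v \in b).
Proof. by rewrite mem_map //; apply: can_inj (swapK c). Qed.

Section Lists.
Variable T : eqType.
Implicit Types (e base : entry T) (U V : seq T).

Lemma col_list_nil base V tw i : (size tw < i)%N -> col_list base V tw i = [::].
Proof.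
elim: tw i => [|c tw IH] [|i] //= lt; rewrite (IH i) // (IH i.+1) //.
exact: ltnW.
Qed.

Lemma col_list_neg base V tw i : eneg base = false ->
  all (fun e => eneg e == odd i) (col_list base V tw i).
Proof.
case: tw => [|c tw] b0 /=; first by case: eqP => [->|] //=; rewrite b0.
by rewrite all_map; apply: sub_all (all_predT _) => e _; apply: eqxx.
Qed.

Lemma row_list_nil C0 U tw h i : (forall j, (h < j)%N -> C0 j = [::]) ->
  (h + size tw < i)%N -> row_list C0 U tw i = [::].
Proof.
move=> C0h; elim: tw i => [|c tw IH] i /=; first by rewrite addn0; apply: C0h.
case: i => // i; rewrite addnS => lt; rewrite /= (IH i) // (IH i.+1) //.
exact: ltnW.
Qed.

Lemma col_list_all (P : pred (entry T)) base V tw (ok : pred nat) i :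
  (forall c e, ok c -> P e -> P (swap_cols V c e)) ->
  (forall b e, P (set_neg b e) = P e) ->
  P base -> all ok tw -> all P (col_list base V tw i).
Proof.
move=> Psw Pneg Pb; elim: tw i => [|c tw IH] i /=; first by case: eqP => //= _; rewrite Pb.
case/andP=> okc /IH oks; rewrite all_map (eq_all (Pneg _)).
rewrite all_cat all_filter all_map; apply/andP; split.
  by case: i => //= i; apply: sub_all (oks i) => e Pe; rewrite /= Pe implybT.
by apply: sub_all (oks i) => e Pe; apply: Psw.
Qed.

Lemma row_list_all (P : pred (entry T)) C0 U tw (ok : pred nat) i :
  (forall c e, ok c -> P e -> P (swap_rows U c e)) ->
  (forall i, all P (C0 i)) -> all ok tw -> all P (row_list C0 U tw i).
Proof.
move=> Psw PC; elim: tw i => [|c tw IH] i //= /andP[okc /IH oks].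
rewrite all_cat all_filter all_map; apply/andP; split.
  by case: i => //= i; apply: sub_all (oks i) => e Pe; rewrite /= Pe implybT.
by apply: sub_all (oks i) => e Pe; apply: Psw.
Qed.
End Lists.

Section Towers.
Variables (k : fieldType) (n : nat).
Local Notation laurent := (laurent k).
Variables (A : algType laurent) (x : 'I_n -> 'I_n -> A).
Hypothesis col_r : forall c d : 'I_n, (d = c.+1 :> nat)%N ->
  exists E, linear E /\ raising c d E (colfam x).
Hypothesis col_l : forall c d : 'I_n, (d = c.+1 :> nat)%N ->
  exists E, linear E /\ lowering c d E (colfam x).
Hypothesis row_r : forall c d : 'I_n, (d = c.+1 :> nat)%N ->
  exists E, linear E /\ raising c d E (rowfam x).
Hypothesis row_l : forall c d : 'I_n, (d = c.+1 :> nat)%N ->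
  exists E, linear E /\ lowering c d E (rowfam x).
Local Notation minor := (minor x).
Variables (V : seq 'I_n) (C : {set 'I_n}) (r p : nat).
Hypothesis iV : increasing V.
Hypothesis VC : forall y, y \in V -> y \notin C.
Local Notation U := (enum 'I_n).
Local Notation valid := (valid V r p).
Local Notation entry_val := (entry_val x C).

(** The signs [(-1)^i] of the column lists are absorbed by the powers of [q - q^-1], the parameter
    of the inverse generators. *)
Definition col_sum base tw : A := \sum_(i < (size tw).+1)
  (q - qV) ^+ i *: \sum_(e <- col_list base V tw i) entry_val e.

Definition in_cols (b : seq nat) : {set 'I_n} := [set y | (y \in V) && (pos V y \in b)].
Definition out_cols (b : seq nat) : {set 'I_n} := [set y | (y \in V) && (pos V y \notin b)].

Lemma twist_cols c vc vd b : adjacent_in V c vc vd ->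
  twist vc vd (in_cols (map (swap c) b)) = in_cols b /\
  twist vc vd (out_cols (map (swap c) b)) = out_cols b.
Proof.
move=> adj; have tV y : (tperm vc vd y \in V) = (y \in V).
  by apply/idP/idP => [|yV]; [rewrite -{2}[y](tpermK vc vd)|]; apply: (tperm_in adj).
by split; apply/setP=> y; rewrite !inE tV; case yV: (y \in V) => //=;
  rewrite (pos_tperm adj) // mem_map_swap.
Qed.

Lemma valid_set_neg b e : valid (set_neg b e) = valid e. Proof. by []. Qed.

(** The operator of the first transposition is applied to the relation for the rest of the tower: it
    swaps the left-hand side and extends the lists by one step. *)
Lemma column_tower base R R' z f b :
  valid base ->
  (forall b0, b0 = iota (size V - p).+1 p ->
     qV ^+ z *: (minor R' (out_cols b0 :|: C) * minor R (in_cols b0 :|: C))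
     = entry_val base) ->
  bounded (size V) b -> size b = p -> (size V * size V <= f + sumn b)%N ->
  let tw := col_tower_rec f (size V) b in
  all (fun c => 0 < c < size V)%N tw /\
  qV ^+ z *: (minor R' (out_cols b :|: C) * minor R (in_cols b :|: C))
    = col_sum base tw.
Proof.
move=> vb baseE; elim: f b => [|f IH] b bb sb hf /=.
  (* Without fuel the sum of the positions is at least [m * m] for [m = size V]; one more swap would
     exceed the bound, so the end of the tower is reached. *)
  have bE : b = iota (size V - p).+1 p.
    rewrite -sb; apply/eqP; apply: contraT => /(col_pivotP bb)[cb c1 cm].
    have dm : (0 < (col_pivot (size V) b).+1 <= size V)%N by [].
    have [] := bounded_swap bb dm cb c1 _; first by rewrite eqxx.
    by move=> /sumn_bounded; lia.
  by split=> //; rewrite /col_sum big_ord1 expr0 scale1r big_seq1 baseE.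
case: eqP => [bE|/eqP bN].
  by split=> //; rewrite /col_sum big_ord1 expr0 scale1r big_seq1 baseE // -sb.
have [cb c1 cm] := col_pivotP bb bN; set c := col_pivot _ _ in cb c1 cm *.
have dm : (0 < c.+1 <= size V)%N by [].
have [] := bounded_swap bb dm cb c1 _; first by rewrite eqxx.
rewrite (_ : minn c c.+1 = c); last by lia.
move=> bb1 sum1.
have c0 : (0 < c)%N by case/andP: bb => _ /allP/(_ _ cb)/andP[].
have okc : (0 < c < size V)%N by rewrite c0.
have [] := IH (map (swap c) b) bb1 _ _; [by rewrite size_map | by lia |].
set tw := col_tower_rec _ _ _ => oktw E; split; first by rewrite /= okc.
have [vc [vd adj]] := adjacent_exists iV okc; have [vcV vdV pc pd] := adj.
have [O [lO OE OS]] := column_step col_r col_l r p iV VC adj.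
have <- : O (col_sum base tw) = col_sum base (c :: tw).
  apply: (list_step lO OE) => [i||i].
  - apply: (@col_list_all _ _ _ _ _ _ _ _ valid_set_neg vb oktw).
    by move=> c' e; apply: valid_swap_cols.
  - by rewrite col_list_nil.
  (* [entry_val] ignores the sign flag, so [set_neg] vanishes by conversion. *)
  - by rewrite /= big_map big_cat big_filter big_map.
have [tJ tL] := twist_cols b adj.
have swc : swap c c = c.+1 by rewrite /swap eqxx.
have swd : swap c c.+1 = c by rewrite -swc swapK.
have memc : (c \in map (swap c) b) = (c.+1 \in b) by rewrite -{1}swd mem_map_swap.
have memd : (c.+1 \in map (swap c) b) = (c \in b) by rewrite -{1}swc mem_map_swap.
rewrite -E (linear_funZ lO) OS ?tJ ?tL // ?inE ?pc ?pd ?vcV ?vdV ?memc ?memd //= ?negbK //.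
- by move=> y; rewrite inE => /andP[].
- by move=> y; rewrite inE => /andP[].
Qed.

(** [h] bounds the indices at which [C0] is nonempty. Signs now belong to the summands, since row
    steps inherit them. *)
Definition row_sum C0 h tw : A := \sum_(i < (h + size tw).+1)
  (qV - q) ^+ i *: \sum_(e <- row_list C0 U tw i) (entry_sign e *: entry_val e).

Definition in_rows (a : seq nat) : {set 'I_n} := [set y | pos U y \in a].

Lemma twist_rows c vc vd a : adjacent_in U c vc vd ->
  twist vc vd (in_rows (map (swap c) a)) = in_rows a.
Proof.
by move=> adj; apply/setP=> y; rewrite !inE (pos_tperm adj) ?mem_enum // mem_map_swap.
Qed.

Lemma twistC (c d : 'I_n) (S : {set 'I_n}) : twist c d (~: S) = ~: twist c d S.
Proof. by apply/setP=> y; rewrite !inE. Qed.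

Lemma row_tower_sum C0 h S S' z f a :
  (forall i, all valid (C0 i)) -> (forall i, (h < i)%N -> C0 i = [::]) ->
  (forall a0, a0 = iota 1 r ->
     qV ^+ z *: (minor (~: in_rows a0) S' * minor (in_rows a0) S) = row_sum C0 h [::]) ->
  bounded (size U) a -> size a = r -> (sumn a <= f)%N ->
  let tw := row_tower_rec f a in
  all (fun c => 0 < c < size U)%N tw /\
  qV ^+ z *: (minor (~: in_rows a) S' * minor (in_rows a) S) = row_sum C0 h tw.
Proof.
move=> vC0 C0h baseE; elim: f a => [|f IH] a ba sa hf /=.
  (* Positions are positive, so a zero sum leaves only the empty tuple. *)
  have aE : a = iota 1 r.
    by case: a ba sa hf => [|v t] /=; [move=> _ <-|case/andP => _ /andP[]; lia].
  by split=> //; rewrite baseE.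
case: eqP => [aE|/eqP aN]; first by split=> //; rewrite baseE // -sa.
have [cS c1 c0] := row_pivotP ba aN; set c := row_pivot _ in cS c1 c0 *.
have cm : (c < size U)%N by case/andP: ba => _ /allP/(_ _ cS)/andP[].
have dm : (0 < c <= size U)%N by rewrite c0 ltnW.
have [] := bounded_swap ba dm cS c1 _; first by rewrite eqxx orbT.
rewrite (_ : minn c.+1 c = c); last by lia.
move=> ba1 sum1.
have okc : (0 < c < size U)%N by rewrite c0.
have [] := IH (map (swap c) a) ba1 _ _; [by rewrite size_map | by lia |].
set tw := row_tower_rec _ _ => oktw E; split; first by rewrite /= okc.
have iU := @increasing_enumT n.
have [vc [vd adj]] := adjacent_exists iU okc; have [vcV vdV pc pd] := adj.
have [O [lO OE OS]] := row_step row_r row_l V C r p adj.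
have <- : O (row_sum C0 h tw) = row_sum C0 h (c :: tw).
  rewrite /row_sum [size (c :: tw)]/= addnS.
  have Ot e : valid e -> O (entry_sign e *: entry_val e) =
      entry_sign (swap_rows U c e) *: entry_val (swap_rows U c e) +
      (if psi U c e then 0 else (qV - q) *: (entry_sign e *: entry_val e)).
    move=> ve; rewrite (linear_funZ lO) OE // scalerDr; congr (_ + _).
    case: ifP => _; first exact: scaler0.
    by rewrite [LHS]scalerA [RHS]scalerA mulrC.
  apply: (list_step lO Ot) => [i||i].
  - apply: (@row_list_all _ _ _ _ _ _ _ _ vC0 oktw).
    by move=> c' e; apply: valid_swap_rows.
  - by apply: row_list_nil C0h _ => /=.
  - by rewrite /= big_cat big_filter big_map.
have tI := twist_rows a adj.
have swc : swap c c = c.+1 by rewrite /swap eqxx.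
have swd : swap c c.+1 = c by rewrite -swc swapK.
have memc : (c \in map (swap c) a) = (c.+1 \in a) by rewrite -{1}swd mem_map_swap.
have memd : (c.+1 \in map (swap c) a) = (c \in a) by rewrite -{1}swc mem_map_swap.
by rewrite -E (linear_funZ lO) OS ?twistC ?tI // !inE ?pc ?pd ?negbK ?memc ?memd.
Qed.
End Towers.

(** * The expansion *)

Lemma card_set_seq (T : finType) (s : seq T) : uniq s -> #|[set y in s]| = size s.
Proof. by move=> /card_uniqP <-; rewrite cardsE. Qed.

Lemma compl_perm (T : eqType) (S X : seq T) : uniq S -> uniq X -> {subset X <= S} ->
  perm_eq (X ++ compl S X) S.
Proof.
move=> uS uX XS; apply: uniq_perm => //.
  rewrite cat_uniq uX filter_uniq // andbT; apply/hasPn => y.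
  by rewrite mem_filter => /andP[].
move=> y; rewrite mem_cat mem_filter; case yX: (y \in X) => //=.
by rewrite XS.
Qed.

Section Main.
Variables (k : fieldType) (n : nat).
Local Notation laurent := (laurent k).
Variables (A : algType laurent) (x : 'I_n -> 'I_n -> A).
Hypothesis xr : qm_rels (fun i j i' l => x i j * x i' l).
Hypothesis col_r : forall c d : 'I_n, (d = c.+1 :> nat)%N ->
  exists E, linear E /\ raising c d E (colfam x).
Hypothesis col_l : forall c d : 'I_n, (d = c.+1 :> nat)%N ->
  exists E, linear E /\ lowering c d E (colfam x).
Hypothesis row_r : forall c d : 'I_n, (d = c.+1 :> nat)%N ->
  exists E, linear E /\ raising c d E (rowfam x).
Hypothesis row_l : forall c d : 'I_n, (d = c.+1 :> nat)%N ->
  exists E, linear E /\ lowering c d E (rowfam x).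
Local Notation minor := (minor x).
Local Notation U := (enum 'I_n).
Local Notation in_rows := (@in_rows n).

Section Base.
Variables (V : seq 'I_n) (C : {set 'I_n}) (r p : nat).
Hypothesis iV : increasing V.
Hypothesis VC : forall y, y \in V -> y \notin C.
Hypothesis VCn : (size V + (#|C| + #|C|) <= n)%N.
Hypothesis rn : (r <= n)%N.
Hypothesis pV : (p <= size V)%N.

(** At the end of both towers all words are increasing and contribute no power of [-q^-1]. The rows
    and the private columns are in the order required by [minor_qcomm], whose power of [q] cancels
    [qV ^+ #|C|]. *)
Lemma base_relation (I B : seq 'I_n) (b0 : seq nat) (e := base_entry U V I B) :
  size I = r -> size B = p -> b0 = iota (size V - p).+1 p ->
  [/\ valid V r p e, [set y in eZ e] = in_rows (iota 1 r),
      [set y in eZ' e] = ~: in_rows (iota 1 r) &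
      qV ^+ #|C| *: (minor (~: in_rows (iota 1 r)) (out_cols V b0 :|: C) *
                     minor (in_rows (iota 1 r)) (in_cols V b0 :|: C))
      = entry_val x C e].
Proof.
move=> sI sB b0E; have uV := increasing_uniq iV; have uU := enum_uniq 'I_n.
have tr : transitive (fun i j : 'I_n => (i < j)%N) by move=> ? ? ?; apply: ltn_trans.
have eZE : [set y in eZ e] = in_rows (iota 1 r).
  apply/setP=> y; rewrite !inE /= in_take ?mem_enum // index_enum_ord sI.
  by rewrite mem_iota pos_enum; lia.
have eZ'E : [set y in eZ' e] = ~: in_rows (iota 1 r).
  by rewrite -eZE; apply/setP=> y; rewrite !inE mem_filter mem_enum andbT.
have in_dropV y : (y \in drop (size V - p) V) = (y \in V) && (size V - p <= index y V)%N.
  have := uV; rewrite -{1}(cat_take_drop (size V - p) V) cat_uniq => /and3P[_ /hasPn h _].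
  case yV: (y \in V); last by apply/negP => /mem_drop; rewrite yV.
  rewrite /= leqNgt -in_take //; apply/idP/idP => [/h //|yT].
  by move: yV; rewrite -{1}(cat_take_drop (size V - p) V) mem_cat (negbTE yT).
have posb y : y \in V -> (pos V y \in b0) = (size V - p <= index y V)%N.
  move=> yV; rewrite b0E mem_iota /pos; move: yV; rewrite -index_mem.
  by move: (index y V) (size V) pV => u v; lia.
have eWE : [set y in eW e] = in_cols V b0.
  apply/setP=> y; rewrite !inE /= sB in_dropV.
  by case yV: (y \in V) => //=; rewrite posb.
have eW'E : [set y in eW' e] = out_cols V b0.
  apply/setP=> y; rewrite !inE /= mem_filter sB in_dropV andbC.
  by case yV: (y \in V) => //=; rewrite posb.
split=> //.
  rewrite /valid /= !compl_perm ?take_uniq ?drop_uniq ?size_takel ?size_drop ?size_enum_ord ?sI ?sB //=;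
    last 2 first.
  - by move=> y /mem_drop.
  - by move=> y /mem_take.
  by rewrite eqxx subKn ?eqxx.
have iU := @increasing_enumT n.
rewrite /entry_val eZE eZ'E eWE eW'E.
rewrite !seq_inv_sorted ?addn0 ?expr0 ?scale1r /=; last 4 first.
- exact: sorted_filter.
- exact: drop_sorted.
- exact: sorted_filter.
- exact: take_sorted.
have RR' a a' : a \in in_rows (iota 1 r) -> a' \in ~: in_rows (iota 1 r) -> (a < a')%N.
  by rewrite !inE !mem_iota !pos_enum; lia.
have IC : (out_cols V b0 :|: C) :&: (in_cols V b0 :|: C) = C.
  apply/setP=> y; rewrite !inE; case yC: (y \in C); first by rewrite !orbT.
  by rewrite !orbF; case: (y \in V) => //=; case: (_ \in b0).
have := minor_qcomm xr col_r col_l RR' (L := out_cols V b0 :|: C) (J := in_cols V b0 :|: C).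
rewrite IC /qcomm => -> .
- by rewrite scalerA -exprMn (qVq k) expr1n scale1r.
- have dis (S : {set 'I_n}) : {subset S <= V} -> #|S :|: C| = (#|S| + #|C|)%N.
    move=> SV; rewrite cardsU (_ : S :&: C = set0) ?cards0 ?subn0 //.
    apply/setP=> y; rewrite !inE; case yS: (y \in S) => //=.
    exact/negbTE/VC/SV.
  rewrite !dis; first last.
  + by move=> y; rewrite inE => /andP[].
  + by move=> y; rewrite inE => /andP[].
  have : (#|out_cols V b0| + #|in_cols V b0|)%N = size V.
    rewrite -(card_set_seq uV) -(cardsID (in_cols V b0) [set y in V]) addnC.
    by congr (_ + _)%N; apply: eq_card => y; rewrite !inE; case: (y \in V); rewrite ?andbT ?andbF.
  by move: VCn; move: #|C| #|out_cols V b0| #|in_cols V b0| => u v w; lia.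
- move=> l j; rewrite !inE; case lC: (l \in C); rewrite ?orbT ?andbF //.
  case jC: (j \in C); rewrite ?orbT ?andbF // !orbF.
  case/andP=> _ /andP[lV lb] /andP[_ /andP[jV jb]].
  move: lb jb; rewrite !posb // -(pos_lt iV lV jV) /pos; lia.
Qed.
End Base.

Theorem quantum_minor_expansion (r s z : nat)
    (I J : r.-tuple 'I_n) (K L : s.-tuple 'I_n) (C : z.-tuple 'I_n)
    (hI : increasing I) (hJ : increasing J)
    (hK : increasing K) (hL : increasing L) (hC : increasing C)
    (hrs : (r + s = n)%N)
    (hIK : forall i, i \in I -> i \notin K)
    (hJL : forall j, (j \in C) = (j \in J) && (j \in L)) :
  let V := [seq v <- enum 'I_n | ((v \in J) || (v \in L)) && (v \notin C)] in
  let B := [seq j <- J | j \notin C] in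
  let N := size (std_row_tower U I) in
  let M := size (std_col_tower V B) in
  let minor := qminor x in
  qV ^+ z *: (minor K L * minor I J) =
    \sum_(i < (M + N).+1) (qV - q) ^+ i *:
      \sum_(e <- Clist U V I B i)
        (entry_sign e * (- qV) ^+ (tuple_inv (eW e) + tuple_inv (eW' e))) *:
        (minor (eZ e) (ord_of (eW e ++ C)) * minor (eZ' e) (ord_of (eW' e ++ C))).
Proof.
move=> V B N M qm; set Cs := [set y in C].
have iU := @increasing_enumT n.
have tr : transitive (fun i j : 'I_n => (i < j)%N) by move=> ? ? ?; apply: ltn_trans.
have iV : increasing V by apply: sorted_filter.
have iB : increasing B by apply: sorted_filter.
have uV := increasing_uniq iV; have uB := increasing_uniq iB.
have [uI uJ uK uL] := And4 (increasing_uniq hI) (increasing_uniq hJ) (increasing_uniq hK) (increasing_uniq hL).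
have uC := increasing_uniq hC.
have memV y : (y \in V) = ((y \in J) || (y \in L)) && (y \notin C).
  by rewrite mem_filter mem_enum andbT.
have memB y : (y \in B) = (y \in J) && (y \notin C) by rewrite mem_filter andbC.
have VC y : y \in V -> y \notin Cs by rewrite memV inE => /andP[].
have cC : #|Cs| = z by rewrite card_set_seq // size_tuple.
have sB : (size B + z = r)%N.
  rewrite -cC -(size_tuple J) -(card_set_seq uB) -(card_set_seq uJ).
  rewrite -(cardsID Cs [set y in J]) addnC; congr (_ + _)%N; apply: eq_card => y.
    by rewrite !inE hJL; case: (y \in J).
  by rewrite !inE memB andbC.
(* Inclusion and exclusion with [r + s = n]: as many columns lie outside [J] and [L] as in both. *)
have sV : (size V + (z + z) = n)%N.
  have cU : #|[set y in J] :|: [set y in L]| = (size V + z)%N.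
    rewrite -cC -(card_set_seq uV) -(cardsID Cs (_ :|: _)) addnC.
    congr (_ + _)%N; apply: eq_card => y; rewrite !inE ?memV ?hJL.
      by rewrite andbC.
    by case: (y \in J); case: (y \in L).
  have cI : #|[set y in J] :&: [set y in L]| = z.
    by rewrite -cC; apply: eq_card => y; rewrite !inE hJL.
  have := cardsUI [set y in J] [set y in L].
  by rewrite cU cI (card_set_seq uJ) (card_set_seq uL) !size_tuple hrs -addnA.
have zs : (z <= s)%N.
  rewrite -cC -(size_tuple L) -(card_set_seq uL); apply: subset_leq_card.
  by apply/subsetP => y; rewrite !inE hJL => /andP[].
have rn : (r <= n)%N by rewrite -hrs leq_addr.
have pV : (size B <= size V)%N by rewrite -(leq_add2r (z + z)) sV addnA sB -hrs leq_add2l.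
have VCn : (size V + (#|Cs| + #|Cs|) <= n)%N by rewrite cC sV.
have [vb _ _ baseE] := base_relation iV VC VCn rn pV (size_tuple I) (erefl _) (erefl _).
have posB : {in B &, {mono pos V : y y' / (y < y')%N}}.
  have BV : {subset B <= V} by move=> y; rewrite memB memV => /andP[-> ->].
  by move=> y y' /BV yV /BV y'V; apply: pos_lt.
have BV : {subset B <= V} by move=> y; rewrite memB memV => /andP[-> ->].
have bb : bounded (size V) (map (pos V) B).
  apply/andP; split; last first.
    by rewrite all_map; apply/allP => y /BV /pos_bound.
  rewrite sorted_map; have aB : all (mem B) B by apply/allP.
  by apply: (sub_in_sorted _ aB iB) => y y' yB y'B; rewrite /= posB.
set b := map (pos V) B in bb; set base := base_entry U V I B in vb baseE.
have fuel : (size V * size V <= size V * size V + sumn b)%N by apply: leq_addr.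
have base_b b0 : b0 = iota (size V - size B).+1 (size B) ->
    qV ^+ z *: (minor (~: in_rows (iota 1 r)) (out_cols V b0 :|: Cs) *
                minor (in_rows (iota 1 r)) (in_cols V b0 :|: Cs))
    = entry_val x Cs base.
  by move=> ->; rewrite -baseE cC.
have [okc colE] := column_tower col_r col_l iV VC vb base_b bb (size_map _ _) fuel.
set tw := col_tower_rec _ _ b in okc colE.
pose C0 := col_list base V tw.
have vC0 i : all (valid V r (size B)) (C0 i).
  apply: (@col_list_all _ _ _ _ _ _ _ _ (@valid_set_neg _ V r (size B)) vb okc).
  by move=> c e; apply: valid_swap_cols.
have C0nil i : (M < i)%N -> C0 i = [::] by apply: col_list_nil.
have base_a a0 : a0 = iota 1 r ->
    qV ^+ z *: (minor (~: in_rows a0) (out_cols V b :|: Cs) *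
                minor (in_rows a0) (in_cols V b :|: Cs)) = row_sum x Cs C0 M [::].
  move=> ->; rewrite colE /col_sum /row_sum [size [::]]/= addn0.
  apply: eq_bigr => i _ /=.
  (* At index [i] every entry of the column list has sign [(-1)^i], which turns the power of
     [q - q^-1] into that of [q^-1 - q]. *)
  have -> : \sum_(e <- C0 i) (entry_sign e *: entry_val x Cs e) =
      \sum_(e <- C0 i) ((-1) ^+ i *: entry_val x Cs e).
    apply: (all_eq_sum (@col_list_neg _ base V tw i erefl)) => e /eqP ei.
    by rewrite /entry_sign ei signr_odd.
  by rewrite -scaler_sumr scalerA -exprMn mulrN1 opprB.
have ba : bounded (size U) (map (pos U) I).
  apply/andP; split; last first.
    by rewrite all_map; apply/allP => y _; apply: pos_bound; rewrite ?mem_enum.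
  rewrite sorted_map; apply: sub_sorted hI => y y'.
  by rewrite /= !pos_enum ltnS.
have sa : size (map (pos U) I) = r by rewrite size_map size_tuple.
have [okr rowE] := row_tower_sum row_r row_l iV vC0 C0nil base_a ba sa (sumn_bounded ba).
have inI : in_rows (map (pos U) I) = [set y in I].
  apply/setP=> y; rewrite !inE; apply/mapP/idP => [[y' y'I /pos_inj e]|yI].
    by rewrite e // mem_enum.
  by exists y.
have inK : ~: [set y in I] = [set y in K].
  apply/esym/eqP; rewrite eqEcard; apply/andP; split.
    by apply/subsetP => y; rewrite !inE; apply: contraL; apply: hIK.
  rewrite (card_set_seq uK) size_tuple; have := cardsC [set y in I].
  rewrite (card_set_seq uI) size_tuple card_ord => e.
  by rewrite -(leq_add2l r) e hrs.
have inJ : in_cols V b :|: Cs = [set y in J].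
  apply/setP=> y; rewrite !inE memV /b.
  case yC: (y \in C); first by move: yC; rewrite hJL orbT => /andP[->].
  rewrite orbF andbT; case yJ: (y \in J) => /=.
    by apply/mapP; exists y; rewrite // memB yJ yC.
  apply/negP=> /andP[yL /mapP[y' y'B /esym/(pos_inj (BV _ y'B)) e]].
  by move: y'B; rewrite e memB yJ.
have inL : out_cols V b :|: Cs = [set y in L].
  apply/setP=> y; rewrite !inE memV /b.
  case yC: (y \in C); first by move: yC; rewrite hJL orbT => /andP[_ ->].
  rewrite orbF andbT; case yJ: (y \in J) => /=.
    have yL : (y \in L) = false by move: yC; rewrite hJL yJ.
    by rewrite yL map_f // memB yJ yC.
  case yL: (y \in L) => //=.
  apply/mapP=> -[y' y'B /esym/(pos_inj (BV _ y'B)) e].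
  by move: y'B; rewrite e memB yJ.
rewrite inI inK inJ inL in rowE.
rewrite /qm !qminorE ?size_tuple // !seq_inv_sorted // expr0 !scale1r rowE.
apply: eq_bigr => i _; congr (_ *: _).
have vCl i0 : all (valid V r (size B)) (Clist U V I B i0).
  apply: (@row_list_all _ _ _ _ _ _ _ _ vC0 okr).
  by move=> c e; apply: valid_swap_rows.
apply: (all_eq_sum (vCl i)) => e /and4P[hZ hW /eqP sZ /eqP sW].
have uZ : uniq (eZ e ++ eZ' e) by rewrite (perm_uniq hZ) enum_uniq.
have uW : uniq (eW e ++ eW' e) by rewrite (perm_uniq hW).
have [uZ1 uZ2] : uniq (eZ e) /\ uniq (eZ' e).
  by move: uZ; rewrite cat_uniq => /and3P[].
have [uW1 uW2] : uniq (eW e) /\ uniq (eW' e).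
  by move: uW; rewrite cat_uniq => /and3P[].
have sZZ : (size (eZ e) + size (eZ' e) = n)%N.
  by rewrite -size_cat (perm_size hZ) size_enum_ord.
have sWW : (size (eW e) + size (eW' e) = size V)%N.
  by rewrite -size_cat (perm_size hW).
have uWC X : {subset X <= eW e ++ eW' e} -> uniq X -> uniq (X ++ C).
  move=> XW uX; rewrite cat_uniq uX uC andbT; apply/hasPn => y yC.
  by apply/negP => /XW; rewrite (perm_mem hW) => /VC; rewrite inE yC.
have uWC1 : uniq (eW e ++ C) by apply: uWC => // y yW; rewrite mem_cat yW.
have uWC2 : uniq (eW' e ++ C) by apply: uWC => // y yW; rewrite mem_cat yW orbT.
have setWC X : [set y in ord_of (X ++ C)] = [set y in X] :|: Cs.
  by apply/setP=> y; rewrite !inE mem_sort mem_cat.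
have uo1 : uniq (ord_of (eW e ++ C)) by rewrite sort_uniq.
have uo2 : uniq (ord_of (eW' e ++ C)) by rewrite sort_uniq.
have s1 : size (eZ e) = size (ord_of (eW e ++ C)).
  by rewrite size_sort size_cat size_tuple sZ sW.
(* The complementary tuples also match in size, because [n] is the size of [V] plus [2 z] and [r] is
   the size of [B] plus [z]. *)
have s2 : size (eZ' e) = size (ord_of (eW' e ++ C)).
  rewrite size_sort size_cat size_tuple.
  apply: (@addnI r); rewrite -{1}sZ sZZ; apply: (etrans (esym sV)).
  by rewrite -sB -sW -sWW addnACA.
rewrite /qm (qminorE x s1 uZ1 uo1) (qminorE x s2 uZ2 uo2).
rewrite (seq_inv_sorted (increasing_ord_of uWC1)) (seq_inv_sorted (increasing_ord_of uWC2)).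
rewrite !addn0 !setWC !tuple_invE.
rewrite /entry_val -scalerAl -scalerAr !scalerA; congr (_ *: _).
rewrite -!mulrA; congr (_ * _); rewrite -!exprD; congr (_ ^+ _).
by rewrite addnC.
Qed.
End Main.

Theorem mainTheorem5 (k : fieldType) (n r s z : nat)
    (I J : r.-tuple 'I_n) (K L : s.-tuple 'I_n) (C : z.-tuple 'I_n)
    (hI : increasing I) (hJ : increasing J)
    (hK : increasing K) (hL : increasing L) (hC : increasing C)
    (hrs : (r + s = n)%N)
    (hIK : forall i, i \in I -> i \notin K)
    (hJL : forall j, (j \in C) = (j \in J) && (j \in L)) :
  let U := enum 'I_n in
  let V := [seq v <- enum 'I_n | ((v \in J) || (v \in L)) && (v \notin C)] in
  let B := [seq j <- J | j \notin C] in
  let N := size (std_row_tower U I) in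
  let M := size (std_col_tower V B) in
  let minor := qminor (@Oq_gen k n) in
  qV ^+ z *: (minor K L * minor I J) =
    \sum_(i < (M + N).+1) (qV - q) ^+ i *:
      \sum_(e <- Clist U V I B i)
        (entry_sign e * (- qV) ^+ (tuple_inv (eW e) + tuple_inv (eW' e))) *:
        (minor (eZ e) (ord_of (eW e ++ C)) * minor (eZ' e) (ord_of (eW' e ++ C))).
Proof.
have cr := col_raising (@col_raise k n); have cl := col_lowering (@col_lower k n).
have xr := @Oq_rels k n.
have rr := row_raising xr (@row_raise k n).
have rl := row_lowering xr (@row_lower k n).
exact: (quantum_minor_expansion xr cr cl rr rl hI hJ hK hL hC hrs hIK hJL).
Qed.
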